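(* Let $d\in(0,1/2)$ and let $\{X_k\}_{k\in\mathbb{Z}}$ be a $q$-variate FARIMA process with spectral density $w(e^{i\theta})=|1-e^{i\theta}|^{-2d}g(e^{i\theta})g(e^{i\theta})^*$, where the entries of $g(z)$ are rational functions of $z$ with no poles on $\overline{\mathbb{D}}$ and $\det g$ has no zeros on $\overline{\mathbb{D}}$. Let $\tilde\phi_{n,j}$ and $\tilde\phi_j$ be the backward finite and infinite predictor coefficients of $\{X_k\}$. Then there exists a positive constant $\tilde K$ such that $$\sum_{j=1}^n\|\tilde\phi_{n,j}-\tilde\phi_j\|\le\tilde K\sum_{j=n+1}^\infty\|\tilde\phi_j\|,\qquad n\in\mathbb{N}.$$
   Context: $\overline{\mathbb{D}}$ is the closed unit disk, $\mathbb{D}$ the open one, $\mathbb{T}$ the unit circle; $\|a\|$ is the spectral (operator) norm of $a\in\mathbb{C}^{q\times q}$. A $q$-variate stationary process $\{X_k\}_{k\in\mathbb{Z}}$ ($q\in\mathbb{N}$) is a $\mathbb{C}^q$-valued, centered, weakly stationary process on a probability space; it has spectral density $w$ if $w\in L_1^{q\times q}(\mathbb{T})$ is positive-semidefinite-Hermitian-valued and $E[X_mX_n^*]=\int_{-\pi}^{\pi}e^{-i(m-n)\theta}w(e^{i\theta})\frac{d\theta}{2\pi}$. A $q$-variate FARIMA process is a $q$-variate stationary process with spectral density of the form in the claim. $P_{[-n,-1]}$ denotes the orthogonal projection, applied entrywise, in the Hilbert space spanned in $L^2(\Omega,\mathcal F,P)$ by all entries of all $X_k$ (inner product $E[x\overline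 y]$) onto the linear span of the entries of $X_{-1},\dots,X_{-n}$. The backward finite predictor coefficients $\tilde\phi_{n,j}\in\mathbb{C}^{q\times q}$ ($1\le j\le n$) are the unique matrices with $P_{[-n,-1]}X_{-(n+1)}=\tilde\phi_{n,1}X_{-n}+\cdots+\tilde\phi_{n,n}X_{-1}$. There is a function $\tilde g:\mathbb{T}\to\mathbb{C}^{q\times q}$, with rational entries having no poles on $\overline{\mathbb{D}}$ and with $\det\tilde g$ having no zeros on $\overline{\mathbb{D}}$, such that $g(e^{-i\theta})g(e^{-i\theta})^*=\tilde g(e^{i\theta})\tilde g(e^{i\theta})^*$; it is unique up to a constant unitary right factor; fix one. Let $\tilde h(z)=(1-z)^{-d}\tilde g(z)$, $\tilde c_0=\tilde h(0)=\tilde g(0)$, and define $\tilde a_k\in\mathbb{C}^{q\times q}$ by $-\tilde h(z)^{-1}=\sum_{k=0}^\infty z^k\tilde a_k$, $z\in\mathbb{D}$. The backward infinite predictor coefficients are $\tilde\phi_k:=\tilde c_0\tilde a_k$, $k\in\mathbb{N}$. *)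

(* Defs.v *)
From HB Require Import structures.
From mathcomp Require Import all_boot all_order all_algebra.
From mathcomp Require Import all_classical all_reals all_analysis.
From mathcomp Require Export complex.

Set Implicit Arguments.
Unset Strict Implicit.
Unset Printing Implicit Defensive.

Import Order.TTheory GRing.Theory Num.Theory.
Import numFieldNormedType.Exports.

Local Open Scope classical_set_scope.
Local Open Scope ring_scope.
Local Open Scope sesquilinear_scope.

Section ComplexAnalysis.
Context {R : realType}.
Local Notation C := R[i].

Definition cabs (z : C) : R := Normc.normc z.

Definition unit_circle : set C := [set z | cabs z = 1].
Definition open_disk : set C := [set z | cabs z < 1].
Definition closed_disk : set C := [set z | cabs z <= 1].

Definition cexpi (t : R) : C := Complex (cos t) (sin t).

(* principal argument, in ]-pi, pi], for z != 0 *)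
Definition carg (z : C) : R :=
  if 0 <= complex.Im z then acos (complex.Re z / cabs z)
  else - acos (complex.Re z / cabs z).

(* z ^ a, principal branch, for z != 0 *)
Definition cpowR (z : C) (a : R) : C :=
  real_complex R (cabs z `^ a) * cexpi (a * carg z).

(* p / r is in lowest terms, so its poles are exactly the roots of r. *)
Definition rational_no_pole_on (D : set C) (f : C -> C) :=
  exists p r : {poly C},
    [/\ coprimep p r,
        (forall z, D z -> ~~ root r z)
      & (forall z, ~~ root r z -> f z = p.[z] / r.[z])].

Definition csummable_to (u : nat -> C) (l : C) :=
  (fun n => \sum_(0 <= k < n) u k : R[i]^o) @ \oo --> (l : R[i]^o).

Definition cintegrable (d : measure_display) (T : measurableType d)
    (mu : {measure set T -> \bar R}) (D : set T) (f : T -> C) :=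
  mu.-integrable D (fun x => (complex.Re (f x))%:E) /\
  mu.-integrable D (fun x => (complex.Im (f x))%:E).

Definition cintegral (d : measure_display) (T : measurableType d)
    (mu : {measure set T -> \bar R}) (D : set T) (f : T -> C) : C :=
  Complex (\int[mu]_(x in D) complex.Re (f x))
          (\int[mu]_(x in D) complex.Im (f x)).

End ComplexAnalysis.

Section Matrices.
Context {R : realType} {q : nat}.
Local Notation C := R[i].

Definition vnorm (v : 'cV[C]_q) : R := Num.sqrt (\sum_i cabs (v i 0) ^+ 2).

Definition opnorm (A : 'M[C]_q) : R :=
  sup [set vnorm (A *m v) | v in [set v : 'cV[C]_q | vnorm v <= 1]].

(* [0 <= z] in R[i] means that z is real and nonnegative. *)
Definition psd_hermitian (A : 'M[C]_q) : Prop :=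
  A \is hermsymmx /\ forall v : 'cV[C]_q, 0 <= (v^t* *m A *m v) 0 0.

End Matrices.

Section Processes.
Context {R : realType} {disp : measure_display} {Omega : measurableType disp}.
Variable P : probability Omega R.
Local Notation C := R[i].

Definition cL2 (x : Omega -> C) : Prop :=
  (fun o => complex.Re (x o)) \in Lfun P 2%:E /\
  (fun o => complex.Im (x o)) \in Lfun P 2%:E.

Definition cexpectation (x : Omega -> C) : C := cintegral P setT x.

Definition cinner (x y : Omega -> C) : C :=
  cexpectation (fun o => x o * (y o)^*).

(* y is (a representative of) the orthogonal projection of x onto V *)
Definition is_orth_proj (V : set (Omega -> C)) (x y : Omega -> C) :=
  V y /\ forall v, V v -> cinner (fun o => x o - y o) v = 0.

Context {q : nat}.
Implicit Type X : int -> Omega -> 'cV[C]_q.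

(* E[X_m X_n^*] *)
Definition covmx X (m n : int) : 'M[C]_q :=
  \matrix_(i, j) cinner (fun o => X m o i 0) (fun o => X n o j 0).

Definition centered_weakly_stationary X :=
  [/\ (forall k i, cL2 (fun o => X k o i 0)),
      (forall k i, cexpectation (fun o => X k o i 0) = 0)
    & (forall m n k, covmx X (m + k) (n + k) = covmx X m n)].

(* Functions on the unit circle are functions on C restricted to it. *)
Definition has_spectral_density X (w : C -> 'M[C]_q) :=
  [/\ (forall i j, cintegrable (@lebesgue_measure R) `[- pi, pi]%classic
         (fun t => w (cexpi t) i j)),
      {ae (@lebesgue_measure R), forall t,
         `[- pi, pi]%classic t -> psd_hermitian (w (cexpi t))}
    & (forall (m n : int) i j,
         covmx X m n i j =
         real_complex R (2 * pi)^-1 *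
         cintegral (@lebesgue_measure R) `[- pi, pi]%classic
           (fun t => cexpi (- ((m - n)%:~R * t)) * w (cexpi t) i j))].

(* linear span of the entries of X_{-1}, ..., X_{-n} *)
Definition past_span X (n : nat) : set (Omega -> C) :=
  [set y | exists c : nat -> 'I_q -> C,
     y = fun o => \sum_(1 <= k < n.+1) \sum_i c k i * X (- k%:Z) o i 0].

(* P_[-n,-1] X_{-(n+1)} = phi_1 X_{-n} + ... + phi_n X_{-1} *)
Definition backward_finite_predictor X (n : nat) (phi : nat -> 'M[C]_q) :=
  forall i, is_orth_proj (past_span X n)
    (fun o => X (- n.+1%:Z) o i 0)
    (fun o =>
       (\sum_(1 <= j < n.+1) phi j *m X (- (n.+1 - j)%N%:Z) o) i 0).

End Processes.

Section FARIMA.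
Context {R : realType} {q : nat}.
Local Notation C := R[i].
Implicit Types (d : R) (g : C -> 'M[C]_q).

Definition rational_invertible_on_disk g :=
  (forall i j, rational_no_pole_on closed_disk (fun z => g z i j)) /\
  (forall z, closed_disk z -> \det (g z) != 0).

(* The value at the singularity z = 1 is junk; it is a null set. *)
Definition farima_density d g (z : C) : 'M[C]_q :=
  real_complex R (cabs (1 - z) `^ (- (2 * d))) *: (g z *m (g z)^t*).

Definition farima_h d g (z : C) : 'M[C]_q := cpowR (1 - z) (- d) *: g z.

(* - h(z)^{-1} = \sum_k z^k a_k on the open unit disk *)
Definition ar_coefficients (h : C -> 'M[C]_q) (a : nat -> 'M[C]_q) :=
  forall z, open_disk z ->
  forall i j, csummable_to (fun k => z ^+ k * a k i j) ((- invmx (h z)) i j).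

Definition infinite_predictor (h : C -> 'M[C]_q) (a : nat -> 'M[C]_q)
  (k : nat) : 'M[C]_q := h 0 *m a k.

End FARIMA.

(* Main.v *)
(* Prediction from the past amounts to solving block Toeplitz systems with symbol w.  On a
   half line such systems are solved explicitly by a kernel K(s, y), built from the
   coefficients of (1 - z)^(-d), of gtilde and of their inverses; K(1, y) is the infinite
   predictor coefficient of index y + 1, and g plays the role of gtilde for the reversed
   half line.  On {0, ..., n - 1} let b_s solve the system whose right-hand side is the column
   at distance s to the left, and b'_s the mirrored one; then
     b_s = K(s, .) + sum_(y >= n) K(s, y) b'_(y - n + 1),
   and symmetrically with the roles of left and right exchanged.
     Up to absolutely summable matrix corrections K(s, y) is the scalar kernel
   s c_s b_y / (s + y), where c and b are the coefficients of (1 - z)^(-d) and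
   (1 - z)^(d - 1).  With the weight f(k) = c_k / nbinom (1/2) k, summing this kernel over
   y >= n against f gives at most 4 d (1 - d) f(s + n), and 4 d (1 - d) < 1.  So a bound
   sum_j |b'_s(j)| <= A f(s + n) / f(n) yields the same bound for b with
   C + (4 d (1 - d) + o(1)) A in place of A.  Some finite A exists for each n, hence one A
   serves for all n; in particular the norms of the b'_s are bounded uniformly in s and n.
     Baxter's inequality is then the displayed expansion at s = 1, where b_1 is the finite
   predictor and b_1 - K(1, .) only involves K(1, y) with y >= n.
     That the covariances are the block Toeplitz entries of the two factorizations follows
   from the recurrence (k + 1 - d) I_(k+1) = (k + d) I_k, obeyed both by the Fourier
   coefficients of |1 - e^(it)|^(-2d) and by the autocorrelations of c. *)
From HB Require Import structures.
Require Import Defs.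
From mathcomp Require Import all_boot all_order all_algebra.
From mathcomp Require Import all_classical all_reals all_analysis.
From mathcomp Require Import ring lra zify.
Import Order.TTheory GRing.Theory Num.Theory.
Import numFieldNormedType.Exports.
Local Open Scope classical_set_scope.
Local Open Scope ring_scope.
Local Open Scope sesquilinear_scope.
Set Implicit Arguments.
Unset Strict Implicit.
Unset Printing Implicit Defensive.

(** * The scalar fractional kernel *)

Section NegativeBinomial.
Context {R : realFieldType}.
Implicit Types (d : R) (k s y n : nat).

(** Alternating between the two half lines does not contract in the unweighted l1 norm: every full
    scalar row sums to 1, and for large s nearly all of that mass sits at y >= n. The weight removes
    this by comparison with the exponent 1/2. It turns c_s into [nbinom half s] up to the factor
    f(s), and it turns b_y into at most 4 d (1 - d) [nbinom half y]; a weighted row of exponent d is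
    therefore dominated by a small multiple of a row of exponent 1/2, whose sum is again at most 1.
    No uniform bound on the inverses of the finite Toeplitz matrices is available beforehand. For
    each n, invertibility alone gives some constant, however large; iterating an affine map whose
    fixed point does not involve n then discards it. A dimension factor in front of the scalar
    kernel would destroy the rate. So K is split into a scalar matrix, which acts on matrices with
    exactly its scalar size, and a correction whose tails vanish and may carry any constant. *)

Definition nbinom d k : R := \prod_(i < k) ((i%:R + d) / i.+1%:R).

Lemma nbinom0 d : nbinom d 0 = 1.
Proof. by rewrite /nbinom big_ord0. Qed.

Lemma nbinomS d k : nbinom d k.+1 = nbinom d k * ((k%:R + d) / k.+1%:R).
Proof. by rewrite /nbinom big_ord_recr. Qed.

Lemma nbinom_gt0 d k : 0 < d -> 0 < nbinom d k.
Proof.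
move=> d0; apply: prodr_gt0 => i _; rewrite divr_gt0 ?ltr0n//.
by rewrite ltr_wpDl.
Qed.

Lemma nbinomS_mul d k : k.+1%:R * nbinom d k.+1 = (k%:R + d) * nbinom d k.
Proof. by rewrite nbinomS; field; rewrite nat1r pnatr_eq0. Qed.

Lemma nbinom_antitone d k l : 0 < d <= 1 -> (k <= l)%N -> nbinom d l <= nbinom d k.
Proof.
move=> /andP[d0 d1] /subnK <-; elim: (l - k)%N => [|m IH]; first by rewrite add0n.
apply: le_trans IH; rewrite addSn nbinomS ger_pMr ?nbinom_gt0//.
by rewrite ler_pdivrMr ?ltr0n// mul1r -[in leRHS]natr1 lerD2l.
Qed.

Lemma nbinom_le1 d k : 0 < d <= 1 -> nbinom d k <= 1.
Proof. by move=> d01; rewrite -(nbinom0 d) nbinom_antitone. Qed.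

Lemma mul_nbinom_homo d k l : 0 < d -> (k <= l)%N ->
  k%:R * nbinom d k <= l%:R * nbinom d l.
Proof.
move=> d0 /subnK <-; elim: (l - k)%N => [|m IH]; first by rewrite add0n.
apply: (le_trans IH); rewrite addSn nbinomS_mul ler_wpM2r//.
  exact/ltW/nbinom_gt0.
by rewrite lerDl ltW.
Qed.

(** Since [k * nbinom d k] increases, moving back by [i] places costs a factor (i + k) / k <= i + 1,
    a polynomial loss that geometric decay absorbs later. The division by [d] pays for [k = 0],
    where the monotone quantity vanishes and the comparison starts at index 1. *)
Lemma nbinom_backward d k i : 0 < d <= 1 ->
  nbinom d k <= i.+1%:R / d * nbinom d (i + k).
Proof.
move=> /andP[d0 d1].
have ik0 := nbinom_gt0 (i + k) d0.
case: k ik0 => [|k] ik0.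
  rewrite nbinom0 addn0; case: i ik0 => [|i] ik0.
    by rewrite nbinom0 mulr1 mul1r invf_ge1.
  have := @mul_nbinom_homo d 1 i.+1 d0 isT.
  rewrite mul1r nbinomS nbinom0 mul1r add0r divr1 => h.
  rewrite addn0 in ik0.
  rewrite mulrAC ler_pdivlMr// mul1r (le_trans h)// ler_wpM2r// ?ler_nat//.
  exact: ltW.
have := @mul_nbinom_homo d k.+1 (i + k.+1) d0 (leq_addl _ _).
rewrite -ler_pdivlMl ?ltr0n// => h; apply: (le_trans h).
rewrite mulrA ler_wpM2r ?(ltW ik0)// mulrC ler_pdivrMr ?ltr0n//.
rewrite mulrAC ler_pdivlMr//.
apply: (@le_trans _ _ ((i + k.+1)%:R * 1)).
  by rewrite ler_wpM2l.
by rewrite mulr1 -natrM ler_nat; nia.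
Qed.

Lemma nbinomN d k : nbinom (- d) k.+1 = - (d / k.+1%:R * nbinom (1 - d) k).
Proof.
elim: k => [|k IH]; first by rewrite nbinomS !nbinom0; ring.
rewrite nbinomS IH [nbinom (1 - d) k.+1]nbinomS.
rewrite -!natr1; field.
by rewrite !natr1 !pnatr_eq0.
Qed.

Lemma sum_nbinomN d k : \sum_(i < k.+1) nbinom (- d) i = nbinom (1 - d) k.
Proof.
elim: k => [|k IH]; first by rewrite big_ord1 !nbinom0.
rewrite big_ord_recr/= IH nbinomN nbinomS -!natr1; field.
by rewrite ?natr1 ?nat1r ?pnatr_eq0.
Qed.

Lemma nbinomN_le0 d k : 0 < d < 1 -> nbinom (- d) k.+1 <= 0.
Proof.
move=> /andP[d0 d1]; rewrite nbinomN oppr_le0 mulr_ge0//.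
  by rewrite divr_ge0 ?ltW.
by rewrite ltW// nbinom_gt0// subr_gt0.
Qed.

(** Only the coefficient of index 0 of (1 - z)^d is positive. Its partial sums stay nonnegative,
    being coefficients of (1 - z)^(d - 1), so the negative terms weigh at most 1 in total. *)
Lemma sum_norm_nbinomN d k : 0 < d < 1 -> \sum_(i < k) `|nbinom (- d) i| <= 2.
Proof.
move=> d01; case: k => [|k]; first by rewrite big_ord0.
rewrite big_ord_recl nbinom0 normr1.
have := sum_nbinomN d k; rewrite big_ord_recl nbinom0 => h.
have : nbinom (1 - d) k >= 0 by apply/ltW/nbinom_gt0; lra.
rewrite -h => {}h.
under eq_bigr do rewrite ler0_norm ?nbinomN_le0//.
by rewrite sumrN; lra.
Qed.

(** A truncated Vandermonde convolution of (1 - z)^(-d) with (1 - z)^d, summed in closed form by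
    induction on the truncation. At [y = N] it vanishes, which is the inverse relation [nbinom_inv];
    at [N = s + y] it is the scalar kernel. *)
Lemma frac_conv d N y : (y <= N)%N -> (0 < N)%N ->
  \sum_(i < y.+1) nbinom d (N - i) * nbinom (- d) i =
  (N - y)%:R * nbinom d (N - y) * nbinom (1 - d) y / N%:R.
Proof.
move=> yN N0; have Nn0 : N%:R != 0 :> R by rewrite pnatr_eq0 -lt0n.
elim: y yN => [|y IH] yN.
  by rewrite big_ord1 subn0 !nbinom0; field.
rewrite big_ord_recr/= IH ?(ltnW yN)// nbinomN (nbinomS (1 - d)).
have -> : (N - y = (N - y.+1).+1)%N by rewrite subnSK.
rewrite nbinomS_mul; set m := (N - y.+1)%N.
have -> : N%:R = m%:R + y%:R + 1 :> R by rewrite -natrD natr1; congr (_%:R); rewrite /m; lia.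
rewrite -!natr1; field.
by rewrite -natrD !natr1 !pnatr_eq0.
Qed.

Definition frac_kernel d s y : R :=
  s%:R * nbinom d s * nbinom (1 - d) y / (s + y)%:R.

Lemma frac_kernel_conv d s y : (0 < s)%N ->
  \sum_(i < y.+1) nbinom d (s + (y - i)) * nbinom (- d) i = frac_kernel d s y.
Proof.
move=> s0; have := @frac_conv d (s + y) y (leq_addl _ _).
rewrite addnK addn_gt0 s0 => /(_ isT); rewrite /frac_kernel => <-.
by apply: eq_bigr => i _; rewrite addnBA// -ltnS.
Qed.

Lemma nbinom_inv d y : \sum_(i < y.+1) nbinom d (y - i) * nbinom (- d) i = (y == 0)%:R.
Proof.
case: y => [|y]; first by rewrite big_ord1 !nbinom0 mulr1.
by rewrite (@frac_conv d y.+1 y.+1)// subnn !mul0r.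
Qed.

Lemma frac_kernel_ge0 d s y : 0 < d < 1 -> 0 <= frac_kernel d s y.
Proof.
move=> /andP[d0 d1]; rewrite divr_ge0// !mulr_ge0//.
  by rewrite ltW// nbinom_gt0.
by rewrite ltW// nbinom_gt0// subr_gt0.
Qed.

(** Row s + 1 is row s shifted by one index, minus [nbinom d s * nbinom (- d) y.+1]. The shift loses
    the entry [frac_kernel d s 0 = nbinom d s], and this is what the subtracted coefficients give
    back at most. The bound thus propagates from row 1, which consists of the coefficients of 1 - (1
    - z)^d. *)
Lemma sum_frac_kernel_le1 d s n : 0 < d < 1 -> (0 < s)%N ->
  \sum_(y < n) frac_kernel d s y <= 1.
Proof.
move=> d01; have [d0 d1] := andP d01; case: s => // s _.
elim: s n => [|s IH] n.
  have b0 : 0 <= nbinom (1 - d) n by apply/ltW/nbinom_gt0; lra.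
  have := sum_nbinomN d n; rewrite big_ord_recl nbinom0 => h.
  rewrite (eq_bigr (fun i : 'I_n => - nbinom (- d) (lift ord0 i))); last first.
    move=> i _; rewrite /frac_kernel nbinomS nbinom0 add1n /=.
    rewrite /bump leq0n add1n nbinomN opprK add0r divr1; field; rewrite ?nat1r ?pnatr_eq0//.
  by rewrite sumrN; lra.
have b0 : 0 <= nbinom (1 - d) n by apply/ltW/nbinom_gt0; lra.
have c0 : 0 <= nbinom d s.+1 by apply/ltW/nbinom_gt0.
have step y : frac_kernel d s.+2 y =
    frac_kernel d s.+1 y.+1 - nbinom d s.+1 * nbinom (- d) y.+1.
  rewrite -!frac_kernel_conv// [in RHS]big_ord_recr/= subnn addn0 addrK.
  apply: eq_bigr => i _; congr (nbinom d _ * _).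
  by rewrite addSn -addnS -subSn// -ltnS.
rewrite (eq_bigr (fun i : 'I_n => frac_kernel d s.+1 i.+1 -
   nbinom d s.+1 * nbinom (- d) i.+1)) => [|i _]; last exact: step.
rewrite sumrB -mulr_sumr.
have := sum_nbinomN d n; rewrite big_ord_recl nbinom0 => h.
have := IH n.+1; rewrite big_ord_recl => h2.
have e : frac_kernel d s.+1 0 = nbinom d s.+1.
  by rewrite /frac_kernel nbinom0 addn0; field; rewrite ?natr1 ?nat1r ?pnatr_eq0.
rewrite e in h2.
have -> : \sum_(i < n) nbinom (- d) i.+1 = nbinom (1 - d) n - 1 by rewrite -h addrC addKr.
have : 0 <= nbinom d s.+1 * nbinom (1 - d) n by rewrite mulr_ge0.
rewrite mulrBr mulr1.
move: h2; rewrite (eq_bigr (fun i : 'I_n => frac_kernel d s.+1 i.+1)) => [|i _].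
  by lra.
by rewrite lift0.
Qed.

Definition half : R := 2^-1.

Lemma half_gt0 : 0 < half. Proof. by rewrite /half; lra. Qed.
Lemma half_lt1 : half < 1. Proof. by rewrite /half; lra. Qed.
Lemma half_compl : 1 - half = half. Proof. by rewrite /half; lra. Qed.

Lemma nbinom_half_gt0 k : 0 < nbinom half k.
Proof. exact/nbinom_gt0/half_gt0. Qed.

(** The weight f, of order k^(d - 1/2), as a product of ratios so that monotonicity is read off
    factor by factor; [frac_weight_nbinom] gives the quotient form. *)
Definition frac_weight d k : R := \prod_(i < k) ((i%:R + d) / (i%:R + half)).

Lemma frac_weight0 d : frac_weight d 0 = 1.
Proof. by rewrite /frac_weight big_ord0. Qed.

Lemma frac_weightS d k : frac_weight d k.+1 =
  frac_weight d k * ((k%:R + d) / (k%:R + half)).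
Proof. by rewrite /frac_weight big_ord_recr. Qed.

Lemma frac_weight_gt0 d k : 0 < d -> 0 < frac_weight d k.
Proof.
move=> d0; apply: prodr_gt0 => i _; have h0 := half_gt0.
by rewrite divr_gt0 ?ltr_wpDl.
Qed.

Lemma frac_weight_nbinom d k : frac_weight d k * nbinom half k = nbinom d k.
Proof.
elim: k => [|k IH]; first by rewrite frac_weight0 !nbinom0 mulr1.
rewrite frac_weightS !nbinomS mulrACA IH; congr (_ * _).
have k0 : 0 <= k%:R :> R by [].
by have h0 := half_gt0; rewrite mulrA divfK// gt_eqF//; lra.
Qed.

Lemma frac_weight_antitone d k l : 0 < d <= 2^-1 -> (k <= l)%N ->
  frac_weight d l <= frac_weight d k.
Proof.
move=> /andP[d0 d1] /subnK <-; elim: (l - k)%N => [|m IH]; first by rewrite add0n.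
apply: le_trans IH; rewrite addSn frac_weightS ger_pMr ?frac_weight_gt0//.
have m0 : 0 <= (m + k)%:R :> R by [].
by rewrite ler_pdivrMr ?mul1r ?lerD2l//; rewrite ?/half; lra.
Qed.

Lemma frac_weight_le1 d k : 0 < d <= 2^-1 -> frac_weight d k <= 1.
Proof.
move=> h; have := frac_weight_antitone h (leq0n k).
by rewrite frac_weight0.
Qed.

Lemma mul_frac_weight_homo d k l : 0 < d -> (k <= l)%N ->
  k%:R * frac_weight d k <= l%:R * frac_weight d l.
Proof.
move=> d0 /subnK <-; elim: (l - k)%N => [|m IH]; first by rewrite add0n.
apply: (le_trans IH); rewrite addSn frac_weightS.
have m0 : 0 <= (m + k)%:R :> R by [].
rewrite [leRHS]mulrCA [leLHS]mulrC ler_pM2l ?frac_weight_gt0//.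
rewrite mulrA ler_pdivlMr; last by rewrite ?/half; lra.
by rewrite -natr1; (rewrite ?/half; nra).
Qed.

Lemma frac_weightD d k l : 0 < d -> (0 < k)%N -> (l <= k)%N ->
  frac_weight d k <= 2 * frac_weight d (l + k).
Proof.
move=> d0 k0 lk; have := mul_frac_weight_homo d0 (leq_addl l k).
rewrite -ler_pdivlMl ?ltr0n// => h; apply: (le_trans h).
rewrite mulrA ler_wpM2r ?(ltW (frac_weight_gt0 _ d0))//.
rewrite mulrC ler_pdivrMr ?ltr0n// -natrM ler_nat; lia.
Qed.

(** Each factor (i + d) / (i + 1/2) is at least 2 d, its value at [i = 0]. The loss is exponential
    in [n], which is harmless in the a priori bound, where [n] is fixed. *)
Lemma frac_weight_shift d k n : 0 < d <= 2^-1 ->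
  frac_weight d k * (2 * d) ^+ n <= frac_weight d (k + n).
Proof.
move=> /andP[d0 d1]; elim: n => [|n IH]; first by rewrite addn0 expr0 mulr1.
rewrite addnS exprSr mulrA frac_weightS; apply: ler_pM => //.
- by rewrite mulr_ge0 ?exprn_ge0 ?(ltW (frac_weight_gt0 _ d0)); rewrite ?/half; lra.
- by rewrite ?/half; lra.
have m0 : 0 <= (k + n)%:R :> R by [].
by rewrite ler_pdivlMr; (rewrite ?/half; nra).
Qed.

Definition frac_rate d : R := 4 * d * (1 - d).

Lemma nbinom_ratio d y : 0 < d < 2^-1 -> (0 < y)%N ->
  nbinom (1 - d) y * frac_weight d y <= frac_rate d * nbinom half y.
Proof.
move=> /andP[d0 d1]; case: y => // y _.
elim: y => [|y IH].
  (* The value of [frac_rate] comes from here: it makes the case of index 1 an equality, (1 - d) 2 d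
     = 4 d (1 - d) / 2. *)
  rewrite frac_weightS frac_weight0 !nbinomS !nbinom0 /frac_rate !add0r !mul1r !divr1.
  by rewrite le_eqVlt; apply/orP; left; apply/eqP; rewrite /half; field.
have h0 := nbinom_half_gt0 y.+1.
have hp := half_gt0.
rewrite nbinomS frac_weightS (nbinomS half).
set k := y.+1%:R; have k0 : 0 <= k :> R by [].
have -> : y.+2%:R = k + 1 :> R by rewrite -natr1.
apply: (@le_trans _ _ ((frac_rate d * nbinom half y.+1) * (((k + (1 - d)) / (k + 1)) * ((k + d) / (k + half))))).
  rewrite mulrACA ler_wpM2r//.
  by rewrite !mulr_ge0 ?invr_ge0//; rewrite ?/half; lra.
rewrite -mulrA ler_wpM2l//; first by rewrite /frac_rate; (rewrite ?/half; nra).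
rewrite ler_pM2l//.
rewrite mulf_div ler_pdivrMr ?mulr_gt0//; last 2 first.
- by rewrite ?/half; lra.
- by rewrite ?/half; lra.
have -> : (k + half) / (k + 1) * ((k + 1) * (k + half)) = (k + half) ^+ 2.
  by field; rewrite gt_eqF//; lra.
have := sqr_ge0 (d - half).
by (rewrite ?/half; nra).
Qed.

(** This version includes [y = 0], where the ratio equals 1 and no smaller rate is possible; the
    contraction therefore has to start at [n > 0]. *)
Lemma nbinom_ratio_le d y : 0 < d < 2^-1 ->
  nbinom (1 - d) y * frac_weight d y <= nbinom half y.
Proof.
move=> d01; case: y => [|y]; first by rewrite frac_weight0 !nbinom0 mulr1.
apply: (le_trans (nbinom_ratio d01 (ltn0Sn y))).
rewrite ler_piMl//; first exact/ltW/nbinom_half_gt0.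
by rewrite /frac_rate; move: d01 => /andP[]; (rewrite ?/half; nra).
Qed.

(* With this weight the tail of the kernel contracts, because
   (k - d) (k - 1 + d) <= (k - 1/2)^2 factor by factor. *)
Lemma frac_kernel_contraction d s n m : 0 < d < 2^-1 -> (0 < s)%N -> (0 < n)%N ->
  \sum_(n <= y < m) frac_kernel d s y * frac_weight d y.+1
   <= frac_rate d * frac_weight d (s + n).
Proof.
move=> d01 s0 n0; have [d0 d1] := andP d01.
have th0 : 0 <= frac_rate d by rewrite /frac_rate; (rewrite ?/half; nra).
have fw k : 0 < frac_weight d k by exact: frac_weight_gt0.
(* The comparison row has exponent 1/2 and is based at [s + n] with column [y - n], so its
   denominators [s + y] agree with those on the left. *)
apply: (@le_trans _ _ (\sum_(n <= y < m)
    frac_rate d * frac_weight d (s + n) * frac_kernel half (s + n) (y - n))); last first.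
  rewrite -mulr_sumr ler_piMr//; first by rewrite mulr_ge0// ltW.
  rewrite -{1}(add0n n) big_addn big_mkord.
  under eq_bigr do rewrite addnK.
  by apply: sum_frac_kernel_le1; rewrite ?half_gt0 ?half_lt1// addn_gt0 s0.
rewrite big_seq_cond [leRHS]big_seq_cond; apply: ler_sum => y.
rewrite mem_index_iota andbT => /andP[ny ym].
have y0 : (0 < y)%N by exact: leq_trans ny.
rewrite /frac_kernel half_compl.
have -> : (s + n + (y - n) = s + y)%N by lia.
rewrite mulrAC !mulrA ler_wpM2r ?invr_ge0//.
have e : frac_weight d (s + n) * nbinom half (s + n) = nbinom d (s + n).
  exact: frac_weight_nbinom.
apply: (@le_trans _ _ (s%:R * nbinom d s * (frac_rate d * nbinom half y))).
  rewrite -[leLHS]mulrA; apply: ler_wpM2l.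
    by rewrite mulr_ge0// ltW// nbinom_gt0.
  apply: le_trans (nbinom_ratio d01 y0).
  rewrite ler_wpM2l//; first by rewrite ltW// nbinom_gt0//; rewrite ?/half; lra.
  by rewrite frac_weight_antitone//; rewrite ?/half; lra.
have -> : frac_rate d * frac_weight d (s + n) * (s + n)%:R *
   nbinom half (s + n) * nbinom half (y - n) =
   ((s + n)%:R * nbinom d (s + n)) * (frac_rate d * nbinom half (y - n)).
  by rewrite -e; ring.
apply: ler_pM.
- by rewrite mulr_ge0// ltW// nbinom_gt0.
- by apply: mulr_ge0 => //; exact/ltW/nbinom_half_gt0.
- by rewrite mul_nbinom_homo// leq_addr.
by rewrite ler_wpM2l// nbinom_antitone ?leq_subr//; rewrite ?/half; lra.
Qed.

(** For [s <= n] the row sum is at most 1, and passing from f(n) to f(s + n) costs a factor 2. For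
    [s > n] the weight moves inside the sum by f(n) <= f(y), where it turns the row into at most
    f(s) times a row of exponent 1/2. *)
Lemma frac_weight_sum_kernel d s n : 0 < d < 2^-1 -> (0 < s)%N -> (0 < n)%N ->
  frac_weight d n * \sum_(y < n) frac_kernel d s y <= 2 * frac_weight d (s + n).
Proof.
move=> d01 s0 n0; have [d0 d1] := andP d01.
have fw k : 0 < frac_weight d k by exact: frac_weight_gt0.
have [sn|ns] := leqP s n.
  apply: le_trans (frac_weightD d0 n0 sn).
  by rewrite ler_piMr ?(ltW (fw _))// sum_frac_kernel_le1//; rewrite ?/half; lra.
rewrite addnC; apply: le_trans (frac_weightD d0 s0 (ltnW ns)).
apply: (@le_trans _ _ (\sum_(y < n) frac_weight d s * frac_kernel half s y)); last first.
  by rewrite -mulr_sumr ler_piMr ?(ltW (fw _))// sum_frac_kernel_le1// half_gt0 half_lt1.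
rewrite mulr_sumr; apply: ler_sum => y _.
apply: (@le_trans _ _ (frac_weight d y * frac_kernel d s y)).
  rewrite ler_wpM2r ?frac_kernel_ge0//; first (rewrite ?/half; lra).
  by rewrite frac_weight_antitone//; [(rewrite ?/half; lra)|exact: ltnW].
rewrite /frac_kernel half_compl !mulrA ler_wpM2r ?invr_ge0//.
have e : frac_weight d s * nbinom half s = nbinom d s.
  exact: frac_weight_nbinom.
have -> : frac_weight d y * s%:R * nbinom d s * nbinom (1 - d) y =
  s%:R * nbinom d s * (nbinom (1 - d) y * frac_weight d y) by ring.
have -> : frac_weight d s * s%:R * nbinom half s * nbinom half y =
  s%:R * nbinom d s * nbinom half y by rewrite -e; ring.
rewrite ler_wpM2l ?nbinom_ratio_le//.
by rewrite mulr_ge0// ltW// nbinom_gt0.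
Qed.

Lemma nbinom_frac_weight d s n : 0 < d < 2^-1 -> (0 < s)%N -> (0 < n)%N ->
  nbinom d s * frac_weight d n <= 2 * frac_weight d (s + n).
Proof.
move=> d01 s0 n0; have [d0 d1] := andP d01.
have fw k : 0 < frac_weight d k by exact: frac_weight_gt0.
have [sn|ns] := leqP s n.
  apply: le_trans (frac_weightD d0 n0 sn).
  by rewrite ler_piMl ?(ltW (fw _))// nbinom_le1//; rewrite ?/half; lra.
rewrite addnC; apply: le_trans (frac_weightD d0 s0 (ltnW ns)).
have e : frac_weight d s * nbinom half s = nbinom d s.
  exact: frac_weight_nbinom.
rewrite -e -mulrA ler_piMr ?(ltW (fw _))//.
rewrite mulr_ile1 ?(ltW (fw _)) ?(ltW (nbinom_half_gt0 _))//.
  by rewrite nbinom_le1// half_gt0 ltW ?half_lt1.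
by rewrite frac_weight_le1//; rewrite ?/half; lra.
Qed.

End NegativeBinomial.

(** * Autocorrelations of the binomial coefficients *)

Lemma sum_nat_diff (V : zmodType) (u : nat -> V) n m : (n <= m)%N ->
  \sum_(n <= k < m) u k = \sum_(k < m) u k - \sum_(k < n) u k.
Proof.
by move=> nm; rewrite -!(big_mkord xpredT u) (big_cat_nat (leq0n n) nm)/= addrAC subrr add0r.
Qed.

Section Tails.
Context {R : realType}.
Implicit Types (u v tau : nat -> R).

Lemma sum_tail u (B : R) : (forall k, 0 <= u k) ->
    (forall n, \sum_(k < n) u k <= B) ->
  exists tau : nat -> R, [/\ tau @ \oo --> (0 : R),
    (forall n, 0 <= tau n <= B), (forall n m, (n <= m)%N -> tau m <= tau n)
    & forall n m, (n <= m)%N -> \sum_(n <= k < m) u k <= tau n].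
Proof.
move=> u0 uB; pose P n := \sum_(k < n) u k.
have Pnd : nondecreasing_seq P.
  apply/nondecreasing_seqP => n; rewrite /P big_ord_recr/=.
  by rewrite lerDl.
have Pcvg : cvgn P.
  apply: nondecreasing_is_cvgn => //.
  by exists B => _ [n _ <-]; exact: uB.
have Ple n : P n <= limn P by exact: nondecreasing_cvgn_le.
have limB : limn P <= B by apply: limr_le => //; near=> n; exact: uB.
exists (fun n => limn P - P n); split.
- rewrite -(subrr (limn P)); apply: cvgB; [exact: cvg_cst|exact: Pcvg].
- move=> n; rewrite subr_ge0 Ple/= lerBlDr (le_trans limB)// lerDl.
  by rewrite sumr_ge0.
- by move=> n m nm; rewrite lerB// Pnd.
by move=> n m nm; rewrite sum_nat_diff// lerB// Ple.
Unshelve. all: by end_near. Qed.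

Lemma cvg_natB (tau : nat -> R) k : tau @ \oo --> (0 : R) ->
  (fun n => tau (n - k)%N) @ \oo --> (0 : R).
Proof.
move=> h; rewrite -(cvg_shiftn k)/=.
by under eq_fun do rewrite addnK.
Qed.

Lemma cvg_half_nat (tau : nat -> R) : tau @ \oo --> (0 : R) ->
  (fun n => tau n./2) @ \oo --> (0 : R).
Proof.
move=> /cvgrPdist_le h; apply/cvgrPdist_le => e e0.
have [N _ hN] := h e e0; exists N.*2 => // n /= Nn; apply: hN => /=.
by rewrite -(doubleK N); exact: half_leq.
Qed.

(** Split at n / 2: below it the null sequence is evaluated far out, above it the tail of the
    summable sequence is small. *)
Lemma conv_l1_c0 v tau (B : R) k : (forall p, 0 <= v p) ->
    (forall n, \sum_(p < n) v p <= B) -> tau @ \oo --> (0 : R) ->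
    (forall n, 0 <= tau n) -> (forall n m, (n <= m)%N -> tau m <= tau n) ->
  (fun n => \sum_(p < n) v p * tau (n - k - p)%N) @ \oo --> (0 : R).
Proof.
move=> v0 vB tau0 tauge taud.
have [rho [rho0 rhoge _ hrho]] := sum_tail v0 vB.
have B0 : 0 <= B by have := vB 0%N; rewrite big_ord0.
apply: (@squeeze_cvgr _ _ _ _ (fun=> 0)
   (fun n => B * tau (n./2 - k)%N + tau 0%N * rho n./2)).
- apply: nearW => n; rewrite sumr_ge0/=; last by move=> i _; rewrite mulr_ge0.
  rewrite -(big_mkord xpredT (fun p => v p * tau (n - k - p)%N)).
  have hn : (n./2 <= n)%N by lia.
  rewrite (big_cat_nat (leq0n _) hn)/= lerD//.
    apply: (@le_trans _ _ (\sum_(0 <= p < n./2) v p * tau (n./2 - k)%N)).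
      rewrite !big_mkord; apply: ler_sum => p _; rewrite ler_wpM2l// taud//.
      by have := ltn_ord p; lia.
    by rewrite -mulr_suml ler_wpM2r// big_mkord.
  apply: (@le_trans _ _ (\sum_(n./2 <= p < n) v p * tau 0%N)).
    by apply: ler_sum => p _; rewrite ler_wpM2l// taud.
  by rewrite -mulr_suml mulrC ler_wpM2l// hrho.
- exact: cvg_cst.
- rewrite -[X in _ --> X](addr0 0); apply: cvgD.
    rewrite -[X in _ --> X](mulr0 B); apply: cvgM; first exact: cvg_cst.
    by apply: (@cvg_half_nat (fun n => tau (n - k)%N)); exact: cvg_natB.
  rewrite -[X in _ --> X](mulr0 (tau 0%N)); apply: cvgM; first exact: cvg_cst.
  exact: cvg_half_nat.
Qed.

End Tails.

Section Autocorrelation.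
Context {R : realType}.
Variable d : R.
Hypothesis d01 : 0 < d < half.
Let c := nbinom d.

Lemma half_mul2 : 2 * half = 1 :> R. Proof. by rewrite /half mulfV// pnatr_eq0. Qed.

Local Lemma d_gt0 : 0 < d. Proof. by case/andP: d01. Qed.

Lemma exponent_le1 : 0 < d <= 1.
Proof. by have := half_mul2; case/andP: d01; lra. Qed.

Local Lemma c_ge0 k : 0 <= c k. Proof. exact/ltW/nbinom_gt0/d_gt0. Qed.

Local Hint Resolve exponent_le1 c_ge0 : core.

(** Here d < 1/2 enters: [k * c k ^+ 2] drops by about (1 - 2 d) [c k ^+ 2] at each step, so the
    squares are dominated by a telescoping sum. From [k0] on, k (1 - 2 d) > 1 absorbs the
    lower-order terms and leaves a quarter of that drop. *)
Lemma nbinom_sq_sum : exists B : R, forall n, \sum_(k < n) c k ^+ 2 <= B.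
Proof.
have [d0 d1] := andP d01; have halfD := half_mul2.
pose e : R := 1 - 2 * d; have e0 : 0 < e by rewrite /e; lra.
pose k0 := Num.bound e^-1.
have hk0 : 1 < k0%:R * e.
  by rewrite -ltr_pdivrMr// div1r; apply: archi_boundP; rewrite invr_ge0 ltW.
exists (\sum_(k < k0) c k ^+ 2 + 4 / e * (k0%:R * c k0 ^+ 2)) => n.
have step k : (k0 <= k)%N ->
    e / 4 * c k ^+ 2 <= k%:R * c k ^+ 2 - k.+1%:R * c k.+1 ^+ 2.
  move=> kk0; have k0' : k0%:R <= k%:R :> R by rewrite ler_nat.
  have k1 : k.+1%:R != 0 :> R by rewrite pnatr_eq0.
  have -> : k.+1%:R * c k.+1 ^+ 2 = (k%:R + d) ^+ 2 / k.+1%:R * c k ^+ 2.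
    rewrite /c nbinomS; move: (k.+1%:R) k1 => K K0; field; exact: K0.
  rewrite -mulrBl ler_wpM2r ?sqr_ge0//.
  rewrite lerBrDr -lerBrDl ler_pdivrMr ?ltr0n// -(natr1 k).
  have kk : 0 <= k%:R :> R by [].
  have : 1 < k%:R * e by apply: (lt_le_trans hk0); rewrite ler_wpM2r// ltW.
  have : d * d <= half * half by apply: ler_pM; exact: ltW.
  clear -e0 d1 d0 kk halfD; rewrite /e expr2; move: (k%:R) kk => x kk h1 h2.
  have -> : (x + d) * (x + d) = x * x + 2 * (x * d) + d * d by ring.
  have -> : (x - (1 - 2 * d) / 4) * (x + 1) = x * x + x - (x - 2 * (x * d) + 1 - 2 * d) / 4 by field.
  have h3 : x * (1 - 2 * d) = x - 2 * (x * d) by ring.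
  have h4 : half * half = 4^-1 :> R by rewrite /half; field.
  by rewrite h3 in h2; rewrite h4 in h1; lra.
have tele m : (k0 <= m)%N -> \sum_(k0 <= k < m) e / 4 * c k ^+ 2 <=
    k0%:R * c k0 ^+ 2 - m%:R * c m ^+ 2.
  move=> /subnKC <-; elim: (m - k0)%N => [|j IH].
    by rewrite addn0 big_geq// subrr.
  rewrite addnS big_nat_recr ?leq_addr//=.
  by have := step (k0 + j)%N (leq_addr _ _); lra.
have [nk|kn] := leqP n k0.
  rewrite -(big_mkord xpredT (fun k => c k ^+ 2)) -(big_mkord xpredT (fun k => c k ^+ 2)).
  rewrite (big_cat_nat (leq0n n) nk)/= -addrA lerDl addr_ge0//.
    by rewrite sumr_ge0// => i _; exact: sqr_ge0.
  by rewrite mulr_ge0 ?divr_ge0 ?mulr_ge0 ?sqr_ge0// ltW.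
rewrite -!(big_mkord xpredT (fun k => c k ^+ 2)).
rewrite (big_cat_nat (leq0n _) (ltnW kn))/= lerD2l.
rewrite -ler_pdivrMl ?divr_gt0// invf_div mulr_sumr.
apply: (le_trans (tele _ (ltnW kn))); rewrite lerBlDr lerDl.
by rewrite mulr_ge0 ?sqr_ge0.
Qed.

Definition shifted y m : R := if (y <= m)%N then c (m - y) else 0.

Lemma sum_shifted (y t n : nat) : (y <= t)%N ->
  \sum_(m < n) shifted y m * shifted t m = \sum_(m < n - t) c m * c (m + (t - y)).
Proof.
move=> yt; rewrite -(big_mkord xpredT (fun m => shifted y m * shifted t m)).
have [tn|nt] := leqP t n; last first.
  have -> : (n - t = 0)%N by lia.
  rewrite big_ord0 big_nat big1// => m /andP[_ mn].
  by rewrite /shifted [(t <= m)%N]leqNgt (leq_trans mn (ltnW nt)) mulr0.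
rewrite (big_cat_nat (leq0n t) tn)/= [X in X + _]big_nat big1 ?add0r; last first.
  by move=> m /andP[_ mt]; rewrite /shifted [(t <= m)%N]leqNgt mt mulr0.
rewrite -{1}(add0n t) big_addn big_mkord; apply: eq_bigr => m _.
rewrite /shifted leq_addl (leq_trans yt) ?leq_addl// addnK mulrC.
by congr (_ * c _); lia.
Qed.

Definition autocorr k : R := limn (fun n => \sum_(m < n) c m * c (m + k)).

Lemma autocorr_term m k : 0 <= c m * c (m + k) <= c m ^+ 2.
Proof. by rewrite mulr_ge0//= expr2 ler_wpM2l// nbinom_antitone// leq_addr. Qed.

Lemma autocorr_tail : exists tau : nat -> R, [/\ tau @ \oo --> (0 : R),
    (forall n, 0 <= tau n), (forall n m, (n <= m)%N -> tau m <= tau n),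
    (forall k n, 0 <= autocorr k - \sum_(m < n) c m * c (m + k) <= tau n) &
    (forall n m, (n <= m)%N -> \sum_(n <= k < m) c k ^+ 2 <= tau n)].
Proof.
have [B hB] := nbinom_sq_sum.
have [tau [t0 tB td ht]] := sum_tail (fun k => sqr_ge0 (c k)) hB.
exists tau; split => // [n|k n]; first by case/andP: (tB n).
pose P n := \sum_(m < n) c m * c (m + k).
have PS a b : (a <= b)%N -> 0 <= P b - P a <= tau a.
  move=> ab; have -> : P b - P a = \sum_(a <= m < b) c m * c (m + k).
    by rewrite sum_nat_diff.
  rewrite sumr_ge0/=; last by move=> i _; case/andP: (autocorr_term i k).
  apply: le_trans (ht _ _ ab); apply: ler_sum => i _.
  by case/andP: (autocorr_term i k).
have Pnd : nondecreasing_seq P.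
  by move=> a b ab; rewrite -subr_ge0; case/andP: (PS a b ab).
have Pcvg : cvgn P.
  apply: nondecreasing_is_cvgn => //; exists (tau 0%N) => _ [m _ <-].
  by case/andP: (PS 0%N m (leq0n _)); rewrite /P big_ord0 subr0.
rewrite /autocorr -/P subr_ge0 nondecreasing_cvgn_le//= lerBlDr.
apply: limr_le => //; near=> m.
have nm : (n <= m)%N by near: m; exact: nbhs_infty_ge.
by rewrite -lerBlDr; case/andP: (PS n m nm).
Unshelve. all: by end_near. Qed.

Lemma cvg_autocorr k : (fun n => \sum_(m < n) c m * c (m + k)) @ \oo --> autocorr k.
Proof.
have [tau [t0 _ _ ht _]] := autocorr_tail.
apply: (@squeeze_cvgr _ _ _ _ (fun n => autocorr k - tau n) (fun=> autocorr k)).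
- by apply: nearW => n; case/andP: (ht k n) => h1 h2; apply/andP; split; lra.
- by rewrite -[X in _ --> X](subr0 (autocorr k)); apply: cvgB => //; exact: cvg_cst.
- exact: cvg_cst.
Qed.

Lemma autocorr_ge0 k : 0 <= autocorr k.
Proof.
have [tau [_ _ _ ht _]] := autocorr_tail.
by have := ht k 0%N; rewrite big_ord0 subr0 => /andP[].
Qed.

Lemma autocorr0_gt0 : 0 < autocorr 0.
Proof.
have [tau [_ _ _ ht _]] := autocorr_tail.
have := ht 0%N 1%N; rewrite big_ord1 addn0 /c nbinom0 mulr1 => /andP[h _].
by lra.
Qed.

(** The classical remark on decreasing summable sequences: the block from n / 2 to n has at least n
    / 2 terms, each at least [c n ^+ 2], and its sum is a tail. *)
Lemma cvg_mul_nbinom_sq : (fun n => n%:R * c n ^+ 2) @ \oo --> (0 : R).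
Proof.
have [tau [t0 tge td _ ht]] := autocorr_tail.
apply: (@squeeze_cvgr _ _ _ _ (fun=> 0) (fun n => 2 * tau n./2)).
- apply: nearW => n; rewrite mulr_ge0 ?sqr_ge0//=.
  have h : (n./2 <= n)%N by lia.
  have := ht _ _ h.
  have : \sum_(n./2 <= k < n) c n ^+ 2 <= \sum_(n./2 <= k < n) c k ^+ 2.
    rewrite !big_nat; apply: ler_sum => k /andP[_ kn].
    by rewrite ler_pXn2r ?nnegrE// nbinom_antitone// ltnW.
  rewrite sumr_const_nat -mulr_natl => h1 h2.
  have : n%:R * c n ^+ 2 <= 2 * ((n - n./2)%:R * c n ^+ 2).
    by rewrite mulrA ler_wpM2r ?sqr_ge0// -natrM ler_nat; lia.
  by lra.
- exact: cvg_cst.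
- rewrite -[X in _ --> X](mulr0 2); apply: cvgM; first exact: cvg_cst.
  exact: cvg_half_nat.
Qed.

(** The partial sums satisfy the recurrence up to the boundary term - n c_n c_(n+k), which
    telescoping leaves over; it tends to 0 because it is at most n c_n^2 in modulus. *)
Lemma autocorrS k : (k%:R + 1 - d) * autocorr k.+1 = (k%:R + d) * autocorr k.
Proof.
apply/eqP; rewrite -subr_eq0; apply/eqP.
pose P k n := \sum_(m < n) c m * c (m + k).
have tele n : (k%:R + 1 - d) * P k.+1 n - (k%:R + d) * P k n =
    - (n%:R * (c n * c (n + k))).
  elim: n => [|n IH]; first by rewrite /P !big_ord0 !mulr0 subrr mul0r oppr0.
  rewrite /P !big_ord_recr/= -!/(P _ _) !mulrDr opprD addrACA IH.
  have e1 := @nbinomS_mul _ d n; have e2 := @nbinomS_mul _ d (n + k).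
  rewrite addSn addnS -/(c _) in e1 e2 *.
  have -> : n.+1%:R * (c n.+1 * c (n + k).+1) = (n%:R + d) * c n * c (n + k).+1.
    by rewrite mulrA e1.
  have : ((n + k)%:R + 1) * c (n + k).+1 = ((n + k)%:R + d) * c (n + k).
    by rewrite natr1 e2.
  rewrite natrD; set x := c n; set y := c (n + k).+1; set z := c (n + k) => h.
  have -> : (k%:R + 1 - d) * (x * y) = x * ((n%:R + k%:R + 1) * y) - (n%:R + d) * x * y by ring.
  by rewrite h; ring.
have h1 : (fun n => - (n%:R * (c n * c (n + k)))) @ \oo --> (0 : R).
  apply: (@squeeze_cvgr _ _ _ _ (fun n => - (n%:R * c n ^+ 2)) (fun=> 0)).
  - apply: nearW => n; have /andP[h1 h2] := autocorr_term n k.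
    by rewrite lerN2 ler_wpM2l//= oppr_le0 mulr_ge0.
  - by rewrite -[X in _ --> X]oppr0; apply: cvgN; exact: cvg_mul_nbinom_sq.
  - exact: cvg_cst.
have h2 : (fun n => - (n%:R * (c n * c (n + k)))) @ \oo -->
    (k%:R + 1 - d) * autocorr k.+1 - (k%:R + d) * autocorr k.
  under eq_fun do rewrite -tele.
  by apply: cvgB; apply: cvgM; (exact: cvg_cst || exact: cvg_autocorr).
exact: (cvg_unique _ h2 h1).
Qed.

Lemma autocorr_proportional (u : nat -> R) :
    (forall k, (k%:R + 1 - d) * u k.+1 = (k%:R + d) * u k) ->
  forall k, u k = u 0%N / autocorr 0 * autocorr k.
Proof.
move=> uS; elim=> [|k IH]; first by rewrite divfK// gt_eqF// autocorr0_gt0.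
have kd : k%:R + 1 - d != 0.
  have : 0 <= k%:R :> R by []. 
  by have halfD := half_mul2; move: d01 => /andP[_ d1] k0; rewrite gt_eqF//; lra.
apply: (mulfI kd); rewrite uS IH [RHS]mulrCA autocorrS; ring.
Qed.

(** The ratio of consecutive autocorrelations is (k + d) / (k + 1 - d), and 1 - d >= 1/2 makes it no
    larger than the ratio (k + d) / (k + 1/2) of the weight. *)
Lemma autocorr_le k : autocorr k <= autocorr 0 * frac_weight d k.
Proof.
have S0 := autocorr_ge0.
have [d0 d1] := andP d01; have halfD := half_mul2.
elim: k => [|k IH]; first by rewrite frac_weight0 mulr1.
have k0 : 0 <= k%:R :> R by [].
have kd : 0 < k%:R + 1 - d by lra.
have -> : autocorr k.+1 = (k%:R + d) / (k%:R + 1 - d) * autocorr k.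
  by rewrite mulrAC -autocorrS mulrAC mulfV ?mul1r// gt_eqF.
rewrite frac_weightS [leRHS]mulrA [leRHS]mulrC; apply: ler_pM => //.
  by rewrite divr_ge0//; lra.
by rewrite ler_wpM2l ?lef_pV2 ?posrE; lra.
Qed.

(** With truncated subtraction [(t - y) + (y - t)] is the distance between [t] and [y]. *)
Lemma sum_shifted_le y t n :
  \sum_(m < n) shifted y m * shifted t m <= autocorr ((t - y) + (y - t)).
Proof.
have [tau [_ _ _ ht _]] := autocorr_tail.
wlog yt : y t / (y <= t)%N.
  move=> H; have [yt|ty] := leqP y t; first exact: H.
  rewrite addnC; under eq_bigr do rewrite mulrC.
  by apply: H; exact: ltnW.
have -> : (t - y + (y - t) = t - y)%N by lia.
by rewrite sum_shifted// -subr_ge0; case/andP: (ht (t - y)%N (n - t)%N).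
Qed.

Lemma shifted_autocorr_tail : exists tau : nat -> R, [/\ tau @ \oo --> (0 : R),
    (forall n, 0 <= tau n), (forall n m, (n <= m)%N -> tau m <= tau n) &
    forall y t n, `|autocorr ((t - y) + (y - t)) -
      \sum_(m < n) shifted y m * shifted t m| <= tau (n - y)%N + tau (n - t)%N].
Proof.
have [tau [t0 tge td ht _]] := autocorr_tail.
exists tau; split => // y t n.
rewrite ger0_norm ?subr_ge0 ?sum_shifted_le//.
wlog yt : y t / (y <= t)%N.
  move=> H; have [yt|ty] := leqP y t; first exact: H.
  rewrite addnC [leRHS]addrC; under eq_bigr do rewrite mulrC.
  by apply: H; exact: ltnW.
have -> : (t - y + (y - t) = t - y)%N by lia.
rewrite sum_shifted//; have /andP[h1 h2] := ht (t - y)%N (n - t)%N.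
by rewrite (le_trans h2)// lerDr.
Qed.

End Autocorrelation.

(** * Matrix norms and limits *)

Section Modulus.
Context {R : realType}.
Local Notation C := R[i].
Implicit Types x y z : C.

Lemma cabs_ge0 z : 0 <= cabs z. Proof. by case: z => a b; exact: sqrtr_ge0. Qed.
Lemma cabs0 : cabs 0 = 0 :> R. Proof. exact: Normc.normc0. Qed.
Lemma cabs1 : cabs 1 = 1 :> R. Proof. exact: Normc.normc1. Qed.
Lemma cabsM x y : cabs (x * y) = cabs x * cabs y. Proof. exact: Normc.normcM. Qed.
Lemma cabsD x y : cabs (x + y) <= cabs x + cabs y. Proof. exact: le_normcD. Qed.
Lemma cabsN x : cabs (- x) = cabs x. Proof. exact: normcN. Qed.
Lemma cabs_eq0 x : cabs x = 0 -> x = 0. Proof. exact: Normc.eq0_normc. Qed.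
Lemma cabsX x n : cabs (x ^+ n) = cabs x ^+ n.
Proof. by elim: n => [|n IH]; rewrite ?expr0 ?cabs1// !exprS cabsM IH. Qed.
Lemma cabsV x : cabs x^-1 = (cabs x)^-1. Proof. exact: Normc.normcV. Qed.
Lemma cabs_real (r : R) : cabs (real_complex R r) = `|r|.
Proof. by rewrite /cabs /= expr0n/= addr0 sqrtr_sqr. Qed.
Lemma cabs_conj x : cabs (x^*) = cabs x.
Proof. by case: x => a b; rewrite /cabs /= sqrrN. Qed.
Lemma cabs_sum (I : Type) (r : seq I) (P : pred I) (F : I -> C) :
  cabs (\sum_(i <- r | P i) F i) <= \sum_(i <- r | P i) cabs (F i).
Proof.
elim/big_rec2: _ => [|i y x _ le]; first by rewrite cabs0.
by apply: (le_trans (cabsD _ _)); rewrite lerD2l.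
Qed.
Lemma cabsB_sym x y : cabs (x - y) = cabs (y - x).
Proof. by rewrite -cabsN opprB. Qed.
Lemma Re_le_cabs z : `|complex.Re z| <= cabs z.
Proof.
case: z => a b; rewrite /cabs/= -sqrtr_sqr ler_wsqrtr// lerDl sqr_ge0//.
Qed.
Lemma Im_le_cabs z : `|complex.Im z| <= cabs z.
Proof.
case: z => a b; rewrite /cabs/= -sqrtr_sqr ler_wsqrtr// lerDr sqr_ge0//.
Qed.
Lemma cabs_le_ReIm z : cabs z <= `|complex.Re z| + `|complex.Im z|.
Proof.
case: z => a b; rewrite /cabs/=.
rewrite -[leRHS]ger0_norm ?addr_ge0// -sqrtr_sqr ler_wsqrtr//.
rewrite sqrrD !real_normK ?num_real// -addrA [X in _ <= _ + X]addrC addrA lerDl.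
by rewrite mulrn_wge0// mulr_ge0.
Qed.
Lemma mul_conj_cabs z : z * z^* = real_complex R (cabs z ^+ 2).
Proof.
case: z => a b; rewrite /cabs/= sqr_sqrtr ?addr_ge0 ?sqr_ge0//.
by apply/eqP; rewrite eq_complex/=; apply/andP; split; apply/eqP; ring.
Qed.

Lemma Re_sum (I : Type) (r : seq I) (P : pred I) (F : I -> C) :
  complex.Re (\sum_(i <- r | P i) F i) = \sum_(i <- r | P i) complex.Re (F i).
Proof.
elim/big_rec2: _ => // i x y _ <-.
by case: (F i) => a b; case: y => c d.
Qed.

End Modulus.

Section MatrixNorm.
Context {R : realType}.
Local Notation C := R[i].

(** The entrywise l1 norm is submultiplicative, preserved by conjugate transposition, and explicit.
    It replaces [opnorm] until the last step, where equivalence of the two only changes the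
    constant. *)
Definition mxnorm {m n} (A : 'M[C]_(m, n)) : R := \sum_i \sum_j cabs (A i j).

Lemma mxnorm_ge0 m n (A : 'M[C]_(m, n)) : 0 <= mxnorm A.
Proof. by apply: sumr_ge0 => i _; apply: sumr_ge0 => j _; exact: cabs_ge0. Qed.

Lemma mxnorm0 m n : mxnorm (0 : 'M[C]_(m, n)) = 0.
Proof.
by rewrite /mxnorm big1// => i _; rewrite big1// => j _; rewrite mxE cabs0.
Qed.

Lemma mxnormD m n (A B : 'M[C]_(m, n)) : mxnorm (A + B) <= mxnorm A + mxnorm B.
Proof.
rewrite /mxnorm -big_split/=; apply: ler_sum => i _.
by rewrite -big_split/=; apply: ler_sum => j _; rewrite mxE cabsD.
Qed.

Lemma mxnormN m n (A : 'M[C]_(m, n)) : mxnorm (- A) = mxnorm A.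
Proof. by apply: eq_bigr => i _; apply: eq_bigr => j _; rewrite mxE cabsN. Qed.

Lemma mxnormB m n (A B : 'M[C]_(m, n)) : mxnorm (A - B) <= mxnorm A + mxnorm B.
Proof. by apply: le_trans (mxnormD _ _) _; rewrite mxnormN. Qed.

Lemma mxnorm_sum m n (I : Type) (r : seq I) (P : pred I) (F : I -> 'M[C]_(m, n)) :
  mxnorm (\sum_(i <- r | P i) F i) <= \sum_(i <- r | P i) mxnorm (F i).
Proof.
elim/big_rec2: _ => [|i y x _ le]; first by rewrite mxnorm0.
by apply: (le_trans (mxnormD _ _)); rewrite lerD2l.
Qed.

Lemma mxnorm_entry m n (A : 'M[C]_(m, n)) i j : cabs (A i j) <= mxnorm A.
Proof.
rewrite /mxnorm (bigD1 i)//= (bigD1 j)//= -addrA lerDl addr_ge0//.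
  by apply: sumr_ge0 => k _; exact: cabs_ge0.
by apply: sumr_ge0 => k _; apply: sumr_ge0 => l _; exact: cabs_ge0.
Qed.

Lemma mxnorm_eq0 m n (A : 'M[C]_(m, n)) : mxnorm A <= 0 -> A = 0.
Proof.
move=> A0; apply/matrixP => i j; rewrite mxE; apply: cabs_eq0.
by apply/eqP; rewrite eq_le cabs_ge0 (le_trans (mxnorm_entry A i j)).
Qed.

Lemma mxnormM m n p (A : 'M[C]_(m, n)) (B : 'M[C]_(n, p)) :
  mxnorm (A *m B) <= mxnorm A * mxnorm B.
Proof.
rewrite {1 2}/mxnorm mulr_suml; apply: ler_sum => i _.
apply: (@le_trans _ _ (\sum_k \sum_j cabs (A i j) * cabs (B j k))).
  apply: ler_sum => k _; rewrite mxE; apply: (le_trans (cabs_sum _ _ _)).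
  by apply: ler_sum => j _; rewrite cabsM.
rewrite exchange_big/= mulr_suml; apply: ler_sum => j _.
rewrite -mulr_sumr ler_wpM2l ?cabs_ge0//.
rewrite /mxnorm (bigD1 j)//= lerDl.
by apply: sumr_ge0 => k _; apply: sumr_ge0 => l _; exact: cabs_ge0.
Qed.

Lemma mxnormZ m n (z : C) (A : 'M[C]_(m, n)) : mxnorm (z *: A) = cabs z * mxnorm A.
Proof.
rewrite /mxnorm mulr_sumr; apply: eq_bigr => i _; rewrite mulr_sumr.
by apply: eq_bigr => j _; rewrite mxE cabsM.
Qed.

Lemma mxnorm_ct m n (A : 'M[C]_(m, n)) : mxnorm (A ^t*) = mxnorm A.
Proof.
rewrite /mxnorm exchange_big/=; apply: eq_bigr => i _; apply: eq_bigr => j _.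
by rewrite !mxE cabs_conj.
Qed.

Lemma mxnorm_scalar n (z : C) : mxnorm (z%:M : 'M[C]_n) = n%:R * cabs z.
Proof.
rewrite /mxnorm (eq_bigr (fun=> cabs z)) => [|i _].
  by rewrite sumr_const card_ord mulr_natl.
rewrite (bigD1 i)//= mxE eqxx big1 ?addr0// => j ji.
by rewrite mxE eq_sym (negbTE ji) cabs0.
Qed.

(** Convergence of matrices is stated through a real null sequence, so that all limit arguments are
    squeezes between real sequences. *)
Definition mcvg {m n} (u : nat -> 'M[C]_(m, n)) (l : 'M[C]_(m, n)) :=
  (fun k => mxnorm (u k - l)) @ \oo --> (0 : R).

Lemma mcvg_le m n (u : nat -> 'M[C]_(m, n)) l (e : nat -> R) :
  (forall k, mxnorm (u k - l) <= e k) -> e @ \oo --> (0 : R) -> mcvg u l.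
Proof.
move=> ue e0; apply: (@squeeze_cvgr _ _ _ _ (fun=> 0) e) => //.
  by apply: nearW => k; rewrite mxnorm_ge0 ue.
exact: cvg_cst.
Qed.

Lemma mcvg_cst m n (l : 'M[C]_(m, n)) : mcvg (fun=> l) l.
Proof. by rewrite /mcvg subrr mxnorm0; exact: cvg_cst. Qed.

Lemma mcvgD m n (u v : nat -> 'M[C]_(m, n)) l k : mcvg u l -> mcvg v k ->
  mcvg (fun i => u i + v i) (l + k).
Proof.
move=> ul vk; apply: (@mcvg_le _ _ _ _ (fun i => mxnorm (u i - l) + mxnorm (v i - k))).
  by move=> i; rewrite opprD addrACA mxnormD.
by rewrite -[X in _ --> X](addr0 0); exact: cvgD.
Qed.

Lemma mcvgMl m n p (A : 'M[C]_(m, n)) (u : nat -> 'M[C]_(n, p)) l : mcvg u l ->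
  mcvg (fun i => A *m u i) (A *m l).
Proof.
move=> ul; apply: (@mcvg_le _ _ _ _ (fun i => mxnorm A * mxnorm (u i - l))).
  by move=> i; rewrite -mulmxBr mxnormM.
by rewrite -[X in _ --> X](mulr0 (mxnorm A)); apply: cvgM => //; exact: cvg_cst.
Qed.

Lemma mcvgMr m n p (A : 'M[C]_(n, p)) (u : nat -> 'M[C]_(m, n)) l : mcvg u l ->
  mcvg (fun i => u i *m A) (l *m A).
Proof.
move=> ul; apply: (@mcvg_le _ _ _ _ (fun i => mxnorm (u i - l) * mxnorm A)).
  by move=> i; rewrite -mulmxBl mxnormM.
by rewrite -[X in _ --> X](mul0r (mxnorm A)); apply: cvgM => //; exact: cvg_cst.
Qed.

Lemma mcvgB m n (u v : nat -> 'M[C]_(m, n)) l k : mcvg u l -> mcvg v k ->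
  mcvg (fun i => u i - v i) (l - k).
Proof.
move=> ul vk; apply: mcvgD => //.
by rewrite /mcvg; under eq_fun do rewrite -opprD mxnormN.
Qed.

Lemma mcvg_sum m n (I : Type) (r : seq I) (u : I -> nat -> 'M[C]_(m, n)) l :
  (forall i, mcvg (u i) (l i)) ->
  mcvg (fun k => \sum_(i <- r) u i k) (\sum_(i <- r) l i).
Proof.
move=> ul; elim: r => [|i r IH].
  by rewrite big_nil; under eq_fun do rewrite big_nil; exact: mcvg_cst.
by rewrite big_cons; under eq_fun do rewrite big_cons; exact: mcvgD.
Qed.

Lemma mcvg_norm_le m n (u : nat -> 'M[C]_(m, n)) l (B : R) :
  mcvg u l -> (\forall k \near \oo, mxnorm (u k) <= B) -> mxnorm l <= B.
Proof.
move=> ul uB; rewrite -(addr0 B).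
have h : (fun k => B + mxnorm (u k - l)) @ \oo --> B + 0 by apply: cvgD => //; exact: cvg_cst.
rewrite -(cvg_lim _ h)//; apply: limr_ge; first by apply/cvg_ex; eexists; exact: h.
near=> k.
rewrite -[X in mxnorm X <= _](subKr (u k)).
apply: (le_trans (mxnormB _ _)); rewrite lerD2r.
by near: k.
Unshelve. all: by end_near. Qed.

Lemma mcvg_shift m n (u : nat -> 'M[C]_(m, n)) l k : mcvg u l ->
  mcvg (fun i => u (i + k)%N) l.
Proof. by move=> ul; rewrite /mcvg (cvg_shiftn k (fun i => mxnorm (u i - l))). Qed.

Lemma mcvg_unique m n (u : nat -> 'M[C]_(m, n)) l k : mcvg u l -> mcvg u k -> l = k.
Proof.
move=> ul uk; apply/eqP; rewrite -subr_eq0; apply/eqP; apply: mxnorm_eq0.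
apply: (mcvg_norm_le (mcvgB ul uk)).
by apply: nearW => i; rewrite subrr mxnorm0.
Qed.

End MatrixNorm.

(** * Half-line kernels *)

Section Convolution.
Context {A : nzRingType}.
Implicit Types u v w : nat -> A.

Definition conv u v k : A := \sum_(i < k.+1) u i * v (k - i)%N.

Definition conv1 k : A := (k == 0)%N%:R.

Lemma conv_coef u v n k : (k < n)%N ->
  conv u v k = (\poly_(i < n) u i * \poly_(i < n) v i)`_k.
Proof.
move=> kn; rewrite coefM; apply: eq_bigr => i _; rewrite !coef_poly.
by rewrite (leq_ltn_trans (leq_subr i k) kn) (leq_trans (ltn_ord i) kn).
Qed.

(** Associativity is borrowed from polynomials: truncating the sequences after index [k] does not
    affect coefficient [k], and the ring need not be commutative. *)
Lemma convA u v w k : conv u (conv v w) k = conv (conv u v) w k.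
Proof.
pose p x : {poly A} := \poly_(i < k.+1) x i.
transitivity ((p u * (p v * p w))`_k).
  rewrite coefM; apply: eq_bigr => i _; rewrite coef_poly ltn_ord.
  by rewrite (@conv_coef _ _ k.+1) ?ltnS ?leq_subr.
rewrite mulrA coefM; apply: eq_bigr => i _.
by rewrite (@conv_coef _ _ k.+1)// coef_poly ltnS leq_subr.
Qed.

Lemma conv1r u k : conv u conv1 k = u k.
Proof.
rewrite /conv big_ord_recr/= subnn /conv1 eqxx mulr1 big1 ?add0r// => i _.
by rewrite subn_eq0 leqNgt ltn_ord mulr0.
Qed.

Lemma conv1l u k : conv conv1 u k = u k.
Proof.
rewrite /conv big_ord_recl/= subn0 /conv1 eqxx mul1r big1 ?addr0// => i _.
by rewrite mul0r.
Qed.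

Lemma eq_conv u u' v v' : u =1 u' -> v =1 v' -> conv u v =1 conv u' v'.
Proof. by move=> uu vv k; apply: eq_bigr => i _; rewrite uu vv. Qed.

Lemma conv_comm u v k : (forall i j, u i * v j = v j * u i) ->
  conv u v k = conv v u k.
Proof.
move=> uv; rewrite /conv (reindex_inj rev_ord_inj)/=; apply: eq_bigr => i _.
by rewrite uv subKn// -ltnS.
Qed.

Lemma convDl u v w k : conv (fun i => u i + v i) w k = conv u w k + conv v w k.
Proof. by rewrite /conv -big_split/=; apply: eq_bigr => i _; rewrite mulrDl. Qed.

Lemma conv0l u v k : (forall i, u i = 0) -> conv u v k = 0.
Proof. by move=> u0; rewrite /conv big1// => i _; rewrite u0 mul0r. Qed.

End Convolution.

Lemma sum_conv_le (R : realDomainType) (u v : nat -> R) n :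
  (forall k, 0 <= u k) -> (forall k, 0 <= v k) ->
  \sum_(k < n) conv u v k <= (\sum_(k < n) u k) * (\sum_(k < n) v k).
Proof.
move=> u0 v0; rewrite mulr_suml.
have -> : \sum_(k < n) conv u v k =
    \sum_(k < n) \sum_(i < n) (if (i <= k)%N then u i * v (k - i)%N else 0).
  apply: eq_bigr => k _; rewrite /conv -big_mkcond/=.
  by rewrite (big_ord_widen_cond n xpredT (fun i => u i * v (k - i)%N)).
rewrite exchange_big/=; apply: ler_sum => i _.
rewrite -big_mkcond/= -mulr_sumr ler_wpM2l//.
rewrite -(big_mkord (fun k => i <= k)%N (fun k => v (k - i)%N)).
rewrite (big_cat_nat (leq0n i) (ltnW (ltn_ord i)))/=.
rewrite big_nat_cond big_pred0 ?add0r => [|k]; last first.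
  by rewrite leq0n/=; apply/negP => /andP[ki ik]; move: ki; rewrite ltnNge ik.
apply: (@le_trans _ _ (\sum_(i <= k < n) v (k - i)%N)).
  rewrite [leRHS](bigID (fun k => i <= k)%N)/= lerDl.
  exact: sumr_ge0.
rewrite -{1}(add0n (i : nat)) big_addn big_mkord.
rewrite (eq_bigr (fun k : 'I_(n - i) => v k)) => [|k _]; last by rewrite addnK.
rewrite (big_ord_widen n v (leq_subr i n)) [leRHS](bigID (fun k : 'I_n => (k < n - i)%N))/=.
by rewrite lerDl sumr_ge0.
Qed.

Lemma sum_geo_le (R : realFieldType) (r : R) n : 0 <= r < 1 ->
  \sum_(k < n) r ^+ k <= (1 - r)^-1.
Proof.
move=> /andP[r0 r1]; rewrite -[leRHS]mul1r ler_pdivlMr ?subr_gt0//.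
have := subrX1 r n; rewrite -opprB -(opprB 1 r) mulNr => /oppr_inj.
by rewrite mulrC => <-; rewrite gerBl exprn_ge0.
Qed.

Lemma sum_arith_geo_le (R : realFieldType) (r : R) n : 0 <= r < 1 ->
  \sum_(k < n) k.+1%:R * r ^+ k <= (1 - r)^-1 ^+ 2.
Proof.
move=> r01; have [r0 r1] := andP r01.
have -> : \sum_(k < n) k.+1%:R * r ^+ k = \sum_(k < n) conv (fun k => r ^+ k) (fun k => r ^+ k) k.
  apply: eq_bigr => k _; rewrite /conv (eq_bigr (fun=> r ^+ k)) => [|i _].
    by rewrite sumr_const card_ord mulr_natl.
  by rewrite -exprD subnKC// -ltnS.
apply: (le_trans (sum_conv_le _ _ _)) => [k|k|]; rewrite ?exprn_ge0//.
by rewrite expr2 ler_pM ?sum_geo_le// sumr_ge0// => i _; rewrite exprn_ge0.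
Qed.

Section HalfLine.
Context {R : realType} {p : nat}.
Local Notation C := R[i].
Local Notation M := 'M[C]_p.+1.
Variables (d : R) (d01 : 0 < d < half).
Variables (G H : nat -> M) (B r : R).
Hypotheses (B0 : 0 <= B) (r01 : 0 <= r < 1).
Hypothesis GB : forall k, mxnorm (G k) <= B * r ^+ k.
Hypothesis HB : forall k, mxnorm (H k) <= B * r ^+ k.
Hypothesis GH : conv G H =1 conv1.
Hypothesis HG : conv H G =1 conv1.

Definition scalar_seq (c : nat -> R) k : M := (real_complex R (c k))%:M.

Lemma scalar_seqC c (A : M) k : scalar_seq c k * A = A * scalar_seq c k.
Proof. by rewrite -!mulmxE scalar_mxC. Qed.

Lemma mxnorm_scalar_seq c (A : M) k : mxnorm (scalar_seq c k * A) = `|c k| * mxnorm A.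
Proof. by rewrite -mulmxE mul_scalar_mx mxnormZ cabs_real. Qed.

Lemma conv_scalar c (u : nat -> M) k : conv (scalar_seq c) u k = conv u (scalar_seq c) k.
Proof. by apply: conv_comm => i j; exact: scalar_seqC. Qed.

Lemma conv_scalar_seq c a k : conv (scalar_seq c) (scalar_seq a) k = scalar_seq (conv c a) k.
Proof.
rewrite /conv /scalar_seq rmorph_sum/= raddf_sum/=.
by apply: eq_bigr => i _; rewrite -mulmxE -scalar_mxM -rmorphM.
Qed.

Local Notation c := (nbinom d).
Local Notation a := (nbinom (- d)).

Lemma conv_nbinom : conv (scalar_seq c) (scalar_seq a) =1 conv1.
Proof.
move=> k; rewrite conv_scalar_seq /scalar_seq.
have -> : conv c a k = (k == 0)%N%:R.
  rewrite conv_comm => [|i j]; last exact: mulrC.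
  rewrite -(nbinom_inv d); apply: eq_bigr => i _; exact: mulrC.
by rewrite rmorph_nat /conv1; case: (k == 0)%N; rewrite ?scalemx1 ?raddf0.
Qed.

(** When [G] and [H] are the power series coefficients of g and of its inverse, these two sequences
    are those of h = (1 - z)^(-d) g and of its inverse. *)
Definition farima_coef := conv (scalar_seq c) G.
Definition farima_inv := conv H (scalar_seq a).
Local Notation om := farima_coef.
Local Notation al := farima_inv.

Lemma farima_inv_coef : conv al om =1 conv1.
Proof.
move=> k; rewrite /om /al convA.
rewrite (eq_conv (u' := conv H conv1) (v' := G))//.
  rewrite (eq_conv (u' := H) (v' := G))// => i; exact: conv1r.
move=> i; rewrite -convA; apply: eq_conv => // j.
rewrite -conv_nbinom; apply: conv_comm => *; exact: scalar_seqC.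
Qed.

Lemma farima_coef_inv : conv om al =1 conv1.
Proof.
move=> k; rewrite /om /al convA.
rewrite (eq_conv (u' := scalar_seq c) (v' := scalar_seq a))//.
  exact: conv_nbinom.
move=> i; rewrite -convA (eq_conv (u' := scalar_seq c) (v' := conv1))//.
exact: conv1r.
Qed.

Definition farima_cst : R := B / d * (1 - r)^-1 ^+ 2.
Local Notation K := farima_cst.

Local Lemma r1inv : 0 <= (1 - r)^-1. Proof. by case/andP: r01 => ? ?; rewrite invr_ge0 subr_ge0 ltW. Qed.

Lemma farima_cst_ge0 : 0 <= K.
Proof.
by case/andP: d01 => d0 _; rewrite /farima_cst mulr_ge0 ?exprn_ge0 ?r1inv ?divr_ge0 ?(ltW d0).
Qed.

(** Convolution with a geometric sequence keeps the size of c_s: [nbinom_backward] replaces c_i by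
    (s - i + 1) c_s / d, and the sum of (k + 1) r^k is at most (1 - r)^(-2). *)
Lemma nbinom_geo s : \sum_(i < s.+1) c i * r ^+ (s - i) <= (1 - r)^-1 ^+ 2 / d * c s.
Proof.
have [d0 _] := andP d01; have [r0 _] := andP r01.
have c0 : 0 <= c s by exact/ltW/nbinom_gt0.
apply: (@le_trans _ _ (\sum_(i < s.+1) (s - i).+1%:R * r ^+ (s - i) * (c s / d))).
  apply: ler_sum => i _.
  have := @nbinom_backward _ d i (s - i) (exponent_le1 d01); rewrite subnK -1?ltnS// => h.
  apply: (le_trans (ler_wpM2r (exprn_ge0 _ r0) h)).
  by rewrite le_eqVlt; apply/orP; left; apply/eqP; ring.
rewrite -mulr_suml mulrAC mulrA ler_wpM2r ?invr_ge0 ?(ltW d0)// ler_wpM2r//.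
rewrite (reindex_inj rev_ord_inj)/=.
rewrite (eq_bigr (fun k : 'I_s.+1 => k.+1%:R * r ^+ k)) ?sum_arith_geo_le// => i _.
by rewrite subSS subKn// -ltnS.
Qed.

Lemma farima_coef_bound k : mxnorm (om k) <= K * c k.
Proof.
have [d0 _] := andP d01.
apply: (le_trans (mxnorm_sum _ _ _)).
apply: (@le_trans _ _ (B * \sum_(i < k.+1) c i * r ^+ (k - i))).
  rewrite mulr_sumr; apply: ler_sum => i _; rewrite mxnorm_scalar_seq mulrCA.
  by rewrite ger0_norm ?ler_wpM2l// ltW// nbinom_gt0.
have -> : K * c k = B * ((1 - r)^-1 ^+ 2 / d * c k) by rewrite /farima_cst; ring.
by rewrite ler_wpM2l// nbinom_geo.
Qed.

Lemma farima_inv_sum n : \sum_(k < n) mxnorm (al k) <= B / (1 - r) * 2.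
Proof.
have [d0 _] := andP d01; have [r0 r1] := andP r01.
have d1 : 0 < d < 1 by have := @half_mul2 R; case/andP: d01 => *; apply/andP; split; lra.
apply: (@le_trans _ _ (\sum_(k < n) conv (fun k => mxnorm (H k)) (fun k => `|a k|) k)).
  apply: ler_sum => k _; apply: (le_trans (mxnorm_sum _ _ _)).
  by apply: ler_sum => i _; rewrite -scalar_seqC mxnorm_scalar_seq mulrC.
apply: (le_trans (sum_conv_le _ _ _)) => [k|k|].
- exact: mxnorm_ge0.
- exact: normr_ge0.
apply: ler_pM; last exact: sum_norm_nbinomN.
- by apply: sumr_ge0 => i _; exact: mxnorm_ge0.
- exact: sumr_ge0.
apply: (@le_trans _ _ (B * \sum_(i < n) r ^+ i)).
  by rewrite mulr_sumr; apply: ler_sum => i _.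
by rewrite ler_wpM2l// sum_geo_le.
Qed.

(** Row s is h shifted by s places, its first s coefficients dropped, divided by h on the right;
    [conv_half_kernel] characterizes it. *)
Definition half_kernel s : nat -> M := conv (fun k => om (s + k)) al.
Local Notation kern := half_kernel.

Lemma conv_half_kernel s k : conv (kern s) om k = om (s + k).
Proof.
rewrite -convA (eq_conv (u' := fun k => om (s + k)) (v' := conv1))// ?conv1r//.
exact: farima_inv_coef.
Qed.

Definition kernel_corr s : nat -> M :=
  conv (fun y => \sum_(i < s) scalar_seq c i * G (s + y - i)) al.

(** Cut the convolution defining [om (s + k)] at index s. The terms i >= s form the convolution of c
    (s + .) with [G], and [G] cancels against the [H] inside [al], leaving the scalar kernel. The
    terms i < s involve [G] only beyond index [k], hence decay geometrically. *)
Lemma half_kernelE s y : (0 < s)%N ->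
  kern s y = (real_complex R (frac_kernel d s y))%:M + kernel_corr s y.
Proof.
move=> s0.
pose E y := \sum_(i < s) scalar_seq c i * G (s + y - i) : M.
have e k : om (s + k) = conv (scalar_seq (fun k => c (s + k))) G k + E k.
  rewrite /om /conv /E -(big_mkord xpredT (fun i => scalar_seq c i * G (s + k - i))).
  rewrite (big_cat_nat (leq0n s)) /= ?leqW ?leq_addr// addrC; congr (_ + _).
    rewrite -{1}(add0n s) big_addn.
    have -> : ((s + k).+1 - s = k.+1)%N by rewrite subSn ?leq_addr// addKn.
    by rewrite big_mkord; apply: eq_bigr => i _; rewrite addnC subnDl.
  by rewrite big_mkord.
rewrite /kern (eq_conv (v' := al) e)// convDl; congr (_ + _).
rewrite -convA (eq_conv (u' := scalar_seq (fun k => c (s + k))) (v' := scalar_seq a))//.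
  rewrite conv_scalar_seq -frac_kernel_conv// /scalar_seq; congr ((real_complex R _)%:M).
  rewrite conv_comm; last by move=> *; exact: mulrC.
  by apply: eq_bigr => i _; rewrite mulrC.
move=> i; rewrite /al convA (eq_conv (u' := conv1) (v' := scalar_seq a))// conv1l//.
Qed.

Definition corr_profile : nat -> R := conv (fun k => r ^+ k) (fun k => mxnorm (al k)).

Lemma corr_profile_ge0 k : 0 <= corr_profile k.
Proof.
have [r0 _] := andP r01.
by apply: sumr_ge0 => i _; rewrite mulr_ge0 ?exprn_ge0 ?mxnorm_ge0.
Qed.

Lemma corr_profile_sum n :
  \sum_(k < n) corr_profile k <= (1 - r)^-1 * (B / (1 - r) * 2).
Proof.
have [r0 _] := andP r01.
apply: (le_trans (sum_conv_le _ _ _)) => [k|k|].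
- by rewrite exprn_ge0.
- exact: mxnorm_ge0.
apply: ler_pM; rewrite ?sum_geo_le ?farima_inv_sum ?sumr_ge0// => i _.
  by rewrite exprn_ge0.
exact: mxnorm_ge0.
Qed.

(** The bound separates the variables because r^(s + y - i) = r^y r^(s - i): [nbinom_geo] sums the
    second factor to a multiple of c_s, and a profile in [y], summable and independent of [s],
    remains. *)
Lemma kernel_corr_bound s y : (0 < s)%N ->
  mxnorm (kernel_corr s y) <= K * c s * corr_profile y.
Proof.
move=> s0; have [r0 _] := andP r01; have [d0 _] := andP d01.
have cs0 : 0 <= c s by exact/ltW/nbinom_gt0.
apply: (le_trans (mxnorm_sum _ _ _)); rewrite /corr_profile /conv mulr_sumr.
apply: ler_sum => i _; rewrite -mulmxE; apply: (le_trans (mxnormM _ _)).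
rewrite mulrA ler_wpM2r ?mxnorm_ge0//.
apply: (le_trans (mxnorm_sum _ _ _)).
apply: (@le_trans _ _ (B * r ^+ i * \sum_(j < s) c j * r ^+ (s - j))).
  rewrite mulr_sumr; apply: ler_sum => j _.
  rewrite mxnorm_scalar_seq ger0_norm; last exact/ltW/nbinom_gt0.
  rewrite mulrCA ler_wpM2l//; first exact/ltW/nbinom_gt0.
  apply: (le_trans (GB _)); rewrite -mulrA ler_wpM2l// -exprD.
  by rewrite addnBA 1?ltnW// addnC.
rewrite mulrAC mulrC [leRHS]mulrC; apply: ler_wpM2l; first exact: exprn_ge0.
apply: (@le_trans _ _ (B * \sum_(j < s.+1) c j * r ^+ (s - j))).
  rewrite ler_wpM2l// big_ord_recr/= lerDl mulr_ge0 ?exprn_ge0//.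
have -> : K * c s = B * ((1 - r)^-1 ^+ 2 / d * c s) by rewrite /farima_cst; ring.
by rewrite ler_wpM2l// nbinom_geo.
Qed.

End HalfLine.


(** * Half-line Toeplitz equations and weighted bounds on the kernel *)

Section HalfLineReproducing.
Context {R : realType} {p : nat}.
Local Notation C := R[i].
Local Notation M := 'M[C]_p.+1.

Definition mshift (om : nat -> M) y m : M := if (y <= m)%N then om (m - y)%N else 0.

(* gamma is the sequence of Fourier coefficients of h h^*, h = sum_k om_k z^k *)
Definition autocov (om : nat -> M) (gamma : int -> M) := forall y t : nat,
  mcvg (fun n => \sum_(m < n) mshift om y m * (mshift om t m)^t*)
       (gamma (t%:Z - y%:Z)).

Variables (d : R) (d01 : 0 < d < half).
Variables (G H : nat -> M) (B r : R).
Hypotheses (B0 : 0 <= B) (r01 : 0 <= r < 1).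
Hypothesis GB : forall k, mxnorm (G k) <= B * r ^+ k.
Hypothesis HB : forall k, mxnorm (H k) <= B * r ^+ k.
Hypothesis GH : conv G H =1 conv1.
Hypothesis HG : conv H G =1 conv1.
Variable gamma : int -> M.
Local Notation om := (farima_coef d G).
Local Notation al := (farima_inv d H).
Local Notation kern := (half_kernel d G H).
Local Notation K := (farima_cst d B r).
Local Notation c := (nbinom d).
Hypothesis gammaE : autocov om gamma.

Lemma mshift_bound y m : mxnorm (mshift om y m) <= K * shifted d y m.
Proof.
rewrite /mshift /shifted; case: ifP => _; last by rewrite mxnorm0 mulr0.
exact: (@farima_coef_bound _ _ _ d01 G B r).
Qed.

Lemma mul_mshift_bound y t m :
  mxnorm (mshift om y m * (mshift om t m)^t*) <=
  K ^+ 2 * (shifted d y m * shifted d t m).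
Proof.
rewrite -mulmxE; apply: (le_trans (mxnormM _ _)); rewrite mxnorm_ct.
apply: (le_trans (ler_pM (mxnorm_ge0 _) (mxnorm_ge0 _) (mshift_bound _ _) (mshift_bound _ _))).
by rewrite mulrACA expr2.
Qed.

Lemma autocov_bound (k : nat) :
  mxnorm (gamma k) <= K ^+ 2 * autocorr d 0 * frac_weight d k.
Proof.
have := gammaE 0 k; rewrite subr0 => h.
apply: (mcvg_norm_le h); apply: nearW => n; apply: (le_trans (mxnorm_sum _ _ _)).
apply: (@le_trans _ _ (\sum_(m < n) K ^+ 2 * (shifted d 0 m * shifted d k m))).
  by apply: ler_sum => m _; exact: mul_mshift_bound.
rewrite -mulr_sumr -mulrA ler_wpM2l ?sqr_ge0//.
apply: (le_trans (sum_shifted_le d01 _ _ _)).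
by rewrite subn0 sub0n addn0 autocorr_le.
Qed.

Lemma half_kernel_sum s : (0 < s)%N ->
  exists Bs : R, forall n, \sum_(y < n) mxnorm (kern s y) <= Bs.
Proof.
move=> s0.
have d1 : 0 < d < 1 by have := @half_mul2 R; case/andP: d01 => *; apply/andP; split; lra.
exists (p.+1%:R + K * c s * ((1 - r)^-1 * (B / (1 - r) * 2))) => n.
have Kc0 : 0 <= K * c s.
  rewrite mulr_ge0 ?(farima_cst_ge0 d01)//.
  by apply/ltW/nbinom_gt0; case/andP: d01.
apply: (@le_trans _ _ (\sum_(y < n) (p.+1%:R * frac_kernel d s y +
    K * c s * corr_profile d H r y))).
  apply: ler_sum => y _; rewrite (half_kernelE _ GH)//.
  apply: (le_trans (mxnormD _ _)); rewrite lerD//.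
    by rewrite mxnorm_scalar cabs_real ger0_norm// frac_kernel_ge0.
  exact: (kernel_corr_bound d01).
rewrite big_split/= -!mulr_sumr lerD// ?ler_piMr ?sum_frac_kernel_le1//.
by rewrite ler_wpM2l// corr_profile_sum.
Qed.

Lemma half_kernel_mshift s Y m : (m < Y)%N ->
  \sum_(y < Y) kern s y * mshift om y m = om (s + m)%N.
Proof.
move=> mY; rewrite -(conv_half_kernel d HG) /conv.
rewrite -(big_mkord xpredT (fun y => kern s y * mshift om y m)).
rewrite (big_cat_nat (leq0n _) mY)/= [X in _ + X]big_nat [X in _ + X]big1 ?addr0; last first.
  by move=> i /andP[mi _]; rewrite /mshift leqNgt mi mulr0.
by rewrite big_mkord; apply: eq_bigr => i _; rewrite /mshift -ltnS ltn_ord.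
Qed.

(** Write the covariances as inner products of delayed copies of [om]. For m < Y the truncated
    kernel reproduces [om (s + m)] exactly ([half_kernel_mshift]); only the indices m >= Y
    contribute an error, small because [kern s] is summable and the products of delayed coefficients
    have small tails. *)
Lemma half_line_reproducing s (t : nat) : (0 < s)%N ->
  mcvg (fun Y => \sum_(y < Y) kern s y * gamma (t%:Z - y%:Z)) (gamma (s + t)%N).
Proof.
move=> s0.
have [tau [tau0 tauge taud htau]] := shifted_autocorr_tail d01.
have [Bs hBs] := half_kernel_sum s0.
have Bs0 : 0 <= Bs by have := hBs 0%N; rewrite big_ord0.
pose tl y Y := tau (Y - y)%N + tau (Y - t)%N.
have tail y Y n : (Y <= n)%N ->
    \sum_(Y <= m < n) shifted d y m * shifted d t m <= tl y Y.
  move=> Yn; rewrite sum_nat_diff//.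
  have := htau y t Y; rewrite ger0_norm ?subr_ge0 ?sum_shifted_le// -/(tl y Y).
  by have := sum_shifted_le d01 y t n; lra.
(* The first two terms bound the part of the error coming from the truncated kernel, the last one
   the part coming from [om (s + m)] with m >= Y. *)
pose delta Y := K ^+ 2 * (\sum_(y < Y) mxnorm (kern s y) * tau (Y - y)%N
    + Bs * tau (Y - t)%N + tl 0%N Y).
apply: (@mcvg_le _ _ _ _ _ delta); last first.
  rewrite /delta -[X in _ --> X](mulr0 (K ^+ 2)); apply: cvgM; first exact: cvg_cst.
  rewrite -[X in _ --> X](addr0 0); apply: cvgD.
    rewrite -[X in _ --> X](addr0 0); apply: cvgD.
      have := @conv_l1_c0 _ _ tau Bs 0 (fun y => mxnorm_ge0 (kern s y)) hBs tau0 tauge taud.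
      by under eq_fun do under eq_bigr do rewrite subn0.
    rewrite -[X in _ --> X](mulr0 Bs); apply: cvgM; first exact: cvg_cst.
    exact: cvg_natB.
  rewrite /tl -[X in _ --> X](addr0 0); apply: cvgD; exact: cvg_natB.
move=> Y.
pose P n := \sum_(y < Y) kern s y * (\sum_(m < n) mshift om y m * (mshift om t m)^t*).
have cP : mcvg P (\sum_(y < Y) kern s y * gamma (t%:Z - y%:Z)).
  by apply: mcvg_sum => y; apply: mcvgMl; exact: gammaE.
pose V n := \sum_(m < n) om (s + m)%N * (mshift om t m)^t*.
have cV : mcvg V (gamma (s + t)%N).
  have := gammaE 0 (s + t); rewrite subr0 => /(mcvg_shift s).
  congr (mcvg _ _); apply/funext => n.
  rewrite -(big_mkord xpredT (fun m => mshift om 0 m * (mshift om (s + t) m)^t*)).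
  rewrite (big_cat_nat (leq0n s) (leq_addl n s))/= big_nat big1 ?add0r; last first.
    move=> m /andP[_ ms]; rewrite {2}/mshift leqNgt ltn_addr// trmx0 map_mx0.
    by rewrite mulr0.
  rewrite -{1}(add0n s) big_addn addnK big_mkord; apply: eq_bigr => m _.
  by rewrite /mshift leq0n subn0 addnC leq_add2l subnDl.
apply: (mcvg_norm_le (mcvgB cP cV)); exists Y => // n /= Yn.
have -> : P n - V n = \sum_(Y <= m < n)
    ((\sum_(y < Y) kern s y * mshift om y m) - om (s + m)%N) * (mshift om t m)^t*.
  rewrite sum_nat_diff// [X in _ = _ - X]big1 ?subr0 => [|m _]; last first.
    by rewrite half_kernel_mshift// subrr mul0r.
  under eq_bigr do rewrite mulrBl mulr_suml.
  rewrite sumrB exchange_big/=; congr (_ - _); apply: eq_bigr => y _.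
  by rewrite mulr_sumr; apply: eq_bigr => m _; rewrite mulrA.
apply: (le_trans (mxnorm_sum _ _ _)).
apply: (@le_trans _ _ (\sum_(Y <= m < n) (\sum_(y < Y) mxnorm (kern s y) *
    (K ^+ 2 * (shifted d y m * shifted d t m)) + K ^+ 2 * (shifted d 0 m * shifted d t m)))).
  apply: ler_sum => m _; rewrite mulrBl; apply: (le_trans (mxnormB _ _)); apply: lerD.
    rewrite mulr_suml; apply: (le_trans (mxnorm_sum _ _ _)); apply: ler_sum => y _.
    rewrite -mulrA -mulmxE; apply: (le_trans (mxnormM _ _)).
    by rewrite ler_wpM2l ?mxnorm_ge0// mul_mshift_bound.
  rewrite -mulmxE; apply: (le_trans (mxnormM _ _)); rewrite mxnorm_ct expr2 mulrACA.
  apply: ler_pM (mshift_bound _ _) => //; rewrite ?mxnorm_ge0//.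
  apply: (le_trans (@farima_coef_bound _ _ _ d01 G B r B0 r01 GB _)).
  rewrite ler_wpM2l ?(farima_cst_ge0 d01)// /shifted leq0n subn0.
  by rewrite nbinom_antitone ?exponent_le1// leq_addl.
rewrite big_split/= exchange_big/= /delta mulrDr lerD//; last first.
  by rewrite -mulr_sumr ler_wpM2l ?sqr_ge0// tail.
apply: (@le_trans _ _ (\sum_(y < Y) mxnorm (kern s y) * (K ^+ 2 * tl y Y))).
  apply: ler_sum => y _; rewrite -mulr_sumr ler_wpM2l ?mxnorm_ge0//.
  by rewrite -mulr_sumr ler_wpM2l ?sqr_ge0// tail.
under eq_bigr do rewrite mulrCA mulrDr.
rewrite -mulr_sumr ler_wpM2l ?sqr_ge0// big_split/= lerD2l -mulr_suml.
by apply: ler_wpM2r; [exact: tauge|exact: hBs].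
Qed.

(** The majorant [kabs] is defined by its action on a matrix factor, not as the norm of [kern s y]:
    a scalar matrix multiplies norms by exactly its scalar, whereas its own [mxnorm] carries the
    dimension, which would spoil the rate. In the bound with [C0], where no rate is at stake, the
    dimension is allowed. The error [eta] comes from the tail of the correction profile. *)
Lemma half_line_bounds : exists (kabs : nat -> nat -> R) (C0 : R) (eta : nat -> R),
  [/\ forall s y, (0 < s)%N -> 0 <= kabs s y,
      forall s y A, (0 < s)%N -> mxnorm (kern s y * A) <= kabs s y * mxnorm A,
      forall s n, (0 < s)%N -> (0 < n)%N ->
        frac_weight d n * \sum_(y < n) mxnorm (kern s y) <= C0 * frac_weight d (s + n),
      eta @ \oo --> (0 : R) &
      forall s n m, (0 < s)%N -> (0 < n)%N ->
        \sum_(n <= y < m) kabs s y * frac_weight d y.+1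
          <= (frac_rate d + eta n) * frac_weight d (s + n)].
Proof.
have [d0 d1] := andP d01; have hD := @half_mul2 R.
have d1' : 0 < d < 1 by apply/andP; split; lra.
have dh : 0 < d <= 2^-1 by rewrite d0 ltW.
have fw k : 0 < frac_weight d k by exact: frac_weight_gt0.
pose E := (1 - r)^-1 * (B / (1 - r) * 2).
have e0 := corr_profile_ge0 d H r01.
have eE : forall n, \sum_(k < n) corr_profile d H r k <= E.
  by move=> n; exact: corr_profile_sum.
have E0 : 0 <= E by have := eE 0%N; rewrite big_ord0.
have K0 : 0 <= K by exact: farima_cst_ge0.
have [tau [tau0 tauE _ htau]] := sum_tail e0 eE.
have c0 s : 0 <= c s by exact/ltW/nbinom_gt0.
exists (fun s y => frac_kernel d s y + K * c s * corr_profile d H r y).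
exists (p.+1%:R * 2 + 2 * K * E), (fun n => 2 * K * tau n); split.
- move=> s y s0; rewrite addr_ge0 ?frac_kernel_ge0//.
  exact: mulr_ge0 (mulr_ge0 K0 (c0 s)) (e0 y).
- move=> s y A s0; rewrite (half_kernelE _ GH)// !mulrDl.
  apply: (le_trans (mxnormD _ _)); apply: lerD.
    by rewrite -mulmxE mul_scalar_mx mxnormZ cabs_real ger0_norm// frac_kernel_ge0.
  rewrite -mulmxE; apply: (le_trans (mxnormM _ _)); rewrite ler_wpM2r ?mxnorm_ge0//.
  exact: (kernel_corr_bound d01).
- move=> s n s0 n0.
  apply: (@le_trans _ _ (frac_weight d n * \sum_(y < n) (p.+1%:R * frac_kernel d s y +
      K * c s * corr_profile d H r y))).
    rewrite ler_wpM2l ?(ltW (fw _))//; apply: ler_sum => y _.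
    rewrite (half_kernelE _ GH)//.
    apply: (le_trans (mxnormD _ _)); rewrite lerD//.
      by rewrite mxnorm_scalar cabs_real ger0_norm// frac_kernel_ge0.
    exact: (kernel_corr_bound d01).
  rewrite big_split/= mulrDr mulrDl; apply: lerD.
    by rewrite -mulr_sumr mulrCA -mulrA ler_wpM2l// frac_weight_sum_kernel.
  rewrite -mulr_sumr.
  apply: (@le_trans _ _ (K * (c s * frac_weight d n) * E)).
    have -> : K * (c s * frac_weight d n) * E = frac_weight d n * (K * c s * E) by ring.
    by rewrite ler_wpM2l ?(ltW (fw _))// ler_wpM2l ?eE//; exact: mulr_ge0 K0 (c0 s).
  have -> : 2 * K * E * frac_weight d (s + n) = K * (2 * frac_weight d (s + n)) * E by ring.
  by rewrite ler_wpM2r// ler_wpM2l// nbinom_frac_weight.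
- rewrite -[X in _ --> X](mulr0 (2 * K)); apply: cvgM => //; exact: cvg_cst.
move=> s n m s0 n0.
have [mn|nm] := leqP m n.
  rewrite big_geq// mulr_ge0 ?(ltW (fw _))// addr_ge0//.
    by rewrite /frac_rate !mulr_ge0//; lra.
  by apply: mulr_ge0; [exact: mulr_ge0|case/andP: (tauE n)].
under eq_bigr do rewrite mulrDl.
rewrite big_split/= mulrDl; apply: lerD; first exact: frac_kernel_contraction.
apply: (@le_trans _ _ (\sum_(n <= y < m) K * (c s * frac_weight d n) * corr_profile d H r y)).
  rewrite !big_nat; apply: ler_sum => y /andP[ny _].
  rewrite mulrAC; apply: ler_wpM2r; first exact: e0.
  rewrite -[leLHS]mulrA; apply: ler_wpM2l => //; apply: ler_wpM2l; first exact: c0.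
  by apply: frac_weight_antitone => //; exact: leqW.
rewrite -mulr_sumr.
have -> : 2 * K * tau n * frac_weight d (s + n) = K * (2 * frac_weight d (s + n)) * tau n by ring.
apply: ler_pM; last exact: htau (ltnW nm).
- by apply: mulr_ge0 => //; apply: mulr_ge0; [exact: c0|exact: ltW].
- by rewrite sumr_ge0.
- by rewrite ler_wpM2l// nbinom_frac_weight.
Qed.

End HalfLineReproducing.

(** * Toeplitz systems on finite intervals *)

Section Toeplitz.
Context {R : realType} {p : nat}.
Local Notation C := R[i].
Local Notation M := 'M[C]_p.+1.

Definition toep (gamma : int -> M) n (x : nat -> M) (l : nat) : M :=
  \sum_(j < n) x j * gamma (l%:Z - (j : nat)%:Z).

(* The quadratic form of the block Toeplitz matrix is sum_m |x_0 om_m + ... + x_m om_0|^2. *)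
Lemma toep_inj (om al : nat -> M) gamma n x : autocov om gamma ->
    conv om al =1 conv1 -> (forall l, (l < n)%N -> toep gamma n x l = 0) ->
  forall j, (j < n)%N -> x j = 0.
Proof.
move=> omg oma x0.
pose Z m := \sum_(j < n) x j * mshift om j m.
have cZ : mcvg (fun N => \sum_(m < N) Z m * (Z m)^t*) (0 : M).
  have : mcvg (fun N => \sum_(l < n) \sum_(j < n) x j *
      (\sum_(m < N) mshift om j m * (mshift om l m)^t*) * (x l)^t*)
      (\sum_(l < n) \sum_(j < n) x j * gamma ((l : nat)%:Z - (j : nat)%:Z) * (x l)^t*).
    apply: mcvg_sum => l; apply: mcvg_sum => j.
    by apply: mcvgMr; apply: mcvgMl; exact: omg.
  rewrite (_ : \sum_(l < n) _ = 0); last first.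
    by rewrite big1// => l _; rewrite -mulr_suml -/(toep gamma n x l) x0// mul0r.
  congr (mcvg _ _); apply/funext => N.
  rewrite (eq_bigr (fun l : 'I_n => \sum_(m < N) Z m * ((mshift om l m)^t* * (x l)^t*))).
    rewrite exchange_big/=; apply: eq_bigr => m _; rewrite -mulr_sumr; congr (_ * _).
    rewrite /Z raddf_sum/= raddf_sum/=; apply: eq_bigr => l _.
    by rewrite -!mulmxE trmx_mul map_mxM.
  move=> l _; rewrite (eq_bigr (fun j : 'I_n => \sum_(m < N)
      (x j * mshift om j m) * ((mshift om l m)^t* * (x l)^t*))).
    by rewrite exchange_big/=; apply: eq_bigr => m _; rewrite -mulr_suml.
  move=> j _; rewrite mulr_sumr mulr_suml; apply: eq_bigr => m _.
  by rewrite !mulrA.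
have Z0 m : Z m = 0.
  apply/matrixP => i k; rewrite mxE; apply: cabs_eq0; apply/eqP.
  rewrite -sqrf_eq0 eq_le sqr_ge0 andbT.
  (* A diagonal entry of Z times its conjugate transpose is a sum of squared moduli, so each single
     square lies below the norm of the partial sum. *)
  have h : forall N, (m < N)%N -> cabs (Z m i k) ^+ 2 <=
      mxnorm (\sum_(m < N) Z m * (Z m)^t* - 0).
    move=> N mN; rewrite subr0.
    apply: le_trans (mxnorm_entry _ i i); apply: le_trans (Re_le_cabs _).
    apply: le_trans (ler_norm _).
    rewrite [X in complex.Re X]summxE Re_sum (bigD1 (Ordinal mN))//=.
    have hd m' : complex.Re ((Z m' * (Z m')^t*) i i) = \sum_k cabs (Z m' i k) ^+ 2.
      rewrite -mulmxE mxE Re_sum; apply: eq_bigr => k' _.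
      by rewrite !mxE mul_conj_cabs.
    rewrite hd (bigD1 k)//= -addrA lerDl addr_ge0//.
      by apply: sumr_ge0 => *; exact: sqr_ge0.
    apply: sumr_ge0 => m' _; rewrite hd.
    by apply: sumr_ge0 => *; exact: sqr_ge0.
  rewrite -(cvg_lim _ cZ)//; apply: limr_ge; first by apply/cvg_ex; eexists; exact: cZ.
  by exists m.+1 => // N /= mN; exact: h.
(* Vanishing of [Z] says that [x], extended by zero, convolves with [om] to zero; convolution with
   [al] then recovers [x]. *)
pose x' j : M := if (j < n)%N then x j else 0.
have c0 m : conv x' om m = 0.
  rewrite -(Z0 m) /Z /conv.
  transitivity (\sum_(j < n + m.+1) x' j * mshift om j m).
    rewrite (big_ord_widen (n + m.+1) (fun i => x' i * om (m - i)%N)) ?leq_addl//.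
    rewrite [RHS](bigID (fun j : 'I_(n + m.+1) => (j < m.+1)%N))/= [X in _ + X]big1 ?addr0.
      by apply: eq_bigr => i im; rewrite /mshift -ltnS im.
    by move=> i; rewrite -leqNgt => im; rewrite /mshift leqNgt im mulr0.
  rewrite (big_ord_widen (n + m.+1) (fun j => x j * mshift om j m)) ?leq_addr//.
  rewrite (bigID (fun j : 'I_(n + m.+1) => (j < n)%N))/= [X in _ + X]big1 ?addr0.
    by apply: eq_bigr => i im; rewrite /x' im.
  by move=> i /negbTE im; rewrite /x' im mul0r.
move=> j jn; have : x' j = 0.
  rewrite -[LHS](conv1r x') -(eq_conv (fun=> erefl) oma) convA.
  exact: conv0l.
by rewrite /x' jn.
Qed.

Lemma linear_ffun_bound n (g : {linear {ffun 'I_n -> M} -> {ffun 'I_n -> M}}) :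
  exists2 B : R, 0 <= B & forall r : {ffun 'I_n -> M},
    \sum_j mxnorm (g r j) <= B * \sum_l mxnorm (r l).
Proof.
pose E (t : 'I_n * ('I_p.+1 * 'I_p.+1)) : {ffun 'I_n -> M} :=
  [ffun k => if k == t.1 then delta_mx t.2.1 t.2.2 else 0].
exists (\sum_t \sum_j mxnorm (g (E t) j)).
  by apply: sumr_ge0 => t _; apply: sumr_ge0 => j _; exact: mxnorm_ge0.
move=> r.
have rE : r = \sum_t r t.1 t.2.1 t.2.2 *: E t.
  apply/ffunP => k; apply/matrixP => a b; rewrite sum_ffunE summxE.
  rewrite (bigD1 (k, (a, b)))//= !ffunE eqxx !mxE !eqxx mulr1 big1 ?addr0//.
  move=> [k' [a' b']] /= neq; rewrite !ffunE/= mxE.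
  have [kk|_] := eqVneq k k'; last by rewrite mxE mulr0.
  rewrite mxE; have [aa|_] := eqVneq a a'; last by rewrite mulr0.
  have [bb|_] := eqVneq b b'; last by rewrite andbF mulr0.
  by rewrite kk aa bb eqxx in neq.
rewrite {1}rE raddf_sum mulr_suml.
apply: (@le_trans _ _ (\sum_t \sum_j cabs (r t.1 t.2.1 t.2.2) * mxnorm (g (E t) j))).
  rewrite [leRHS]exchange_big/=; apply: ler_sum => j _.
  rewrite sum_ffunE; apply: (le_trans (mxnorm_sum _ _ _)); apply: ler_sum => t _.
  by rewrite linearZ/= ffunE mxnormZ.
apply: ler_sum => t _; rewrite -mulr_sumr mulrC ler_wpM2l//.
  by apply: sumr_ge0 => j _; exact: mxnorm_ge0.
apply: (le_trans (mxnorm_entry _ _ _)); rewrite (bigD1 t.1)//= lerDl.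
by apply: sumr_ge0 => j _; exact: mxnorm_ge0.
Qed.

Section Solve.
Variables (gamma : int -> M) (n : nat).
Hypothesis inj : forall x, (forall l, (l < n)%N -> toep gamma n x l = 0) ->
  forall j, (j < n)%N -> x j = 0.

Definition ffun_ext (x : {ffun 'I_n -> M}) (j : nat) : M :=
  if insub j is Some i then x i else 0.

Lemma ffun_ext_ord (x : {ffun 'I_n -> M}) (j : 'I_n) : ffun_ext x j = x j.
Proof. by rewrite /ffun_ext valK. Qed.

Definition toep_ffun (x : {ffun 'I_n -> M}) : {ffun 'I_n -> M} :=
  [ffun l : 'I_n => toep gamma n (ffun_ext x) l].

Lemma toep_ffun_linear : linear toep_ffun.
Proof.
move=> k x y; apply/ffunP => l; rewrite !ffunE /toep scaler_sumr -big_split/=.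
by apply: eq_bigr => j _; rewrite !ffun_ext_ord !ffunE mulrDl scalerAl.
Qed.

HB.instance Definition _ := GRing.isLinear.Build C {ffun 'I_n -> M} {ffun 'I_n -> M} _
  toep_ffun toep_ffun_linear.

Local Notation T := toep_ffun.
Local Notation TL := (toep_ffun : {linear {ffun 'I_n -> M} -> {ffun 'I_n -> M}}).

(** An injective endomorphism of a finite-dimensional space is invertible, and its inverse is
    bounded. The constant [B] depends on [n] without any control; later arguments use only its
    finiteness. *)
Lemma toep_solve :
  (forall r : nat -> M, exists x, forall l, (l < n)%N -> toep gamma n x l = r l) /\
  exists2 B : R, 0 <= B & forall x : nat -> M, \sum_(j < n) mxnorm (x j) <=
    B * \sum_(l < n) mxnorm (toep gamma n x l).
Proof.
have TE x : linfun TL x = T x by exact: (lfunE TL).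
have ker0 : lker (linfun TL) == 0%VS.
  apply/lker0P; apply: raddf_inj => x Tx0; have {}Tx0 : T x = 0 by rewrite -TE.
  apply/ffunP => j; rewrite ffunE -ffun_ext_ord; apply: inj => // l ln.
  by have /ffunP/(_ (Ordinal ln)) := Tx0; rewrite !ffunE.
have TV r : T ((linfun TL)^-1%VF r) = r.
  by rewrite -TE; exact: lker0_lfunVK.
split.
  move=> r; pose r' := [ffun l : 'I_n => r l].
  exists (ffun_ext ((linfun TL)^-1%VF r')) => l ln.
  by have /ffunP/(_ (Ordinal ln)) := TV r'; rewrite !ffunE.
have [B B0 hB] := linear_ffun_bound ((linfun TL)^-1%VF : {linear _ -> _}).
exists B => // x; have := hB (T [ffun j : 'I_n => x j]).
have e : (linfun TL)^-1%VF (T [ffun j : 'I_n => x j]) = [ffun j : 'I_n => x j].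
  by rewrite -TE; exact: lker0_lfunK.
rewrite (eq_bigr (fun j : 'I_n => mxnorm (x j))) => [|j _]; last first.
  by congr mxnorm; rewrite -[RHS](ffunE (fun j : 'I_n => x j)) -[in RHS]e.
move=> /le_trans; apply; rewrite le_eqVlt; apply/orP; left; apply/eqP; congr (_ * _).
apply: eq_bigr => l _; rewrite ffunE; congr mxnorm; apply: eq_bigr => j _.
by rewrite ffun_ext_ord ffunE.
Qed.

End Solve.

End Toeplitz.


Lemma cvg_sum0 (R : realType) n (u : 'I_n -> nat -> R) :
  (forall i, u i @ \oo --> (0 : R)) -> (fun k => \sum_(i < n) u i k) @ \oo --> (0 : R).
Proof.
move=> h; rewrite [X in _ --> X](_ : _ = \sum_(i < n) (0 : R)); last by rewrite big1.
apply: cvg_big => //; exact: add_continuous.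
Qed.

(** * From the half line to a finite interval *)

Section Interval.
Context {R : realType} {p : nat}.
Local Notation C := R[i].
Local Notation M := 'M[C]_p.+1.

Section Step.
Variables (gamma : int -> M) (n : nat) (kern : nat -> nat -> M).
Hypothesis n0 : (0 < n)%N.
Hypothesis kernP : forall s t : nat, (0 < s)%N ->
  mcvg (fun Y => \sum_(y < Y) kern s y * gamma (t%:Z - y%:Z)) (gamma (s + t)%N).
Variable B : R.
Hypothesis stab : forall x : nat -> M,
  \sum_(j < n) mxnorm (x j) <= B * \sum_(l < n) mxnorm (toep gamma n x l).
(* b s and b' s expand the points at distance s to the left and, after the reflection
   j |-> n - 1 - j, to the right of the interval {0, ..., n - 1}. *)
Variables b b' : nat -> nat -> M.
Hypothesis bP : forall s l, (0 < s)%N -> (l < n)%N -> toep gamma n (b s) l = gamma (l + s)%N.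
Hypothesis b'P : forall s l, (0 < s)%N -> (l < n)%N ->
  toep (fun k => gamma (- k)) n (b' s) l = gamma (- (l + s)%N%:Z).

(** Each exterior point y >= n of the half-line expansion lies at distance y - n + 1 to the right of
    the interval and is replaced by its expansion inside, read backwards through j |-> n - 1 - j. On
    the interval the result has the same Toeplitz image as the truncated half-line sum, which tends
    to the right-hand side solved by [b s]; stability of the finite system turns this into
    convergence of the coefficients. *)
Lemma interval_split s j : (0 < s)%N -> (j < n)%N ->
  mcvg (fun Y => \sum_(n <= y < Y) kern s y * b' (y - n).+1 (n.-1 - j)%N)
       (b s j - kern s j).
Proof.
move=> s0 jn.
pose x Y (j : nat) := kern s j + \sum_(n <= y < Y) kern s y * b' (y - n).+1 (n.-1 - j)%N.
have xP Y l : (n <= Y)%N -> (l < n)%N ->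
    toep gamma n (x Y) l = \sum_(y < Y) kern s y * gamma (l%:Z - y%:Z).
  move=> nY ln; rewrite /toep /x; under eq_bigr do rewrite mulrDl mulr_suml.
  rewrite big_split/= exchange_big/=.
  rewrite -(big_mkord xpredT (fun j => kern s j * gamma (l%:Z - j%:Z))).
  rewrite -(big_mkord xpredT (fun j => kern s j * gamma (l%:Z - j%:Z))).
  rewrite [RHS](big_cat_nat (leq0n n) nY)/=; congr (_ + _).
  rewrite !big_nat; apply: eq_bigr => y /andP[ny _].
  under eq_bigr do rewrite -mulrA.
  rewrite -mulr_sumr; congr (_ * _).
  have ln' : (n.-1 - l < n)%N by lia.
  transitivity (toep (fun k => gamma (- k)) n (b' (y - n).+1) (n.-1 - l)).
    rewrite /toep [RHS](reindex_inj rev_ord_inj)/=; apply: eq_bigr => i _.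
    have -> : (n - i.+1 = n.-1 - i)%N by lia.
    congr (_ * gamma _); have := ltn_ord i; lia.
  by rewrite b'P//; congr gamma; lia.
apply: (@mcvg_le _ _ _ _ _ (fun Y => if (n <= Y)%N then
    B * \sum_(l < n) mxnorm (\sum_(y < Y) kern s y * gamma (l%:Z - y%:Z) - gamma (s + l)%N)
  else mxnorm (b s j - kern s j))).
  move=> Y; case: ifPn => [nY|]; last first.
    by rewrite -ltnNge => Yn; rewrite big_geq ?(ltnW Yn)// sub0r mxnormN.
  have := stab (fun j => x Y j - b s j).
  under [X in _ <= _ * X -> _]eq_bigr => l _.
    have -> : toep gamma n (fun j => x Y j - b s j) l =
        \sum_(y < Y) kern s y * gamma ((l : nat)%:Z - (y : nat)%:Z) - gamma (s + l)%N.
      rewrite -xP// addnC -bP// /toep -sumrB; apply: eq_bigr => i _.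
      by rewrite mulrBl.
    over.
  apply: le_trans; rewrite (bigD1 (Ordinal jn))//=.
  have -> : x Y j - b s j = \sum_(n <= y < Y) kern s y * b' (y - n).+1 (n.-1 - j)%N - (b s j - kern s j).
    by rewrite /x opprB addrA [_ + kern s j]addrC.
  by rewrite lerDl sumr_ge0// => i _; exact: mxnorm_ge0.
have h : (fun Y => B * \sum_(l < n) mxnorm (\sum_(y < Y) kern s y *
    gamma ((l : nat)%:Z - (y : nat)%:Z) - gamma (s + l)%N)) @ \oo --> (0 : R).
  rewrite -[X in _ --> X](mulr0 B); apply: cvgM; first exact: cvg_cst.
  by apply: cvg_sum0 => l; exact: kernP.
apply: cvg_trans h; apply: near_eq_cvg; exists n => // Y /= nY.
by rewrite nY.
Qed.

(** The infinite expansion is met only through its partial sums, whose uniform bound passes to the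
    limit. The majorant [w] is left open because it takes two forms: the weighted kernel in the
    contraction, and the norms of the first row in the final estimate. *)
Lemma sum_interval_split s (T A : R) (w : nat -> R) : (0 < s)%N -> 0 <= A ->
    (forall y, 0 <= w y) ->
    (forall y, (n <= y)%N -> \sum_(j < n) mxnorm (kern s y * b' (y - n).+1 j) <= A * w y) ->
    (forall Y, \sum_(n <= y < Y) w y <= T) ->
  \sum_(j < n) mxnorm (b s j - kern s j) <= A * T.
Proof.
move=> s0 A0 w0 hw hT.
pose u j Y := \sum_(n <= y < Y) kern s y * b' (y - n).+1 (n.-1 - j)%N.
have h : (fun Y => A * T + \sum_(j < n) mxnorm (u j Y - (b s j - kern s j))) @ \oo --> A * T + 0.
  apply: cvgD; first exact: cvg_cst.
  by apply: cvg_sum0 => j; exact: interval_split.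
rewrite -[leRHS]addr0 -(cvg_lim _ h)//; apply: limr_ge.
  by apply/cvg_ex; eexists; exact: h.
apply: nearW => Y.
apply: (@le_trans _ _ (\sum_(j < n) (mxnorm (u j Y) + mxnorm (u j Y - (b s j - kern s j))))).
  apply: ler_sum => j _; rewrite -{1}[X in mxnorm X](subKr (u j Y)).
  exact: mxnormB.
rewrite big_split/= lerD2r.
apply: (@le_trans _ _ (\sum_(j < n) \sum_(n <= y < Y) mxnorm (kern s y * b' (y - n).+1 (n.-1 - j)%N))).
  by apply: ler_sum => j _; exact: mxnorm_sum.
rewrite exchange_big/=; apply: (@le_trans _ _ (\sum_(n <= y < Y) A * w y)).
  rewrite !big_nat; apply: ler_sum => y /andP[ny _].
  apply: le_trans (hw _ ny); rewrite [leRHS](reindex_inj rev_ord_inj)/=.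
  rewrite le_eqVlt; apply/orP; left; apply/eqP; apply: eq_bigr => j _.
  by congr (mxnorm (_ * b' _ _)); lia.
by rewrite -mulr_sumr ler_wpM2l.
Qed.

End Step.

End Interval.


(** * Contraction and Baxter's inequality for Toeplitz systems *)

Section Baxter.
Context {R : realType} {p : nat}.
Local Notation C := R[i].
Local Notation M := 'M[C]_p.+1.
Variables (d : R) (d01 : 0 < d < half).
Local Notation f := (frac_weight d).

(* kern solves the Toeplitz equations on the half line; its majorant kabs contracts the
   weight f at a rate that tends to frac_rate d < 1. *)
Definition half_line (gamma : int -> M) (kern : nat -> nat -> M) :=
  [/\ forall s t : nat, (0 < s)%N ->
        mcvg (fun Y => \sum_(y < Y) kern s y * gamma (t%:Z - y%:Z)) (gamma (s + t)%N),
      exists (kabs : nat -> nat -> R) (C0 : R) (eta : nat -> R),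
      [/\ forall s y, (0 < s)%N -> 0 <= kabs s y,
          forall s y A, (0 < s)%N -> mxnorm (kern s y * A) <= kabs s y * mxnorm A,
          forall s n, (0 < s)%N -> (0 < n)%N ->
            f n * \sum_(y < n) mxnorm (kern s y) <= C0 * f (s + n),
          eta @ \oo --> (0 : R) &
          forall s n m, (0 < s)%N -> (0 < n)%N ->
            \sum_(n <= y < m) kabs s y * f y.+1 <= (frac_rate d + eta n) * f (s + n)],
      exists Cg : R, forall k : nat, mxnorm (gamma k) <= Cg * f k &
      forall n x, (forall l, (l < n)%N -> toep gamma n x l = 0) ->
        forall j, (j < n)%N -> x j = 0].

Lemma farima_half_line (G H : nat -> M) (B r : R) gamma :
    0 <= B -> 0 <= r < 1 ->
    (forall k, mxnorm (G k) <= B * r ^+ k) -> (forall k, mxnorm (H k) <= B * r ^+ k) ->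
    conv G H =1 conv1 -> conv H G =1 conv1 ->
    autocov (farima_coef d G) gamma ->
  half_line gamma (half_kernel d G H).
Proof.
move=> B0 r01 GB HB GH HG gammaE; split.
- by move=> s t s0; exact: (half_line_reproducing d01 B0 r01 GB HB GH HG gammaE).
- exact: (half_line_bounds d01 B0 r01 GB HB GH).
- by exists (farima_cst d B r ^+ 2 * autocorr d 0) => k; exact: (autocov_bound d01 B0 r01 GB gammaE).
- move=> n x; apply: (toep_inj gammaE (al := farima_inv d H)).
  exact: farima_coef_inv.
Qed.

Local Lemma fgt0 k : 0 < f k. Proof. by apply: frac_weight_gt0; case/andP: d01. Qed.

Section FixedLength.
Variables (gamma : int -> M) (kern kern' : nat -> nat -> M) (n : nat).
Hypothesis n0 : (0 < n)%N.
Variables b b' : nat -> nat -> M.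
Hypothesis bP : forall s l, (0 < s)%N -> (l < n)%N -> toep gamma n (b s) l = gamma (l + s)%N.
Hypothesis b'P : forall s l, (0 < s)%N -> (l < n)%N ->
  toep (fun k => gamma (- k)) n (b' s) l = gamma (- (l + s)%N%:Z).

(** This starts the iteration: a finite constant valid for all s at once with the right weight. The
    right-hand side [gamma (l + s)] is at most a multiple of f(s), and f(s) is at most f(s + n) / (2
    d)^n. *)
Lemma interval_apriori : half_line gamma kern ->
  exists2 A : R, 0 <= A & forall s, (0 < s)%N ->
    \sum_(j < n) mxnorm (b s j) <= A * (f (s + n) / f n).
Proof.
move=> [_ _ [Cg hCg] inj].
have [_ [B B0 stab]] := toep_solve (inj n).
have [d0 d1] := andP d01.
have Cg0 : 0 <= Cg.
  by have := hCg 0%N; rewrite frac_weight0 mulr1; apply: le_trans; exact: mxnorm_ge0.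
have dn : 0 < (2 * d) ^+ n by rewrite exprn_gt0// mulr_gt0.
have fn := fgt0 n.
exists (B * n%:R * Cg * f n / (2 * d) ^+ n).
  apply: divr_ge0; last exact: ltW.
  by apply: mulr_ge0; [rewrite !mulr_ge0|exact: ltW].
move=> s s0; apply: (le_trans (stab _)).
have -> : B * n%:R * Cg * f n / (2 * d) ^+ n * (f (s + n) / f n) =
    B * (n%:R * (Cg * (f (s + n) / (2 * d) ^+ n))).
  by field; rewrite !gt_eqF//= mulr_gt0.
apply: ler_wpM2l => //; rewrite -[X in X%:R](card_ord n) mulr_natl -sumr_const.
apply: ler_sum => l _; rewrite bP//.
apply: (le_trans (hCg _)); apply: ler_wpM2l => //.
apply: (@le_trans _ _ (f s)).
  by apply: frac_weight_antitone; rewrite ?leq_addl// d0 ltW.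
by rewrite ler_pdivlMr//; apply: frac_weight_shift; rewrite d0 ltW.
Qed.

(** A bound for the mirrored solutions passes to [b]. The column [y] of the kernel meets the
    mirrored solution at distance y - n + 1, whose bound has the weight f((y - n + 1) + n) = f(y +
    1): this is why the contraction is stated with [y.+1]. *)
Lemma interval_improve (kabs : nat -> nat -> R) (C0 e A : R) :
    half_line gamma kern ->
    (forall s y, (0 < s)%N -> 0 <= kabs s y) ->
    (forall s y D, (0 < s)%N -> mxnorm (kern s y * D) <= kabs s y * mxnorm D) ->
    (forall s, (0 < s)%N -> f n * \sum_(y < n) mxnorm (kern s y) <= C0 * f (s + n)) ->
    (forall s m, (0 < s)%N -> \sum_(n <= y < m) kabs s y * f y.+1 <= e * f (s + n)) ->
    0 <= A ->
    (forall s, (0 < s)%N -> \sum_(j < n) mxnorm (b' s j) <= A * (f (s + n) / f n)) ->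
  forall s, (0 < s)%N -> \sum_(j < n) mxnorm (b s j) <= (C0 + e * A) * (f (s + n) / f n).
Proof.
move=> [kernP _ _ inj] k0 kM hC0 he A0 hA s s0.
have [_ [B B0 stab]] := toep_solve (inj n).
have fn := fgt0 n.
have h := @sum_interval_split _ _ _ _ _ n0 kernP B stab b b' bP b'P s
  (e * f (s + n)) (A / f n) (fun y => kabs s y * f y.+1) s0.
apply: (@le_trans _ _ (\sum_(j < n) (mxnorm (kern s j) + mxnorm (b s j - kern s j)))).
  by apply: ler_sum => j _; rewrite -{1}[b s j](subrKC (kern s j)) mxnormD.
rewrite big_split/= mulrDl; apply: lerD.
  by rewrite mulrA ler_pdivlMr// mulrC hC0.
have -> : e * A * (f (s + n) / f n) = A / f n * (e * f (s + n)) by ring.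
apply: h => [||y ny|Y].
- by rewrite divr_ge0// ltW.
- by move=> y; rewrite mulr_ge0 ?k0// ltW// fgt0.
- apply: (@le_trans _ _ (\sum_(j < n) kabs s y * mxnorm (b' (y - n).+1 j))).
    by apply: ler_sum => j _; exact: kM.
  rewrite -mulr_sumr; apply: (le_trans (ler_wpM2l (k0 s y s0) (hA _ (ltn0Sn _)))).
  rewrite addSn subnK// le_eqVlt; apply/orP; left; apply/eqP; ring.
- exact: he.
Qed.

End FixedLength.

Lemma affine_contraction (q C0 A0 x : R) : 0 <= q < 1 ->
  (forall k, x <= C0 / (1 - q) + q ^+ k * A0) -> x <= C0 / (1 - q).
Proof.
move=> q01 h.
have c : (fun k => C0 / (1 - q) + q ^+ k * A0) @ \oo --> C0 / (1 - q) + 0 * A0.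
  apply: cvgD; first exact: cvg_cst.
  apply: cvgM; last exact: cvg_cst.
  by apply: cvg_expr; case/andP: q01 => q0 q1; rewrite ger0_norm.
rewrite -[leRHS]addr0 -(mul0r A0) -(cvg_lim _ c)//.
by apply: limr_ge; [apply/cvg_ex; eexists; exact: c|exact: nearW].
Qed.

(** For large n the rate is at most a fixed q < 1, and the map A |-> Cm + q A has the fixed point Cm
    / (1 - q), in which n does not occur; iterating it from the a priori constant gives this fixed
    point as a bound. The finitely many remaining n keep their a priori constants. *)
Theorem baxter_inequality (gamma : int -> M) (kern kern' : nat -> nat -> M)
    (phi_fin : nat -> nat -> M) :
    half_line gamma kern -> half_line (fun k => gamma (- k)) kern' ->
    (forall n l, (0 < n)%N -> (l < n)%N -> toep gamma n (phi_fin n) l = gamma l.+1) ->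
  exists2 K : R, 0 < K & forall n, (0 < n)%N -> forall T : R,
    (forall Y, \sum_(n <= y < Y) mxnorm (kern 1 y) <= T) ->
    \sum_(j < n) mxnorm (phi_fin n j - kern 1%N j) <= K * T.
Proof.
move=> hl hl' hphi.
have [kernP [kabs [C0 [eta [k0 kM hC0 eta0 he]]]] _ inj] := hl.
have [kernP' [kabs' [C0' [eta' [k0' kM' hC0' eta0' he']]]] _ inj'] := hl'.
have [d0 d1] := andP d01; have hD := @half_mul2 R.
have th0 : 0 < frac_rate d by rewrite /frac_rate !mulr_gt0//; lra.
have th1 : frac_rate d < 1.
  have : 0 < (1 - 2 * d) ^+ 2 by rewrite exprn_gt0//; lra.
  by rewrite /frac_rate expr2; lra.
(* The midpoint between the limiting rate and 1 leaves room for [eta n] once n is large. *)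
pose q := (1 + frac_rate d) / 2.
have q01 : 0 <= q < 1 by apply/andP; split; rewrite /q; lra.
pose Cm := Num.max C0 C0'.
have C0m : C0 <= Cm by rewrite le_max lexx.
have C0'm : C0' <= Cm by rewrite le_max lexx orbT.
have Cm0 : 0 <= Cm.
  apply: le_trans C0m; rewrite -(pmulr_lge0 _ (fgt0 (1 + 1))).
  apply: le_trans (hC0 1%N 1%N isT isT).
  by rewrite mulr_ge0 ?(ltW (fgt0 _))// sumr_ge0// => *; exact: mxnorm_ge0.
have Cq0 : 0 <= Cm / (1 - q) by case/andP: q01 => ? ?; rewrite divr_ge0//; lra.
pose F n s := f (s + n) / f n.
have F0 n s : 0 < F n s by rewrite divr_gt0// fgt0.
have sols n : exists bb : (nat -> nat -> M) * (nat -> nat -> M),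
    (forall s l, (l < n)%N -> toep gamma n (bb.1 s) l = gamma (l + s)%N) /\
    (forall s l, (l < n)%N ->
      toep (fun k => gamma (- k)) n (bb.2 s) l = gamma (- (l + s)%N%:Z)).
  have [sol _] := toep_solve (inj n); have [sol' _] := toep_solve (inj' n).
  have [b hb] := choice (fun s => sol (fun l => gamma (l + s)%N)).
  have [b' hb'] := choice (fun s => sol' (fun l => gamma (- (l + s)%N%:Z))).
  by exists (b, b'); split => s l; [exact: hb|exact: hb'].
have [bb hbb] := choice sols.
pose b n := (bb n).1; pose b' n := (bb n).2.
have bP n s l : (0 < s)%N -> (l < n)%N -> toep gamma n (b n s) l = gamma (l + s)%N.
  by move=> _; exact: (hbb n).1.
have b'P n s l : (0 < s)%N -> (l < n)%N ->
    toep (fun k => gamma (- k)) n (b' n s) l = gamma (- (l + s)%N%:Z).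
  by move=> _; exact: (hbb n).2.
have bP' n s l : (0 < s)%N -> (l < n)%N ->
    toep (fun k => gamma (- - k)) n (b n s) l = gamma (- - (l + s)%N%:Z).
  by under [fun k => _]eq_fun do rewrite opprK; rewrite opprK; exact: bP.
pose bounded n A := forall s, (0 < s)%N -> \sum_(j < n) mxnorm (b n s j) <= A * F n s /\
  \sum_(j < n) mxnorm (b' n s j) <= A * F n s.
have apriori n : exists2 A : R, 0 <= A & bounded n A.
  have [A A0 hA] := interval_apriori (bP n) hl.
  have [A' A'0 hA'] := interval_apriori (b'P n) hl'.
  exists (Num.max A A'); first by rewrite le_max A0.
  move=> s s0; split.
    by apply: le_trans (hA s s0) _; rewrite ler_wpM2r ?le_max ?lexx// ltW// F0.
  by apply: le_trans (hA' s s0) _; rewrite ler_wpM2r ?le_max ?lexx ?orbT// ltW// F0.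
have unif : exists n1, forall n, (0 < n)%N -> (n1 <= n)%N -> bounded n (Cm / (1 - q)).
  have th2 : 0 < (1 - frac_rate d) / 2 by lra.
  have [N1 _ hN1] := (cvgrPdist_le _ _).1 eta0 _ th2.
  have [N2 _ hN2] := (cvgrPdist_le _ _).1 eta0' _ th2.
  exists (maxn N1 N2) => n n0; rewrite geq_max => /andP[n1 n2].
  have e1 : frac_rate d + eta n <= q.
    have /= := hN1 n n1; rewrite sub0r normrN => h.
    by have := le_trans (ler_norm _) h; rewrite /q; lra.
  have e2 : frac_rate d + eta' n <= q.
    have /= := hN2 n n2; rewrite sub0r normrN => h.
    by have := le_trans (ler_norm _) h; rewrite /q; lra.
  have [A0 A00 hA0] := apriori n.
  (* Each side is improved from the bound on the other, so both bounds are carried together. *)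
  have step A : 0 <= A -> bounded n A -> bounded n (Cm + q * A).
    move=> Age hA s s0; split.
      apply: (@interval_improve gamma kern n n0 (b n) (b' n) (bP n) (b'P n) kabs Cm q A hl k0 kM) => //.
      - move=> t t0; apply: (le_trans (hC0 t n t0 n0)).
        by rewrite ler_wpM2r// ltW// fgt0.
      - move=> t m t0; apply: (le_trans (he t n m t0 n0)).
        by rewrite ler_wpM2r// ltW// fgt0.
      - by move=> t t0; exact: (hA t t0).2.
    apply: (@interval_improve (fun k => gamma (- k)) kern' n n0 (b' n) (b n) (b'P n) (bP' n) kabs' Cm q A hl' k0' kM') => //.
    - move=> t t0; apply: (le_trans (hC0' t n t0 n0)).
      by rewrite ler_wpM2r// ltW// fgt0.
    - move=> t m t0; apply: (le_trans (he' t n m t0 n0)).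
      by rewrite ler_wpM2r// ltW// fgt0.
    - by move=> t t0; exact: (hA t t0).1.
  have [q0 q1] := andP q01.
  have iter k : bounded n (Cm / (1 - q) + q ^+ k * A0).
    elim: k => [|k IH].
      by move=> s s0; have [h1 h2] := hA0 s s0; split; [apply: le_trans h1 _|apply: le_trans h2 _];
        rewrite ler_wpM2r ?(ltW (F0 _ _))// expr0 mul1r lerDr.
    have := step _ _ IH.
    have -> : Cm + q * (Cm / (1 - q) + q ^+ k * A0) = Cm / (1 - q) + q ^+ k.+1 * A0.
      by rewrite exprS; field; rewrite subr_eq0 eq_sym lt_eqF.
    by apply; rewrite addr_ge0// mulr_ge0// exprn_ge0.
  move=> s s0; split; rewrite -ler_pdivrMr//; apply: (@affine_contraction q Cm A0) => // k;
    rewrite ler_pdivrMr//; [exact: (iter k s s0).1|exact: (iter k s s0).2].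
have [n1 hn1] := unif.
have [K1 K10 hK1] : exists2 K : R, 0 <= K & forall n, (n < n1)%N -> bounded n K.
  elim: n1 {hn1} => [|m [K Kge hK]]; first by exists 0.
  have [A A0 hA] := apriori m.
  exists (Num.max K A); first by rewrite le_max Kge.
  move=> n; rewrite ltnS leq_eqVlt => /orP[/eqP ->|nm] s s0.
    have [h1 h2] := hA s s0; split; [apply: le_trans h1 _|apply: le_trans h2 _];
      by rewrite ler_wpM2r ?(ltW (F0 _ _))// le_max lexx orbT.
  have [h1 h2] := hK n nm s s0; split; [apply: le_trans h1 _|apply: le_trans h2 _];
    by rewrite ler_wpM2r ?(ltW (F0 _ _))// le_max lexx.
(* Adding 1 makes the constant positive even if both bounds are 0. *)
exists (Num.max K1 (Cm / (1 - q)) + 1); first by rewrite ltr_wpDl// le_max K10.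
move=> n n0 T hT.
have T0 : 0 <= T by have := hT n; rewrite big_geq.
set K := Num.max _ _.
have bK : bounded n K.
  have [nn1|n1n] := ltnP n n1.
    move=> s s0; have [h1 h2] := hK1 n nn1 s s0; split; [apply: le_trans h1 _|apply: le_trans h2 _];
      by rewrite ler_wpM2r ?(ltW (F0 _ _))// /K le_max lexx.
  move=> s s0; have [h1 h2] := hn1 n n0 n1n s s0; split; [apply: le_trans h1 _|apply: le_trans h2 _];
    by rewrite ler_wpM2r ?(ltW (F0 _ _))// /K le_max lexx orbT.
have K0 : 0 <= K by rewrite /K le_max K10.
have phib j : (j < n)%N -> phi_fin n j = b n 1%N j.
  move=> jn; apply/eqP; rewrite -subr_eq0; apply/eqP.
  apply: (inj n (fun j => phi_fin n j - b n 1%N j)) => // l ln.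
  rewrite /toep; under eq_bigr do rewrite mulrBl.
  by rewrite sumrB -!/(toep _ _ _ _) hphi// bP// addn1 subrr.
have [_ [B B0 stab]] := toep_solve (inj n).
rewrite (eq_bigr (fun j : 'I_n => mxnorm (b n 1%N j - kern 1%N j))) => [|j _]; last by rewrite phib.
apply: (@le_trans _ _ (K * T)); last by rewrite ler_wpM2r// lerDl.
apply: (@sum_interval_split _ _ _ _ _ n0 kernP B stab (b n) (b' n) (bP n) (b'P n) 1%N T K
  (fun y => mxnorm (kern 1%N y))) => // [y|y ny].
  exact: mxnorm_ge0.
apply: (@le_trans _ _ (\sum_(j < n) mxnorm (kern 1%N y) * mxnorm (b' n (y - n).+1 j))).
  by apply: ler_sum => j _; exact: mxnormM.
rewrite -mulr_sumr mulrC ler_wpM2r ?mxnorm_ge0//.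
apply: (le_trans (bK _ (ltn0Sn (y - n))).2).
(* The weight decreases, so f(s + n) / f(n) <= 1 and the weighted bound becomes a uniform one. *)
rewrite ler_piMr// ler_pdivrMr ?fgt0// mul1r frac_weight_antitone ?leq_addl//.
by rewrite d0 ltW.
Qed.

End Baxter.

(** * Power series of rational matrix functions *)

Section RationalSeries.
Context {R : realType}.
Local Notation C := R[i].
Implicit Types (f : C -> C) (z : C).

(** Coprimality is dropped and values matter only on the closed disk, so that sums, products and
    inverses can be formed without reducing fractions. *)
Definition disk_rational f := exists p r : {poly C},
  (forall z, closed_disk z -> r.[z] != 0) /\
  (forall z, closed_disk z -> f z = p.[z] / r.[z]).

Lemma disk_rational_no_pole f :
  rational_no_pole_on closed_disk f -> disk_rational f.
Proof.
move=> [p [r [_ hr hf]]]; exists p, r; split=> z hz; first exact: hr.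
by apply: hf; exact: hr.
Qed.

Lemma disk_rational_cst (c : C) : disk_rational (fun=> c).
Proof.
exists c%:P, 1; split=> z _; rewrite !hornerE ?oner_neq0//.
by rewrite divr1.
Qed.

Lemma disk_rationalD f g : disk_rational f -> disk_rational g ->
  disk_rational (fun z => f z + g z).
Proof.
move=> [p [r [r0 fE]]] [p' [r' [r'0 gE]]].
exists (p * r' + p' * r), (r * r'); split=> z hz; rewrite !hornerE.
  by rewrite mulf_neq0 ?r0 ?r'0.
by rewrite fE// gE// addf_div ?r0 ?r'0.
Qed.

Lemma disk_rationalM f g : disk_rational f -> disk_rational g ->
  disk_rational (fun z => f z * g z).
Proof.
move=> [p [r [r0 fE]]] [p' [r' [r'0 gE]]].
exists (p * p'), (r * r'); split=> z hz; rewrite !hornerE.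
  by rewrite mulf_neq0 ?r0 ?r'0.
by rewrite fE// gE// mulf_div.
Qed.

Lemma disk_rationalV f : disk_rational f -> (forall z, closed_disk z -> f z != 0) ->
  disk_rational (fun z => (f z)^-1).
Proof.
move=> [p [r [r0 fE]]] f0; exists r, p; split=> z hz.
  by have := f0 z hz; rewrite fE// mulf_eq0 negb_or => /andP[].
by rewrite fE// invf_div.
Qed.

Lemma disk_rational_sum (I : Type) (s : seq I) (P : pred I) (F : I -> C -> C) :
  (forall i, P i -> disk_rational (F i)) -> disk_rational (fun z => \sum_(i <- s | P i) F i z).
Proof.
move=> h; elim: s => [|i s IH].
  by under eq_fun do rewrite big_nil; exact: disk_rational_cst.
under eq_fun do rewrite big_cons; case Pi: (P i) => //.
by apply: disk_rationalD => //; exact: h.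
Qed.

Lemma disk_rational_prod (I : Type) (s : seq I) (P : pred I) (F : I -> C -> C) :
  (forall i, P i -> disk_rational (F i)) -> disk_rational (fun z => \prod_(i <- s | P i) F i z).
Proof.
move=> h; elim: s => [|i s IH].
  by under eq_fun do rewrite big_nil; exact: disk_rational_cst.
under eq_fun do rewrite big_cons; case Pi: (P i) => //.
by apply: disk_rationalM => //; exact: h.
Qed.

Lemma disk_rational_det n (A : C -> 'M[C]_n) :
  (forall i j, disk_rational (fun z => A z i j)) -> disk_rational (fun z => \det (A z)).
Proof.
move=> h; apply: disk_rational_sum => s _.
apply: disk_rationalM; first exact: disk_rational_cst.
by apply: disk_rational_prod => i _; exact: h.
Qed.

Lemma disk_rational_invmx n (A : C -> 'M[C]_n) :
    (forall i j, disk_rational (fun z => A z i j)) ->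
    (forall z, closed_disk z -> \det (A z) != 0) ->
  forall i j, disk_rational (fun z => invmx (A z) i j).
Proof.
move=> h det0 i j.
have [p [r [r0 hf]]] : disk_rational (fun z => (\det (A z))^-1 * cofactor (A z) j i).
  apply: disk_rationalM; first by apply: disk_rationalV => //; exact: disk_rational_det.
  apply: disk_rationalM; first exact: disk_rational_cst.
  apply: disk_rational_det => a b.
  by under eq_fun do rewrite !mxE; exact: h.
exists p, r; split => // z hz.
by rewrite /invmx unitmxE unitfE det0// !mxE hf.
Qed.

Definition disk_series f (u : nat -> C) (B r : R) :=
  [/\ 0 <= B, 0 <= r < 1, forall k, cabs (u k) <= B * r ^+ k &
      forall z, closed_disk z ->
        (fun n => cabs (\sum_(k < n) u k * z ^+ k - f z)) @ \oo --> (0 : R)].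

(** With t = r / s, the k + 1 copies of t^k are at most 1 + t + ... + t^k. *)
Lemma mul_geo_le (r s : R) k : 0 <= r -> r < s ->
  k.+1%:R * r ^+ k <= (1 - r / s)^-1 * s ^+ k.
Proof.
move=> r0 rs; have s0 : 0 < s by exact: le_lt_trans rs.
rewrite -ler_pdivrMr ?exprn_gt0// -mulrA -expr_div_n.
have t01 : 0 <= r / s < 1 by rewrite divr_ge0 ?(ltW s0)//= ltr_pdivrMr// mul1r.
apply: le_trans (sum_geo_le k.+1 t01).
rewrite -[X in X%:R](card_ord k.+1) mulr_natl -sumr_const; apply: ler_sum => i _.
case/andP: t01 => t0 t1.
by apply: ler_wiXn2l; rewrite ?(ltW t1)// -ltnS.
Qed.

Lemma cvg_geo (r : R) (B : R) : 0 <= r < 1 -> (fun k => B * r ^+ k) @ \oo --> (0 : R).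
Proof.
move=> /andP[r0 r1]; rewrite -[X in _ --> X](mulr0 B); apply: cvgM; first exact: cvg_cst.
by apply: cvg_expr; rewrite ger0_norm.
Qed.

Lemma cabs_expr_le1 z k : closed_disk z -> cabs (z ^+ k) <= 1.
Proof. by move=> hz; rewrite cabsX exprn_ile1// cabs_ge0. Qed.

Lemma disk_series_poly (p : {poly C}) : exists u B r, disk_series (fun z => p.[z]) u B r.
Proof.
pose B := \sum_(k < size p) cabs p`_k * 2 ^+ k.
exists (fun k => p`_k), B, 2^-1; split.
- by apply: sumr_ge0 => i _; rewrite mulr_ge0 ?cabs_ge0 ?exprn_ge0.
- by rewrite invr_ge0 ler0n invf_lt1 ?ltr1n.
- move=> k; have [ps|sp] := leqP (size p) k.
    rewrite nth_default// cabs0 mulr_ge0 ?exprn_ge0//.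
      by apply: sumr_ge0 => i _; rewrite mulr_ge0 ?cabs_ge0 ?exprn_ge0.
  rewrite exprVn ler_pdivlMr ?exprn_gt0// /B (bigD1 (Ordinal sp))//= lerDl.
  by apply: sumr_ge0 => i _; rewrite mulr_ge0 ?cabs_ge0 ?exprn_ge0.
- move=> z _; apply: cvg_near_cst.
  by exists (size p) => // n /= pn; rewrite (horner_coef_wide _ pn) subrr cabs0.
Qed.

Lemma conv_geo_le (u v : nat -> R) (B B' r s : R) k : 0 <= r -> r < s ->
    (forall k, 0 <= u k <= B * r ^+ k) -> (forall k, 0 <= v k <= B' * r ^+ k) ->
  conv u v k <= B * B' * (1 - r / s)^-1 * s ^+ k.
Proof.
move=> r0 rs hu hv.
have B0 : 0 <= B by have /andP[h1 h2] := hu 0%N; rewrite expr0 mulr1 in h2; exact: le_trans h2.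
have B'0 : 0 <= B' by have /andP[h1 h2] := hv 0%N; rewrite expr0 mulr1 in h2; exact: le_trans h2.
rewrite -mulrA; apply: le_trans (ler_wpM2l (mulr_ge0 B0 B'0) (mul_geo_le k r0 rs)).
rewrite mulrCA mulr_natl -[X in _ *+ X](card_ord k.+1) -sumr_const; apply: ler_sum => i _.
have /andP[u0 u1] := hu i; have /andP[v0 v1] := hv (k - i)%N.
apply: (le_trans (ler_pM u0 v0 u1 v1)).
by rewrite mulrACA -exprD subnKC// -ltnS.
Qed.

Lemma disk_series_scale f u B r (c : C) : disk_series f u B r ->
  disk_series (fun z => c * f z) (fun k => c * u k) (cabs c * B) r.
Proof.
move=> [B0 r01 hu hf]; split => // [|k|z hz].
- by rewrite mulr_ge0 ?cabs_ge0.
- by rewrite cabsM -mulrA ler_wpM2l ?cabs_ge0.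
- rewrite (_ : (fun n => _) = fun n => cabs c * cabs (\sum_(k < n) u k * z ^+ k - f z)); last first.
    apply/funext => n; rewrite -cabsM mulrBr mulr_sumr.
    by congr (cabs (_ - _)); apply: eq_bigr => i _; rewrite mulrA.
  rewrite -[X in _ --> X](mulr0 (cabs c)); apply: cvgM; first exact: cvg_cst.
  exact: hf.
Qed.

(* Dividing by 1 - b z turns u into e_k = u_k + b e_(k-1). *)
Lemma disk_series_div f u B r (b : C) : disk_series f u B r -> cabs b < 1 ->
  exists u' B' r', disk_series (fun z => f z / (1 - b * z)) u' B' r'.
Proof.
move=> [B0 r01 hu hf] b1; have [r0 r1] := andP r01.
pose e k := conv u (fun k => b ^+ k) k.
pose rho := Num.max r (cabs b); pose s := (rho + 1) / 2.
have rho1 : rho < 1 by rewrite gt_max r1 b1.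
have rrho : r <= rho by rewrite le_max lexx.
have brho : cabs b <= rho by rewrite le_max lexx orbT.
have rho0 : 0 <= rho := le_trans r0 rrho.
have rs : rho < s by rewrite /s; lra.
have s01 : 0 <= s < 1 by rewrite /s; apply/andP; split; lra.
have s0 : 0 < s by exact: le_lt_trans rs.
pose B' := B * 1 * (1 - rho / s)^-1.
have B'0 : 0 <= B'.
  by rewrite mulr_ge0 ?mulr1// invr_ge0 subr_ge0 ler_pdivrMr// mul1r ltW.
have he k : cabs (e k) <= B' * s ^+ k.
  apply: (@le_trans _ _ (conv (fun k => cabs (u k)) (fun k => cabs b ^+ k) k)).
    by apply: (le_trans (cabs_sum _ _ _)); apply: ler_sum => i _; rewrite cabsM cabsX.
  apply: conv_geo_le => // i; first rewrite cabs_ge0/=.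
    by apply: (le_trans (hu i)); rewrite ler_wpM2l// lerXn2r ?nnegrE.
  by rewrite exprn_ge0 ?cabs_ge0//= mul1r lerXn2r ?nnegrE ?cabs_ge0.
exists e, B', s; split => // z hz.
have bz : cabs (b * z) < 1.
  by rewrite cabsM (le_lt_trans _ b1)// ler_piMr ?cabs_ge0.
have d0 : 1 - b * z != 0.
  by apply/eqP => /eqP; rewrite subr_eq0 => /eqP h; rewrite -h cabs1 ltxx in bz.
have eS k : e k.+1 = u k.+1 + b * e k.
  rewrite /e /conv big_ord_recr/= subnn expr0 mulr1 addrC; congr (_ + _).
  rewrite mulr_sumr; apply: eq_bigr => i _.
  by rewrite subSn -1?ltnS// exprS mulrCA.
have tele n : (\sum_(k < n.+1) e k * z ^+ k) * (1 - b * z) =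
    \sum_(k < n.+1) u k * z ^+ k - b * e n * z ^+ n.+1.
  elim: n => [|n IH].
    by rewrite !big_ord1 /e /conv big_ord1 subnn !expr0 !mulr1 expr1; ring.
  by rewrite big_ord_recr/= mulrDl IH [in RHS]big_ord_recr/= eS !exprS; ring.
rewrite -(cvg_shiftS _)/=.
apply: (@squeeze_cvgr _ _ _ _ (fun=> 0) (fun n => (cabs (1 - b * z))^-1 *
    (cabs (\sum_(k < n.+1) u k * z ^+ k - f z) + B' * s ^+ n))).
- apply: nearW => n; rewrite cabs_ge0/=.
  have -> : \sum_(k < n.+1) e k * z ^+ k - f z / (1 - b * z) =
      (1 - b * z)^-1 * ((\sum_(k < n.+1) u k * z ^+ k - f z) - b * e n * z ^+ n.+1).
    have -> : \sum_(k < n.+1) u k * z ^+ k - f z - b * e n * z ^+ n.+1 =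
        (\sum_(k < n.+1) e k * z ^+ k) * (1 - b * z) - f z by rewrite tele addrAC.
    by move: (\sum_(k < _) _) => x; field.
  rewrite cabsM cabsV ler_wpM2l ?invr_ge0 ?cabs_ge0//.
  apply: (le_trans (cabsD _ _)); rewrite lerD2l cabsN !cabsM.
  apply: le_trans (he n); rewrite -[leRHS]mulr1.
  apply: ler_pM => //; rewrite ?mulr_ge0 ?cabs_ge0 ?cabs_expr_le1//.
  by rewrite ler_piMl ?cabs_ge0// ltW.
- exact: cvg_cst.
- rewrite -[X in _ --> X](mulr0 (cabs (1 - b * z))^-1); apply: cvgM; first exact: cvg_cst.
  rewrite -[X in _ --> X](addr0 0); apply: cvgD; last exact: cvg_geo.
  by have := hf z hz; rewrite -(cvg_shiftS _).
Qed.

Lemma eq_disk_series f f' u B r : (forall z, closed_disk z -> f z = f' z) ->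
  disk_series f u B r -> disk_series f' u B r.
Proof. by move=> ff [B0 r01 hu hf]; split => // z hz; rewrite -ff//; exact: hf. Qed.

(** The denominator splits over the complex numbers with all roots a outside the closed disk; each
    factor is divided out in turn, as 1 / (z - a) = - a^-1 / (1 - a^-1 z). *)
Lemma disk_rational_series f : disk_rational f -> exists u B r, disk_series f u B r.
Proof.
move=> [p [r [r0 fE]]].
have [s sE] := closed_field_poly_normal r.
have z0 : closed_disk (0 : C) by rewrite /closed_disk /mkset cabs0.
have l0 : lead_coef r != 0.
  by rewrite lead_coef_eq0; apply/eqP => h; have := r0 0 z0; rewrite h horner0 eqxx.
have s1 a : a \in s -> 1 < cabs a.
  move=> sa; rewrite ltNge; apply/negP => a1; have := r0 a a1; rewrite sE hornerZ.
  have : root (\prod_(z <- s) ('X - z%:P)) a by rewrite root_prod_XsubC.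
  by rewrite rootE => /eqP ->; rewrite mulr0 eqxx.
suff : exists u B r', disk_series (fun z => p.[z] / (\prod_(a <- s) (z - a))) u B r'.
  move=> [u [B [r' h]]].
  have := disk_series_scale (lead_coef r)^-1 h => h'.
  do 3 eexists; apply: eq_disk_series h' => z hz.
  rewrite fE// [in RHS]sE hornerZ horner_prod invfM mulrCA; congr (_ * (_ / _)).
  by apply: eq_bigr => a _; rewrite !hornerE.
elim: s s1 {sE} => [|a s IH] s1.
  have [u [B [r' h]]] := disk_series_poly p; exists u, B, r'.
  by apply: eq_disk_series h => z _; rewrite big_nil divr1.
have [|u [B [r' h]]] := IH; first by move=> b bs; apply: s1; rewrite inE bs orbT.
have a1 : 1 < cabs a by apply: s1; rewrite inE eqxx.
have a0 : a != 0 by apply/eqP => h0; move: a1; rewrite h0 cabs0 ltr10.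
have ia1 : cabs a^-1 < 1 by rewrite cabsV invf_lt1// (lt_trans _ a1).
have [u' [B' [r'' h']]] := disk_series_div (disk_series_scale (- a^-1) h) ia1.
exists u', B', r''; apply: eq_disk_series h' => z hz; rewrite big_cons.
have -> : z - a = - a * (1 - a^-1 * z) by rewrite mulrBr mulr1 mulrA mulNr mulfV// mulN1r opprK addrC.
by rewrite !invfM invrN; ring.
Qed.

End RationalSeries.


(** * Products and uniqueness of matrix power series *)

Section MatrixSeries.
Context {R : realType} {p : nat}.
Local Notation C := R[i].
Local Notation M := 'M[C]_p.+1.

Definition geometric_bound (G : nat -> M) (B r : R) :=
  [/\ 0 <= B, 0 <= r < 1 & forall k, mxnorm (G k) <= B * r ^+ k].

Definition msums_to (G : nat -> M) (z : C) (A : M) :=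
  mcvg (fun n => \sum_(k < n) z ^+ k *: G k) A.

Lemma geometric_boundW G (B r B' r' : R) : geometric_bound G B r -> B <= B' ->
  r <= r' -> r' < 1 -> geometric_bound G B' r'.
Proof.
move=> [B0 /andP[r0 r1] hG] BB rr r'1; split; first exact: le_trans BB.
  by rewrite (le_trans r0 rr).
move=> k; apply: (le_trans (hG k)); rewrite ler_pM ?exprn_ge0//.
by rewrite lerXn2r ?nnegrE// (le_trans r0).
Qed.

Lemma geometric_bound_sum G B r n : geometric_bound G B r ->
  \sum_(k < n) mxnorm (G k) <= B / (1 - r).
Proof.
move=> [B0 r01 hG]; apply: (@le_trans _ _ (B * \sum_(k < n) r ^+ k)).
  by rewrite mulr_sumr; apply: ler_sum.
by rewrite ler_wpM2l// sum_geo_le.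
Qed.

Lemma rational_msums (A : C -> M) : (forall i j, disk_rational (fun z => A z i j)) ->
  exists G B r, geometric_bound G B r /\ forall z, closed_disk z -> msums_to G z (A z).
Proof.
move=> hA.
have : forall ij : 'I_p.+1 * 'I_p.+1, exists t : (nat -> C) * R * R,
    disk_series (fun z => A z ij.1 ij.2) t.1.1 t.1.2 t.2.
  by move=> [i j]; have [u [B [r h]]] := disk_rational_series (hA i j); exists (u, B, r).
move=> /choice[t ht].
pose r := \big[Num.max/0]_ij (t ij).2.
have r0 : 0 <= r by exact: bigmax_ge_id.
have r1 : r < 1.
  by apply: bigmax_lt => // ij _; have [_ /andP[]] := ht ij.
have rt ij : (t ij).2 <= r by exact: le_bigmax.
exists (fun k => \matrix_(i, j) (t (i, j)).1.1 k), (\sum_i \sum_j (t (i, j)).1.2), r.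
split; first split.
- by apply: sumr_ge0 => i _; apply: sumr_ge0 => j _; have [] := ht (i, j).
- by rewrite r0.
- move=> k; rewrite /mxnorm mulr_suml; apply: ler_sum => i _; rewrite mulr_suml.
  apply: ler_sum => j _; rewrite mxE; have [B0 /andP[rr0 _] hu _] := ht (i, j).
  by apply: (le_trans (hu k)); rewrite ler_wpM2l// lerXn2r ?nnegrE.
move=> z hz; rewrite /msums_to /mcvg /mxnorm.
apply: cvg_sum0 => i; apply: cvg_sum0 => j.
have [_ _ _ /(_ z hz) h] := ht (i, j).
apply: cvg_trans h; apply: near_eq_cvg; apply: nearW => n /=.
by rewrite !mxE summxE; congr (cabs (_ - _)); apply: eq_bigr => k _; rewrite !mxE mulrC.
Qed.

(** Cauchy products converge up to the boundary of the disk by absolute summability: the product of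
    two n-th partial sums exceeds that of the convolution by the pairs i, j < n with i + j >= n,
    which [conv_l1_c0] shows to be negligible. *)
Lemma msums_conv (G H : nat -> M) z A D (BG BH : R) : cabs z <= 1 ->
    (forall n, \sum_(k < n) mxnorm (G k) <= BG) ->
    (forall n, \sum_(k < n) mxnorm (H k) <= BH) ->
    msums_to G z A -> msums_to H z D -> msums_to (conv G H) z (A * D).
Proof.
move=> z1 hG hH sA sD.
have [tau [tau0 tauE taud htau]] := sum_tail (fun k => mxnorm_ge0 (H k)) hH.
have tauge n : 0 <= tau n by case/andP: (tauE n).
have zk k : cabs (z ^+ k) <= 1 by exact: cabs_expr_le1.
pose U n := \sum_(k < n) z ^+ k *: G k.
pose V n := \sum_(k < n) z ^+ k *: H k.
have UV : mcvg (fun n => U n * V n) (A * D).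
  apply: (@mcvg_le _ _ _ _ _ (fun n => BG * mxnorm (V n - D) + mxnorm (U n - A) * mxnorm D)).
    move=> n; have -> : U n * V n - A * D = U n * (V n - D) + (U n - A) * D.
      by rewrite mulrBr mulrBl addrA subrK.
    apply: (le_trans (mxnormD _ _)); rewrite -!mulmxE lerD ?mxnormM//.
    apply: (le_trans (mxnormM _ _)); rewrite ler_wpM2r ?mxnorm_ge0//.
    apply: le_trans (hG n); apply: (le_trans (mxnorm_sum _ _ _)).
    by apply: ler_sum => k _; rewrite mxnormZ ler_piMl ?mxnorm_ge0.
  rewrite -[X in _ --> X](addr0 0); apply: cvgD.
    by rewrite -[X in _ --> X](mulr0 BG); apply: cvgM => //; exact: cvg_cst.
  by rewrite -[X in _ --> X](mul0r (mxnorm D)); apply: cvgM => //; exact: cvg_cst.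
have -> : A * D = A * D - 0 by rewrite subr0.
rewrite /msums_to (_ : (fun n => _) = fun n => U n * V n -
    (U n * V n - \sum_(k < n) z ^+ k *: conv G H k)); last first.
  by apply/funext => n; rewrite opprB addrC subrK.
apply: mcvgB => //.
apply: (@mcvg_le _ _ _ _ _ (fun n => \sum_(i < n) mxnorm (G i) * tau (n - 0 - i)%N)); last first.
  exact: (conv_l1_c0 0 (fun k => mxnorm_ge0 (G k)) hG tau0 tauge taud).
move=> n; rewrite subr0 subn0.
have -> : \sum_(k < n) z ^+ k *: conv G H k =
    \sum_(i < n) (z ^+ i *: G i) * \sum_(j < n - i) z ^+ j *: H j.
  transitivity (\sum_(k < n) \sum_(i < n | (i <= k)%N) (z ^+ i *: G i) * (z ^+ (k - i) *: H (k - i)%N)).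
    apply: eq_bigr => k _; rewrite /conv scaler_sumr.
    rewrite (big_ord_widen_cond n xpredT (fun i => z ^+ k *: (G i * H (k - i)%N)))//.
    apply: eq_big => i; first by rewrite ltnS.
    rewrite ltnS => ik; rewrite -scalerAl -scalerAr scalerA -exprD subnKC//.
  rewrite (exchange_big_dep xpredT)//=; apply: eq_bigr => i _.
  rewrite mulr_sumr -(big_mkord (fun k => i <= k)%N (fun k => z ^+ i *: G i * (z ^+ (k - i) *: H (k - i)%N))).
  rewrite (big_cat_nat (leq0n i) (ltnW (ltn_ord i)))/=.
  rewrite [X in X + _]big_nat_cond [X in X + _]big_pred0 ?add0r => [|k]; last first.
    by rewrite leq0n/=; apply/negP => /andP[ki ik]; move: ki; rewrite ltnNge ik.
  rewrite big_nat_cond (eq_bigl (fun k => i <= k < n)%N); last first.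
    by move=> k; case: (i <= k)%N; rewrite /= ?andbT ?andbF.
  rewrite -big_nat -{1}(add0n (i : nat)) big_addn big_mkord.
  by apply: eq_bigr => k _; rewrite addnK.
rewrite /U mulr_suml -sumrB; apply: (le_trans (mxnorm_sum _ _ _)); apply: ler_sum => i _.
rewrite -mulrBr -mulmxE; apply: (le_trans (mxnormM _ _)); apply: ler_pM; rewrite ?mxnorm_ge0//.
  by rewrite mxnormZ ler_piMl ?mxnorm_ge0.
rewrite /V -(sum_nat_diff (fun k => z ^+ k *: H k) (leq_subr i n)).
apply: le_trans (htau _ _ (leq_subr i n)); apply: (le_trans (mxnorm_sum _ _ _)).
by apply: ler_sum => k _; rewrite mxnormZ ler_piMl ?mxnorm_ge0.
Qed.

(** Uniqueness of coefficients, tested on the real interval only, where the principal power of 1 - x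
    is a real power. Once the earlier coefficients vanish, division by x^k isolates [v k] up to
    O(x). *)
Lemma msums_identity (v : nat -> M) (D E : R) : 0 < E ->
    (forall k, mxnorm (v k) <= D * E ^+ k) ->
    (forall x : R, 0 < x < 1 -> msums_to v (real_complex R x) 0) ->
  forall k, v k = 0.
Proof.
move=> E0 hv hs; elim/ltn_ind => k IH.
have D0 : 0 <= D by have := hv 0%N; rewrite expr0 mulr1; apply: le_trans; exact: mxnorm_ge0.
(* For x E <= 1/2 the terms beyond index k sum to at most 2 D (x E)^(k + 1), that is x^k W x. *)
pose W := 2 * D * E ^+ k.+1.
have W0 : 0 <= W by rewrite /W !mulr_ge0// exprn_ge0// ltW.
have main (x : R) : 0 < x < 1 -> x * E <= 2^-1 -> mxnorm (v k) <= W * x.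
  move=> x01 xE; have [x0 x1] := andP x01.
  have xk : 0 < x ^+ k by rewrite exprn_gt0.
  have c : (fun n => W * x + (x ^+ k)^-1 * mxnorm (\sum_(j < n) real_complex R x ^+ j *: v j - 0)) @ \oo
      --> W * x + (x ^+ k)^-1 * 0.
    apply: cvgD; first exact: cvg_cst.
    by apply: cvgM; [exact: cvg_cst|exact: hs].
  rewrite -[leRHS]addr0 -(mulr0 (x ^+ k)^-1) -(cvg_lim _ c)//; apply: limr_ge.
    by apply/cvg_ex; eexists; exact: c.
  exists k.+1 => // n /= kn; rewrite subr0.
  set S := \sum_(j < n) _.
  have SE : S = real_complex R (x ^+ k) *: v k +
      \sum_(k.+1 <= j < n) real_complex R x ^+ j *: v j.
    rewrite /S -(big_mkord xpredT (fun j => real_complex R x ^+ j *: v j)).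
    rewrite (big_cat_nat (leq0n k.+1) kn)/= big_nat_recr//= big_nat big1 ?add0r ?rmorphXn//.
    by move=> j /andP[_ jk]; rewrite IH// scaler0.
  have : x ^+ k * mxnorm (v k) <= mxnorm S + x ^+ k * (W * x).
    have -> : x ^+ k * mxnorm (v k) = mxnorm (S - \sum_(k.+1 <= j < n) real_complex R x ^+ j *: v j).
      by rewrite SE addrK mxnormZ cabs_real ger0_norm// ltW.
    apply: (le_trans (mxnormB _ _)); rewrite lerD2l.
    apply: (le_trans (mxnorm_sum _ _ _)).
    apply: (@le_trans _ _ (\sum_(k.+1 <= j < n) (D * (x * E) ^+ k.+1) * (x * E) ^+ (j - k.+1))).
      rewrite !big_nat; apply: ler_sum => j /andP[kj _].
      rewrite mxnormZ -rmorphXn cabs_real ger0_norm ?exprn_ge0 ?(ltW x0)//.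
      rewrite -mulrA -exprD subnKC// exprMn mulrCA; apply: ler_wpM2l => //.
      by rewrite exprn_ge0// ltW.
    rewrite -mulr_sumr.
    have -> : \sum_(k.+1 <= j < n) (x * E) ^+ (j - k.+1) = \sum_(j < n - k.+1) (x * E) ^+ j.
      rewrite -{1}[k.+1]add0n big_addn big_mkord.
      by apply: eq_bigr => j _; rewrite addnK.
    have t01 : 0 <= x * E < 1.
      by rewrite mulr_ge0 ?(ltW x0) ?(ltW E0)//= (le_lt_trans xE)// invf_lt1// ltr1n.
    apply: (@le_trans _ _ (D * (x * E) ^+ k.+1 * 2)).
      apply: ler_wpM2l; first by rewrite mulr_ge0// exprn_ge0//; case/andP: t01.
      apply: (le_trans (sum_geo_le _ t01)).
      rewrite -[leRHS]invrK lef_pV2 ?posrE ?invr_gt0//; last by rewrite subr_gt0; case/andP: t01.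
      by rewrite lerBrDr -lerBrDl; apply: le_trans xE _; rewrite -{1}[2^-1]mul1r; lra.
    by rewrite /W exprMn !exprSr le_eqVlt; apply/orP; left; apply/eqP; ring.
  rewrite -ler_pdivlMl// mulrDr mulKf; first by rewrite addrC.
  by rewrite gt_eqF.
apply: mxnorm_eq0; apply/ler_addgt0Pr => e e0; rewrite add0r.
pose x := Num.min (Num.min 2^-1 (2^-1 / E)) (e / (W + 1)).
have x0 : 0 < x by rewrite !lt_min invr_gt0 !divr_gt0 ?invr_gt0// ltr_wpDl.
have x1 : x <= 2^-1 by rewrite !ge_min lexx.
have x2 : x <= 2^-1 / E by rewrite !ge_min lexx orbT.
have x3 : x <= e / (W + 1) by rewrite !ge_min lexx orbT.
have h1 : 0 < x < 1.
  by rewrite x0 (le_lt_trans x1)// invf_lt1// ltr1n.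
have h2 : x * E <= 2^-1 by rewrite -ler_pdivlMr.
apply: (le_trans (main x h1 h2)).
apply: (@le_trans _ _ ((W + 1) * x)); first by rewrite ler_wpM2r ?(ltW x0)// lerDl.
by rewrite mulrC -ler_pdivlMr// ltr_wpDl.
Qed.

Lemma conv_bound_sum (G H : nat -> M) (BG BH : R) : 0 <= BG -> 0 <= BH ->
    (forall n, \sum_(k < n) mxnorm (G k) <= BG) ->
    (forall n, \sum_(k < n) mxnorm (H k) <= BH) ->
  forall n, \sum_(k < n) mxnorm (conv G H k) <= BG * BH.
Proof.
move=> BG0 BH0 hG hH n.
apply: (@le_trans _ _ (\sum_(k < n) conv (fun k => mxnorm (G k)) (fun k => mxnorm (H k)) k)).
  apply: ler_sum => k _; apply: (le_trans (mxnorm_sum _ _ _)).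
  by apply: ler_sum => i _; exact: mxnormM.
apply: (le_trans (sum_conv_le _ _ _)); [by move=> k; exact: mxnorm_ge0..|].
by apply: ler_pM => //; apply: sumr_ge0 => i _; exact: mxnorm_ge0.
Qed.

Lemma closed_disk_real (x : R) : 0 < x < 1 -> closed_disk (real_complex R x).
Proof.
by move=> /andP[x0 x1]; rewrite /closed_disk /mkset cabs_real ger0_norm ltW.
Qed.

Lemma msums_inverse (A D : C -> M) G H B r :
    geometric_bound G B r -> geometric_bound H B r ->
    (forall z, closed_disk z -> msums_to G z (A z)) ->
    (forall z, closed_disk z -> msums_to H z (D z)) ->
    (forall z, closed_disk z -> A z * D z = 1) ->
  conv G H =1 conv1.
Proof.
move=> gG gH sA sD AD k; apply/eqP; rewrite -subr_eq0; apply/eqP; move: k.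
have hG n := geometric_bound_sum n gG; have hH n := geometric_bound_sum n gH.
have B0 : 0 <= B / (1 - r) by have := hG 0%N; rewrite big_ord0.
have s1 := conv_bound_sum B0 B0 hG hH.
apply: (@msums_identity _ (B / (1 - r) * (B / (1 - r)) + p.+1%:R) 1) => // [k|x x01].
  rewrite expr1n mulr1; apply: (le_trans (mxnormB _ _)); apply: lerD.
    apply: le_trans (s1 k.+1); rewrite big_ord_recr/= lerDr.
    by apply: sumr_ge0 => i _; exact: mxnorm_ge0.
  rewrite /conv1; case: (k == 0)%N; last by rewrite mxnorm0.
  by rewrite mxnorm_scalar cabs1 mulr1.
have hx := closed_disk_real x01.
have := msums_conv hx hG hH (sA _ hx) (sD _ hx); rewrite AD// => h.
have e0 : (0 : M) = 1 - 1 by rewrite subrr.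
rewrite /msums_to [X in mcvg _ X]e0.
rewrite (_ : (fun n => _) = fun n => \sum_(k < n) real_complex R x ^+ k *: conv G H k -
   \sum_(k < n) real_complex R x ^+ k *: (conv1 k : M)); last first.
  by apply/funext => n; rewrite -sumrB; apply: eq_bigr => i _; rewrite scalerBr.
apply: mcvgB => //.
apply: cvg_near_cst; exists 1%N => // -[//|n] _ /=.
rewrite big_ord_recl/= expr0 scale1r /conv1 eqxx big1 ?addr0 ?subrr ?mxnorm0//.
by move=> i _; rewrite scaler0.
Qed.

Lemma rational_invertible_series (g : C -> M) : rational_invertible_on_disk g ->
  exists G H B r, [/\ geometric_bound G B r, geometric_bound H B r,
    conv G H =1 conv1, conv H G =1 conv1 &
    forall z, closed_disk z -> msums_to G z (g z) /\ msums_to H z (invmx (g z))].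
Proof.
move=> [hg det0].
have hg' i j : disk_rational (fun z => g z i j) by exact/disk_rational_no_pole.
have [G [B [r [gG sG]]]] := rational_msums hg'.
have [H [B' [r' [gH sH]]]] := rational_msums (disk_rational_invmx hg' det0).
have [_ /andP[_ r1] _] := gG; have [_ /andP[_ r'1] _] := gH.
pose Bm := Num.max B B'; pose rm := Num.max r r'.
have rm1 : rm < 1 by rewrite gt_max r1 r'1.
have gG' : geometric_bound G Bm rm by apply: geometric_boundW gG _ _ _; rewrite ?le_max ?lexx.
have gH' : geometric_bound H Bm rm.
  by apply: geometric_boundW gH _ _ _; rewrite ?le_max ?lexx ?orbT.
have un z : closed_disk z -> g z \in unitmx by move=> hz; rewrite unitmxE unitfE det0.
exists G, H, Bm, rm; split => //.
- by apply: (msums_inverse gG' gH' sG sH) => z hz; rewrite -mulmxE mulmxV ?un.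
- by apply: (msums_inverse gH' gG' sH sG) => z hz; rewrite -mulmxE mulVmx ?un.
- by move=> z hz; split; [exact: sG|exact: sH].
Qed.

End MatrixSeries.


(** * The binomial series of (1 - x)^d on the real interval *)

Section BinomialSeries.
Context {R : realType}.
Variables (d : R) (d01 : 0 < d < 1).
Local Notation f := (nbinom (- d)).

Lemma cvg_pseries_quadratic (u : nat -> R) (D K : R) : 0 <= K < 1 ->
  (forall k, `|u k| <= D * (k.+1%:R * k.+1%:R)) -> cvgn (pseries u K).
Proof.
move=> /andP[K0 K1] hu.
have D0 : 0 <= D by have := hu 0%N; rewrite !mulr1; apply: le_trans.
pose s := (K + 1) / 2; pose t := (s + 1) / 2.
have Ks : K < s by rewrite /s; lra.
have st : s < t by rewrite /t /s; lra.
have t1 : t < 1 by rewrite /t /s; lra.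
have s0 : 0 <= s by exact: le_trans (ltW Ks).
have t0 : 0 <= t by exact: le_trans (ltW st).
pose W := D * ((1 - K / s)^-1 * (1 - s / t)^-1).
apply: normed_cvg.
apply: (@series_le_cvg _ _ (geometric W t)).
- by move=> n; rewrite normr_ge0.
- move=> n; rewrite /geometric/= mulr_ge0 ?exprn_ge0//.
  have sp : 0 < s by exact: le_lt_trans Ks.
  have tp : 0 < t by exact: le_lt_trans st.
  by rewrite /W !mulr_ge0// invr_ge0 subr_ge0 ler_pdivrMr// mul1r ltW.
- move=> n; rewrite /geometric/= normrM normrX (ger0_norm K0).
  apply: (le_trans (ler_wpM2r (exprn_ge0 _ K0) (hu n))).
  have -> : W * t ^+ n = D * ((1 - K / s)^-1 * ((1 - s / t)^-1 * t ^+ n)) by rewrite /W; ring.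
  rewrite -[leLHS]mulrA; apply: ler_wpM2l => //; rewrite -mulrA.
  apply: (@le_trans _ _ (n.+1%:R * ((1 - K / s)^-1 * s ^+ n))).
    by rewrite ler_wpM2l// mul_geo_le.
  rewrite mulrCA; apply: ler_wpM2l; last exact: mul_geo_le.
  have sp : 0 < s by exact: le_lt_trans Ks.
  by rewrite invr_ge0 subr_ge0 ler_pdivrMr// mul1r ltW.
- by apply: is_cvg_geometric_series; rewrite ger0_norm.
Qed.

Lemma nbinomN_le2 k : `|f k| <= 2.
Proof.
apply: le_trans (sum_norm_nbinomN k.+1 d01); rewrite big_ord_recr/= lerDr.
exact: sumr_ge0.
Qed.

Lemma pseries_diffs_nbinomN k : pseries_diffs f k = (k%:R - d) * f k.
Proof. by rewrite /pseries_diffs nbinomS_mul. Qed.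

Lemma nbinomN_pseries_cvg (K : R) : 0 <= K < 1 -> [/\ cvgn (pseries f K),
  cvgn (pseries (pseries_diffs f) K) & cvgn (pseries (pseries_diffs (pseries_diffs f)) K)].
Proof.
have [d0 d1] := andP d01.
have f1 k : `|pseries_diffs f k| <= 2 * k.+1%:R.
  rewrite pseries_diffs_nbinomN normrM mulrC ler_pM ?nbinomN_le2//.
  have k0 : 0 <= k%:R :> R by [].
  by rewrite -natr1 ler_norml; apply/andP; split; lra.
move=> K01; split; apply: (cvg_pseries_quadratic (D := 4)) => // k.
- have k1 : 1 <= k.+1%:R :> R by rewrite ler1n.
  by apply: (le_trans (nbinomN_le2 k)); nra.
- have k1 : 1 <= k.+1%:R :> R by rewrite ler1n.
  by apply: (le_trans (f1 k)); nra.
- rewrite {1}/pseries_diffs normrM ger0_norm//.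
  apply: (@le_trans _ _ (k.+1%:R * (2 * k.+2%:R))); first by rewrite ler_wpM2l.
  have k1 : 1 <= k.+1%:R :> R by rewrite ler1n.
  have -> : k.+2%:R = k.+1%:R + 1 :> R by rewrite natr1.
  nra.
Qed.

Local Definition A (x : R) : R := limn (pseries f x).

Lemma nbinomN_series_ode (x : R) : 0 <= x < 1 -> (1 - x) * limn (pseries (pseries_diffs f) x) = - d * A x.
Proof.
move=> x01; have [c0 c1 _] := nbinomN_pseries_cvg x01.
set D := limn (pseries (pseries_diffs f) x).
suff h : D = x * D - d * A x by rewrite mulrBl mul1r {1}h; ring.
have e := pseries_diffs_equiv c1.
have h1 : (fun n => x * series (fun i => i%:R * f i * x ^+ i.-1) n - d * pseries f x n) @ \oo
    --> x * D - d * A x.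
  by apply: cvgB; (apply: cvgM; first exact: cvg_cst); [exact: e|exact: c0].
have h2 : pseries (pseries_diffs f) x @ \oo --> D by [].
have h3 : pseries (pseries_diffs f) x @ \oo --> x * D - d * A x; last exact: (cvg_unique _ h2 h3).
apply: cvg_trans h1; apply: near_eq_cvg; apply: nearW => n /=.
rewrite /pseries /series/= !mulr_sumr -sumrB; apply: eq_bigr => i _.
rewrite pseries_diffs_nbinomN; case: i => [|i]; first by rewrite !expr0; ring.
by rewrite /= exprS; ring.
Qed.

(** The sum A solves (1 - x) A' = - d A, so A(x) (1 - x)^(-d) has zero derivative and keeps its
    value 1 at the origin. *)
Lemma nbinomN_series (x : R) : 0 < x < 1 ->
  (fun n => \sum_(k < n) f k * x ^+ k) @ \oo --> (1 - x) `^ d.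
Proof.
move=> /andP[x0 x1].
have D (t : R) : 0 <= t < 1 -> is_derive t 1 A (limn (pseries (pseries_diffs f) t)).
  move=> /andP[t0 t1]; pose K := (t + 1) / 2.
  have K01 : 0 <= K < 1 by rewrite /K; apply/andP; split; lra.
  have [c0 c1 c2] := nbinomN_pseries_cvg K01.
  apply: pseries_snd_diffs c0 c1 c2 _.
  by rewrite !ger0_norm// /K; lra.
pose Phi t : R := A t * (1 - t) `^ (- d).
have DPhi (t : R) : 0 <= t < 1 -> is_derive t 1 Phi 0.
  move=> t01; have [t0 t1] := andP t01.
  have t1' : 0 < 1 - t by lra.
  have DA := D t t01.
  have Dp : is_derive (1 - t) 1 (fun x : R => x `^ (- d)) (- d * (1 - t) `^ (- d - 1)).
    exact: is_derive1_powR.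
  have Dc : is_derive t 1 (fun t : R => (1 - t) `^ (- d)) (- (- d * (1 - t) `^ (- d - 1))).
    have Ds : is_derive t 1 (fun t : R => 1 - t) (-1).
      have -> : (-1 : R) = 0 - 1 by rewrite sub0r.
      exact: is_deriveB.
    have := @is_derive1_comp _ (fun x : R => x `^ (- d)) (fun t : R => 1 - t) t _ _ Dp Ds.
    by rewrite mulrN1.
  have := is_deriveM DA Dc; rewrite /Phi.
  set e := (X in is_derive _ _ _ X -> _); suff -> : e = 0 by [].
  rewrite /e /GRing.scale/=.
  have -> : (1 - t) `^ (- d) = (1 - t) * (1 - t) `^ (- d - 1).
    rewrite -{2}(powRr1 (ltW t1')) -powRD; first by congr (_ `^ _); ring.
    by apply/implyP => _; rewrite gt_eqF.
  have := nbinomN_series_ode t01; set L := limn (pseries (pseries_diffs f) t) => ode.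
  transitivity ((1 - t) `^ (- d - 1) * ((1 - t) * L + d * A t)); first by ring.
  by rewrite ode mulNr addNr mulr0.
have [c0 _ _] := @nbinomN_pseries_cvg x ltac:(by rewrite (ltW x0)).
have Phi0 : Phi 0 = 1.
  rewrite /Phi subr0 powR1 mulr1 /A; apply: (@cvg_lim _ _) => //.
  apply: cvg_near_cst; exists 1%N => // -[//|n] _ /=.
  rewrite /pseries /series/= big_nat_recl//= nbinom0 expr0 mulr1 big1 ?addr0// => i _.
  by rewrite exprS mul0r mulr0.
have [c cx ce] : exists2 c, c \in `]0, x[%R & Phi x - Phi 0 = 0 * (x - 0).
  apply: (@MVT _ Phi (fun=> 0) 0 x x0).
    by move=> t; rewrite in_itv/= => /andP[t0 t1]; apply: DPhi; rewrite ltW//= (lt_trans t1).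
  apply: derivable_within_continuous => t; rewrite in_itv/= => /andP[t0 t1].
  by have [] := DPhi t; rewrite ?t0//= (le_lt_trans t1).
have Ax : A x = (1 - x) `^ d.
  have x1' : 0 < 1 - x by lra.
  have /eqP := ce; rewrite mul0r subr_eq0 Phi0 /Phi powRN => /eqP h.
  by rewrite -[LHS](mulfVK (lt0r_neq0 (powR_gt0 d x1'))) h mul1r.
rewrite -Ax; apply: cvg_trans c0; apply: near_eq_cvg; apply: nearW => n /=.
by rewrite /pseries /series/= big_mkord.
Qed.

End BinomialSeries.


Section PrincipalPower.
Context {R : realType}.
Local Notation C := R[i].

Lemma cpowR_real (x d : R) : 0 < x -> cpowR (real_complex R x) d = real_complex R (x `^ d).
Proof.
move=> x0; rewrite /cpowR cabs_real gtr0_norm//.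
have -> : carg (real_complex R x) = 0.
  by rewrite /carg cabs_real gtr0_norm//= lexx divff ?gt_eqF// acos1.
by rewrite mulr0 /cexpi cos0 sin0 -[Complex 1 0]/(1 : C) mulr1.
Qed.

Lemma csummable_to_cabs (u : nat -> C) (l : C) : csummable_to u l ->
  (fun n => cabs (\sum_(k < n) u k - l)) @ \oo --> (0 : R).
Proof.
move=> /cvgrPdist_lt h; apply/cvgrPdist_lt => e e0.
have := h (real_complex R e); rewrite ltcR => /(_ e0); apply: filterS => n.
rewrite -[`|_|]/(real_complex R (cabs _)) ltcR sub0r normrN (ger0_norm (cabs_ge0 _)).
by rewrite cabsB_sym big_mkord.
Qed.

End PrincipalPower.

(** * The infinite predictor coefficients as a row of the kernel *)

Section Identification.
Context {R : realType} {p : nat}.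
Local Notation C := R[i].
Local Notation M := 'M[C]_p.+1.
Variables (d : R) (d01 : 0 < d < half).
Variables (g : C -> M) (G H : nat -> M) (B r : R).
Hypotheses (gH : geometric_bound H B r).
Hypothesis GH : conv G H =1 conv1.
Hypothesis det0 : forall z, closed_disk z -> \det (g z) != 0.
Hypothesis sG : forall z, closed_disk z -> msums_to G z (g z).
Hypothesis sH : forall z, closed_disk z -> msums_to H z (invmx (g z)).

Lemma msums_scalar (u : nat -> R) (x l : R) :
  (fun n => \sum_(k < n) u k * x ^+ k) @ \oo --> l ->
  msums_to (scalar_seq u : nat -> M) (real_complex R x) (real_complex R l)%:M.
Proof.
move=> h.
have h' : (fun n => p.+1%:R * `|\sum_(k < n) u k * x ^+ k - l|) @ \oo --> (0 : R).
  rewrite -[X in _ --> X](mulr0 p.+1%:R); apply: cvgM; first exact: cvg_cst.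
  rewrite -[X in _ --> X](@normr0 _ R); apply: cvg_norm.
  by rewrite -[X in _ --> X](subrr l); apply: cvgB => //; exact: cvg_cst.
apply: (mcvg_le _ h') => n.
rewrite -cabs_real -mxnorm_scalar.
rewrite le_eqVlt; apply/orP; left; apply/eqP; congr mxnorm.
rewrite rmorphB raddfB/=; congr (_ - _); rewrite rmorph_sum/= raddf_sum/=.
by apply: eq_bigr => k _; rewrite /scalar_seq scale_scalar_mx -rmorphXn -rmorphM mulrC.
Qed.

Lemma farima_h_real (x : R) : 0 < x < 1 ->
  - invmx (farima_h d g (real_complex R x)) =
  - (invmx (g (real_complex R x)) * (real_complex R ((1 - x) `^ d))%:M).
Proof.
move=> x01; have [x0 x1] := andP x01; have hx := closed_disk_real x01.
have p0 : 0 < 1 - x by rewrite subr_gt0.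
rewrite /farima_h.
have -> : 1 - real_complex R x = real_complex R (1 - x) by rewrite rmorphB.
rewrite cpowR_real// invmxZ; last first.
  by rewrite unitmxZ ?unitmxE ?unitfE ?det0//; apply/eqP => -[] /eqP; rewrite gt_eqF// powR_gt0.
by rewrite -mulmxE mul_mx_scalar powRN fmorphV invrK.
Qed.

Lemma farima_h0 : farima_h d g 0 = G 0.
Proof.
rewrite /farima_h subr0 -[1](rmorph1 (real_complex R)) cpowR_real// powR1.
rewrite [real_complex R 1]rmorph1 scale1r.
have z0 : closed_disk (0 : C) by rewrite /closed_disk /mkset cabs0.
apply: (mcvg_unique (sG z0)); apply: cvg_near_cst; exists 1%N => // -[//|n] _ /=.
rewrite big_ord_recl/= expr0 scale1r big1 ?addr0 ?subrr ?mxnorm0//.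
by move=> i _; rewrite exprS mul0r scale0r.
Qed.

Variable a : nat -> M.
Hypothesis ha : ar_coefficients (farima_h d g) a.

Lemma ar_coefficients_inv k : a k = - farima_inv d H k.
Proof.
move: k.
have d1 : 0 < d < 1 by have := @half_mul2 R; case/andP: d01 => *; apply/andP; split; lra.
have sa (x : R) : 0 < x < 1 -> msums_to a (real_complex R x) (- invmx (farima_h d g (real_complex R x))).
  move=> x01; rewrite /msums_to /mcvg /mxnorm.
  apply: cvg_sum0 => i; apply: cvg_sum0 => j.
  have ox : open_disk (real_complex R x).
    by case/andP: x01 => x0 x1; rewrite /open_disk /mkset cabs_real gtr0_norm.
  have h := csummable_to_cabs (@ha _ ox i j).
  apply: cvg_trans h; apply: near_eq_cvg; apply: nearW => n /=.
  rewrite [in RHS]mxE; congr (cabs (_ + _)); last by rewrite !mxE.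
  by rewrite summxE; apply: eq_bigr => l _; rewrite mxE.
have sal (x : R) : 0 < x < 1 -> msums_to (farima_inv d H) (real_complex R x)
    (invmx (g (real_complex R x)) * (real_complex R ((1 - x) `^ d))%:M).
  move=> x01; have hx := closed_disk_real x01.
  apply: (@msums_conv _ _ H _ _ _ _ (B / (1 - r)) (p.+1%:R * 2)) => //.
  - by move=> n; exact: geometric_bound_sum.
  - move=> n; apply: (@le_trans _ _ (p.+1%:R * \sum_(k < n) `|nbinom (- d) k|)).
      rewrite mulr_sumr; apply: ler_sum => k _.
      by rewrite mxnorm_scalar cabs_real.
    by rewrite ler_wpM2l// sum_norm_nbinomN.
  - exact: sH.
  - by apply: msums_scalar; exact: nbinomN_series.
(* Uniqueness asks for a growth bound on [a]. Convergence at x = 1/2 bounds the partial sums there,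
   hence the terms, and [a n] is O(2^n). *)
have [D hD] : exists D, forall n, mxnorm (a n) <= D * 2 ^+ n.
  have h2 : 0 < (2^-1 : R) < 1 by rewrite invr_gt0 ltr0n invf_lt1 ?ltr1n.
  have := sa _ h2; set L := - _ => hL.
  have [D hD] : exists D, forall n, mxnorm (\sum_(k < n) real_complex R 2^-1 ^+ k *: a k - L) <= D.
    have /cvg_seq_bounded : cvgn (fun n => mxnorm (\sum_(k < n) real_complex R 2^-1 ^+ k *: a k - L)).
      by apply/cvg_ex; exists 0.
    rewrite /bounded_fun /= => -[K [_ /(_ (K + 1))]]; rewrite ltrDl ltr01 => /(_ isT) hK.
    by exists (K + 1) => n; apply: le_trans (ler_norm _) (hK n I).
  exists (2 * D) => n.
  have : mxnorm (real_complex R 2^-1 ^+ n *: a n) <= D + D.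
    have := hD n.+1; rewrite big_ord_recr/= => h.
    set S := \sum_(i < n) _ in h.
    have -> : real_complex R 2^-1 ^+ n *: a n = (S + real_complex R 2^-1 ^+ n *: a n - L) - (S - L).
      by rewrite opprB addrA subrK addrC addKr.
    by apply: (le_trans (mxnormB _ _)); apply: lerD => //; exact: hD.
  rewrite mxnormZ -rmorphXn cabs_real ger0_norm ?exprn_ge0 ?invr_ge0// exprVn mulrC.
  by rewrite ler_pdivrMr ?exprn_gt0// => h; apply: (le_trans h); rewrite ler_wpM2r ?exprn_ge0//; lra.
have hal n : mxnorm (farima_inv d H n) <= B / (1 - r) * 2.
  have [B0 r01 hB] := gH.
  apply: le_trans (farima_inv_sum d01 B0 r01 hB n.+1); rewrite big_ord_recr/= lerDr.
  by apply: sumr_ge0 => i _; exact: mxnorm_ge0.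
have D0 : 0 <= D by have := hD 0%N; rewrite expr0 mulr1; apply: le_trans; exact: mxnorm_ge0.
move=> k; apply/eqP; rewrite -addr_eq0; apply/eqP; move: k.
apply: (@msums_identity _ _ (fun k => a k + farima_inv d H k) (D + B / (1 - r) * 2) 2) => // [k|x x01].
  apply: (le_trans (mxnormD _ _)); rewrite mulrDl lerD//.
  apply: (le_trans (hal k)); rewrite ler_peMr//; last by rewrite exprn_ege1// ler1n.
  by apply: le_trans (hal 0%N); exact: mxnorm_ge0.
have := mcvgD (sa x x01) (sal x x01); rewrite farima_h_real// addNr.
rewrite /msums_to; congr (mcvg _ _); apply/funext => n.
by rewrite -big_split/=; apply: eq_bigr => k _; rewrite scalerDr.
Qed.

(** At index y + 1 the convolution of [om] with [al] vanishes. Isolating its term with [om 0] gives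
    minus the sum over the remaining terms, which is the kernel row at s = 1; the sign in the
    definition of [a] cancels this minus. *)
Lemma infinite_predictor_kernel y :
  infinite_predictor (farima_h d g) a y.+1 = half_kernel d G H 1 y.
Proof.
rewrite /infinite_predictor farima_h0 ar_coefficients_inv mulmxN mulmxE.
have om0 : farima_coef d G 0 = G 0.
  by rewrite /farima_coef /conv big_ord1 subn0 /scalar_seq nbinom0 rmorph1 mul1r.
have := @farima_coef_inv _ _ d _ _ GH y.+1; rewrite /conv1 /= /conv big_ord_recl/=.
rewrite subn0 om0 => /eqP; rewrite addr_eq0 => /eqP ->; rewrite opprK.
by apply: eq_bigr => i _; rewrite /bump leq0n add1n subSS.
Qed.

End Identification.

(** * Fourier coefficients of the singular weight *)

Section TrigIntegrals.
Context {R : realType}.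
Notation mu := (@lebesgue_measure R).

(** The integrand may blow up at an endpoint. The integral as a function of its upper limit and [F]
    have the same derivative inside and are continuous up to the ends, so the mean value theorem
    applies to their difference. *)
Lemma FTC_open (h F : R -> R) (a b : R) : a < b ->
    mu.-integrable `[a, b] (EFin \o h) -> {within `[a, b], continuous F} ->
    {in `]a, b[, forall t, {for t, continuous h}} ->
    {in `]a, b[, forall t : R, is_derive t 1 F (h t)} ->
  \int[mu]_(t in `[a, b]) h t = F b - F a.
Proof.
move=> ab ih cF ch dF.
pose Phi x := \int[mu]_(t in `[a, x]) h t.
have cPhi : {within `[a, b], continuous Phi}.
  exact: (parameterized_integral_continuous (ltW ab) ih).
have dPhi t : t \in `]a, b[ -> is_derive t 1 (Phi - F) 0.
  move=> tab; have := tab; rewrite in_itv/= => /andP[at_ tb].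
  have [d1 d2] := continuous_FTC1_closed tb ih at_ (ch t tab).
  have dt : is_derive t 1 Phi (h t) by split => //; rewrite -derive1E.
  have := is_deriveB dt (dF t tab); by rewrite subrr.
have cD : {within `[a, b], continuous (Phi - F)}.
  by move=> x; apply: continuousB; [exact: cPhi|exact: cF].
have [c _] := MVT ab dPhi cD.
rewrite mul0r => /eqP; rewrite subr_eq0 => /eqP.
rewrite !fctE /Phi set_itv1 Rintegral_set1 sub0r => e.
by rewrite -/(Phi b) -[LHS](subrK (F b)) e addrC.
Qed.

Lemma continuous_norm_powR (b : R) : 0 < b -> continuous (fun x : R => `|x| `^ b).
Proof.
move=> b0 x; have [->|x0] := eqVneq x 0.
  apply/cvgrPdist_lt => e e0.
  have /cvgrPdist_lt/(_ e e0) := powR_cvg0 b0.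
  move=> [d /= d0 hd]; exists d => // y /=; rewrite sub0r normrN => yd.
  rewrite normr0 powR0 ?gt_eqF//.
  have [->|y0] := eqVneq y 0; first by rewrite normr0 powR0 ?gt_eqF// subr0 normr0.
  apply: hd; rewrite /= ?sub0r ?normrN ?normr_id ?normr_gt0//.
apply: (@continuous_comp _ _ _ (fun x : R => `|x|) (fun y : R => y `^ b)).
  exact: norm_continuous.
apply: differentiable_continuous; apply/derivable1_diffP.
by apply: derivable_powR; rewrite in_itv/= andbT normr_gt0.
Qed.

Lemma is_derive_norm_powR (b s x : R) : s ^+ 2 = 1 -> 0 < s * x ->
  is_derive x 1 (fun x : R => `|x| `^ b) (s * (b * (s * x) `^ (b - 1))).
Proof.
move=> s2 sx0.
have D : is_derive x 1 (fun y : R => (s * y) `^ b) (s * (b * (s * x) `^ (b - 1))).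
  have D1 : is_derive (s * x) 1 (fun x : R => x `^ b) (b * (s * x) `^ (b - 1)).
    exact: is_derive1_powR.
  have D2 : is_derive x 1 (fun y : R => s * y) s.
    have : is_derive x 1 (s *: (id : R -> R)) (s *: (1 : R)) by exact: is_deriveZ.
    by rewrite [s *: 1]mulr1.
  by have := is_derive1_comp D1 D2; rewrite mulrC.
apply: near_eq_is_derive D.
have s1 : `|s| = 1.
  by apply/eqP; rewrite -sqrp_eq1// -normrX s2 normr1.
near=> y.
have sy : 0 < s * y.
  near: y; apply: (@cvgr_gt _ _ _ _ (fun y : R => s * y) (s * x)) => //.
  by apply: cvgM; [exact: cvg_cst|exact: cvg_id].
by rewrite -(gtr0_norm sy) normrM s1 mul1r.
Unshelve. all: by end_near. Qed.

(** A signed form of |1 - e^(it)|, smooth across 0. *)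
Definition chord (t : R) : R := 2 * sin (t / 2).

Lemma cabs_chord t : cabs (1 - cexpi t) = `|chord t|.
Proof.
rewrite /cabs /cexpi /= -sqrtr_sqr; congr (Num.sqrt _).
have {1 2}-> : t = (t / 2) *+ 2 by rewrite -mulr_natr divfK.
rewrite cos_mulr2n sin_mulr2n /chord; set c := cos _; set x := sin _.
have : c ^+ 2 = 1 - x ^+ 2 by rewrite cos2sin2.
rewrite !mulr2n => h.
have -> : 1 - (c ^+ 2 + c ^+ 2 - 1) = 2 * x ^+ 2 by rewrite h; ring.
have -> : (0 - (c * x + c * x)) ^+ 2 = 4 * c ^+ 2 * x ^+ 2 by ring.
by rewrite h; ring.
Qed.

Lemma continuous_chord : continuous chord.
Proof.
move=> t; apply: cvgM; first exact: cvg_cst.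
apply: (@continuous_comp _ _ _ (fun t : R => t / 2) sin); last exact: continuous_sin.
by apply: cvgM; [exact: cvg_id|exact: cvg_cst].
Qed.

Lemma is_derive_chord (t : R) : is_derive t 1 chord (cos (t / 2)).
Proof.
have D1 : is_derive t 1 (fun t : R => t / 2) (2^-1).
  have : is_derive t 1 (2^-1 *: (id : R -> R)) (2^-1 *: (1 : R)) by exact: is_deriveZ.
  rewrite [_ *: 1]mulr1; congr (is_derive _ _ _ _); apply/funext => x.
  by rewrite mulrC.
have D2 := @is_derive1_comp _ sin (fun t : R => t / 2) t _ _ (is_derive_sin (t / 2)) D1.
have : is_derive t 1 (2 *: (sin \o (fun t : R => t / 2))) (2 *: (cos (t / 2) * 2^-1)).
  exact: is_deriveZ.
suff -> : 2 *: (cos (t / 2) * 2^-1) = cos (t / 2) by [].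
by rewrite /GRing.scale/= mulrCA mulfV ?mulr1.
Qed.

Section SingularFTC.
Variables (d : R) (d01 : 0 < d < half) (phi dphi : R -> R).
Hypothesis phiD : forall t : R, is_derive t 1 phi (dphi t).
Hypothesis dphiC : continuous dphi.

Definition singular_weight t : R := `|chord t| `^ (- (2 * d)).
Local Notation u := singular_weight.

(* On each side of 0 this is the derivative of |chord t|^(1 - 2 d) phi t, up to the sign of t. *)
Definition singular_integrand t : R :=
  u t * ((1 - 2 * d) * cos (t / 2) * phi t + 2 * sin (t / 2) * dphi t).
Local Notation h := singular_integrand.

Lemma continuous_phi : continuous phi.
Proof.
move=> t; apply: differentiable_continuous; apply/derivable1_diffP.
by have [] := phiD t.
Qed.

Lemma continuous_half_cos : continuous (fun t : R => cos (t / 2)).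
Proof.
move=> t; apply: (@continuous_comp _ _ _ (fun t : R => t / 2) cos); last exact: continuous_cos.
by apply: cvgM; [exact: cvg_id|exact: cvg_cst].
Qed.

Lemma singular_primitive (s t : R) : s ^+ 2 = 1 -> 0 < s * chord t ->
  is_derive t 1 (fun t : R => s * (`|chord t| `^ (1 - 2 * d) * phi t)) (h t).
Proof.
move=> s2 sc.
have D1 := is_derive1_comp (is_derive_norm_powR (1 - 2 * d) s2 sc) (is_derive_chord t).
have D2 := is_deriveM D1 (phiD t).
have := is_deriveZ s D2.
set e := (X in is_derive _ _ _ X -> _); suff -> : e = h t by [].
rewrite /e /h /GRing.scale/=.
have s1 : `|s| = 1 by apply/eqP; rewrite -sqrp_eq1// -normrX s2 normr1.
have nc : `|chord t| = s * chord t by rewrite -(gtr0_norm sc) [RHS]normrM s1 mul1r.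
have -> : 1 - 2 * d - 1 = - (2 * d) by ring.
have -> : `|chord t| `^ (1 - 2 * d) = `|chord t| * u t.
  rewrite /u -{2}(powRr1 (normr_ge0 (chord t))) -powRD//.
  by apply/implyP => _; rewrite nc gt_eqF.
rewrite -nc -/(u t) nc.
transitivity (s ^+ 2 * (u t * ((1 - 2 * d) * cos (t / 2) * phi t + chord t * dphi t))); first by ring.
by rewrite s2 mul1r.
Qed.

Lemma continuous_singular_weight (s t : R) : s ^+ 2 = 1 -> 0 < s * chord t ->
  {for t, continuous u}.
Proof.
move=> s2 sc; apply: differentiable_continuous; apply/derivable1_diffP.
by have [] := is_derive1_comp (is_derive_norm_powR (- (2 * d)) s2 sc) (is_derive_chord t).
Qed.

Lemma continuous_singular_integrand (s t : R) : s ^+ 2 = 1 -> 0 < s * chord t ->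
  {for t, continuous h}.
Proof.
move=> s2 sc; apply: continuousM; first exact: continuous_singular_weight s2 sc.
apply: continuousD; apply: continuousM.
- by apply: continuousM; [exact: cst_continuous|exact: continuous_half_cos].
- exact: continuous_phi.
- exact: continuous_chord.
- exact: dphiC.
Qed.

Lemma continuous_singular_primitive (s : R) :
  continuous (fun t : R => s * (`|chord t| `^ (1 - 2 * d) * phi t)).
Proof.
have b0 : 0 < 1 - 2 * d by have := @half_mul2 R; case/andP: d01; lra.
move=> t; apply: cvgM; first exact: cvg_cst.
apply: cvgM; last exact: continuous_phi.
apply: (@continuous_comp _ _ _ chord (fun x : R => `|x| `^ (1 - 2 * d))).
  exact: continuous_chord.
exact: continuous_norm_powR.
Qed.

Lemma chord0 : chord 0 = 0. Proof. by rewrite /chord mul0r sin0 mulr0. Qed.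
Lemma chord_pi : chord pi = 2. Proof. by rewrite /chord sin_pihalf mulr1. Qed.
Lemma chordN t : chord (- t) = - chord t.
Proof. by rewrite /chord mulNr sinN mulrN. Qed.

Lemma chord_gt0 t : 0 < t < pi -> 0 < chord t.
Proof.
move=> /andP[t0 tpi]; rewrite /chord mulr_gt0// sin_gt0_pihalf//.
by rewrite divr_gt0//= ltr_pM2r// invr_gt0.
Qed.

(** The interval is cut at the singularity, where the primitive vanishes because 1 - 2 d > 0. On the
    left half it carries the opposite sign, so the boundary values at pi and - pi add up. *)
Lemma singular_FTC : mu.-integrable `[- pi, pi] (EFin \o h) ->
  \int[mu]_(t in `[- pi, pi]) h t = 2 `^ (1 - 2 * d) * (phi pi + phi (- pi)).
Proof.
have b0 : 0 < 1 - 2 * d by have := @half_mul2 R; case/andP: d01; lra.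
have pi0 := pi_gt0 R.
move=> ih.
have i1 : mu.-integrable `[0, pi] (EFin \o h).
  by apply: integrableS ih => //; apply: subset_itvr; rewrite bnd_simp; lra.
have i2 : mu.-integrable `[- pi, 0] (EFin \o h).
  by apply: integrableS ih => //; apply: subset_itvl; rewrite bnd_simp; lra.
have -> : \int[mu]_(t in `[- pi, pi]) h t =
    \int[mu]_(t in `[- pi, 0]) h t + \int[mu]_(t in `[0, pi]) h t.
  have e : \int[mu]_(t in `[- pi, pi]) h t - \int[mu]_(t in `[- pi, 0]) h t =
      \int[mu]_(t in `]0, pi]) h t.
    by apply: Rintegral_itvB; rewrite ?bnd_simp//; lra.
  rewrite -[LHS](subrK (\int[mu]_(t in `[- pi, 0]) h t)) e addrC; congr (_ + _).
  rewrite Rintegral_itv_obnd_cbnd//.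
  by apply: integrableS ih => //; apply: subset_itvr; rewrite bnd_simp; lra.
have s1 : (1 : R) ^+ 2 = 1 by rewrite expr1n.
have s2 : (- 1 : R) ^+ 2 = 1 by rewrite sqrrN expr1n.
rewrite (@FTC_open h (fun t => 1 * (`|chord t| `^ (1 - 2 * d) * phi t)) 0 pi)//; last 3 first.
- exact/continuous_subspaceT/continuous_singular_primitive.
- move=> t; rewrite in_itv/= => ht; apply: (continuous_singular_integrand s1).
  by rewrite mul1r chord_gt0.
- move=> t; rewrite in_itv/= => ht; apply: (singular_primitive s1).
  by rewrite mul1r chord_gt0.
rewrite (@FTC_open h (fun t => - 1 * (`|chord t| `^ (1 - 2 * d) * phi t)) (- pi) 0)//; last 4 first.
- by lra.
- exact/continuous_subspaceT/continuous_singular_primitive.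
- move=> t; rewrite in_itv/= => /andP[t1 t2]; apply: (continuous_singular_integrand s2).
  by rewrite mulN1r -chordN chord_gt0//; apply/andP; split; lra.
- move=> t; rewrite in_itv/= => /andP[t1 t2]; apply: (singular_primitive s2).
  by rewrite mulN1r -chordN chord_gt0//; apply/andP; split; lra.
rewrite chordN chord0 chord_pi normrN normr0 powR0 ?gt_eqF// ger0_norm//.
ring.
Qed.

End SingularFTC.

End TrigIntegrals.


Section RealIntegrable.
Context {R : realType} {disp : measure_display} {T : measurableType disp}.
Variables (mu : {measure set T -> \bar R}) (D : set T).
Implicit Types f g : T -> R.

Lemma integrable_scale (c : R) f : mu.-integrable D (EFin \o f) -> measurable D ->
  mu.-integrable D (EFin \o (fun t => c * f t)).
Proof. by move=> fi mD; exact: (integrableZl mD c fi). Qed.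

Lemma integrable_sub f g : mu.-integrable D (EFin \o f) ->
  mu.-integrable D (EFin \o g) -> measurable D ->
  mu.-integrable D (EFin \o (fun t => f t - g t)).
Proof. by move=> fi gi mD; exact: (integrableB mD fi gi). Qed.

Lemma integrable_add f g : mu.-integrable D (EFin \o f) ->
  mu.-integrable D (EFin \o g) -> measurable D ->
  mu.-integrable D (EFin \o (fun t => f t + g t)).
Proof. by move=> fi gi mD; exact: (integrableD mD fi gi). Qed.

End RealIntegrable.

Section WeightIntegrals.
Context {R : realType}.
Notation mu := (@lebesgue_measure R).
Local Notation I := (`[- pi, pi]%classic : set R).
Variables (d : R) (d01 : 0 < d < half).
Local Notation u := (singular_weight d).
Hypothesis ui : mu.-integrable I (EFin \o u).

Lemma integrable_bounded_mul (f g : R -> R) : mu.-integrable I (EFin \o f) ->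
  continuous g -> (forall t, `|g t| <= 1) -> mu.-integrable I (EFin \o (fun t => g t * f t)).
Proof.
move=> fi gc g1.
have -> : EFin \o (fun t => g t * f t) = ((EFin \o g) \* (EFin \o f))%E by apply/funext.
apply: integrableMr => //.
  apply: measurable_realfun.subspace_continuous_measurable_fun => //.
  exact: continuous_subspaceT.
by exists 1; split => // M M1 t _; apply: le_trans (g1 t) (ltW M1).
Qed.

Lemma continuous_scale_comp (g : R -> R) (a : R) : continuous g -> continuous (fun t : R => g (a * t)).
Proof.
move=> gc t; apply: (@continuous_comp _ _ _ (fun t : R => a * t) g); last exact: gc.
by apply: cvgM; [exact: cvg_cst|exact: cvg_id].
Qed.

Lemma cos_weight_integrable (a : R) : mu.-integrable I (EFin \o (fun t => cos (a * t) * u t)).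
Proof.
apply: integrable_bounded_mul => //; last by move=> t; exact: cos_max.
by apply: continuous_scale_comp; exact: continuous_cos.
Qed.

Lemma sin_weight_integrable (a : R) : mu.-integrable I (EFin \o (fun t => sin (a * t) * u t)).
Proof.
apply: integrable_bounded_mul => //; last by move=> t; exact: sin_max.
by apply: continuous_scale_comp; exact: continuous_sin.
Qed.

Definition cos_coef (k : nat) : R := \int[mu]_(t in I) (cos (k%:R * t) * u t).
Definition sin_coef (k : nat) : R := \int[mu]_(t in I) (sin (k%:R * t) * u t).

Lemma is_derive_scale (f : R -> R) (a t df : R) : is_derive (a * t) 1 f df ->
  is_derive t 1 (fun t : R => f (a * t)) (a * df).
Proof.
move=> D1.
have D2 : is_derive t 1 (fun y : R => a * y) a.
  have : is_derive t 1 (a *: (id : R -> R)) (a *: (1 : R)) by exact: is_deriveZ.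
  by rewrite [a *: 1]mulr1.
by have := @is_derive1_comp _ f (fun y : R => a * y) t _ _ D1 D2; rewrite mulrC.
Qed.

Lemma cos_mul_half_pi (k : nat) : cos ((k%:R + half) * pi) = 0 :> R.
Proof.
rewrite mulrDl; have -> : half * pi = pi / 2 :> R by rewrite mulrC.
rewrite cosDpihalf; apply/eqP; rewrite oppr_eq0; apply/eqP.
elim: k => [|k IH]; first by rewrite mul0r sin0.
by rewrite -natr1 mulrDl mul1r sinDpi IH oppr0.
Qed.

(** Take phi(t) = cos((k + 1/2) t) in [singular_FTC]. Product formulas turn the integrand into the
    two cosines of the recurrence with exactly these coefficients, and phi vanishes at both ends. *)
Lemma cos_coefS k : (k%:R + 1 - d) * cos_coef k.+1 = (k%:R + d) * cos_coef k.
Proof.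
have mI : measurable I by exact: measurable_itv.
pose b : R := k%:R + half.
pose phi t := cos (b * t); pose dphi t := b * - sin (b * t).
have phiD (t : R) : is_derive t 1 phi (dphi t) by apply: is_derive_scale.
have dphiC : continuous dphi.
  move=> t; apply: cvgM; first exact: cvg_cst.
  by apply: cvgN; apply: continuous_scale_comp; exact: continuous_sin.
have hE t : singular_integrand d phi dphi t =
    (k%:R + 1 - d) * (cos (k.+1%:R * t) * u t) - (k%:R + d) * (cos (k%:R * t) * u t).
  have -> : k.+1%:R * t = b * t + t / 2 by rewrite -natr1 /b /half; field.
  have -> : k%:R * t = b * t - t / 2 by rewrite /b /half; field.
  rewrite cosD cosB /singular_integrand /phi /dphi.
  have -> : b = k%:R + 1 / 2 by rewrite /b /half div1r.
  by field.
have i1 := cos_weight_integrable k.+1%:R; have i2 := cos_weight_integrable k%:R.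
have i1' := integrable_scale (k%:R + 1 - d) i1 mI.
have i2' := integrable_scale (k%:R + d) i2 mI.
have hi : mu.-integrable I (EFin \o singular_integrand d phi dphi).
  have := integrable_sub i1' i2' mI; congr (mu.-integrable _ _).
  by apply/funext => t /=; rewrite hE.
have := singular_FTC d01 phiD dphiC hi.
rewrite /phi mulrN cosN cos_mul_half_pi addr0 mulr0.
under eq_Rintegral do rewrite hE.
by rewrite RintegralB// !RintegralZl// => /eqP; rewrite subr_eq0 => /eqP.
Qed.

(** The same with phi(t) = sin((k + 1/2) t), whose values at pi and - pi cancel since it is odd. *)
Lemma sin_coefS k : (k%:R + 1 - d) * sin_coef k.+1 = (k%:R + d) * sin_coef k.
Proof.
have mI : measurable I by exact: measurable_itv.
pose b : R := k%:R + half.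
pose phi t := sin (b * t); pose dphi t := b * cos (b * t).
have phiD (t : R) : is_derive t 1 phi (dphi t) by apply: is_derive_scale.
have dphiC : continuous dphi.
  move=> t; apply: cvgM; first exact: cvg_cst.
  by apply: continuous_scale_comp; exact: continuous_cos.
have hE t : singular_integrand d phi dphi t =
    (k%:R + 1 - d) * (sin (k.+1%:R * t) * u t) - (k%:R + d) * (sin (k%:R * t) * u t).
  have -> : k.+1%:R * t = b * t + t / 2 by rewrite -natr1 /b /half; field.
  have -> : k%:R * t = b * t - t / 2 by rewrite /b /half; field.
  rewrite sinD sinB /singular_integrand /phi /dphi.
  have -> : b = k%:R + 1 / 2 by rewrite /b /half div1r.
  by field.
have i1 := sin_weight_integrable k.+1%:R; have i2 := sin_weight_integrable k%:R.
have i1' := integrable_scale (k%:R + 1 - d) i1 mI.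
have i2' := integrable_scale (k%:R + d) i2 mI.
have hi : mu.-integrable I (EFin \o singular_integrand d phi dphi).
  have := integrable_sub i1' i2' mI; congr (mu.-integrable _ _).
  by apply/funext => t /=; rewrite hE.
have := singular_FTC d01 phiD dphiC hi.
rewrite /phi mulrN sinN subrr mulr0.
under eq_Rintegral do rewrite hE.
by rewrite RintegralB// !RintegralZl// => /eqP; rewrite subr_eq0 => /eqP.
Qed.

Lemma sin_coef0 k : sin_coef k = 0.
Proof.
have halfD := @half_mul2 R; have [_ d1] := andP d01.
elim: k => [|k IH].
  rewrite /sin_coef; under eq_Rintegral do rewrite mul0r sin0 mul0r.
  by rewrite Rintegral_cst// mul0r.
have k0 : 0 <= k%:R :> R by [].
have /eqP := sin_coefS k; rewrite IH mulr0 mulf_eq0 => /orP[|/eqP//].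
by rewrite gt_eqF//; lra.
Qed.

(* Its value is 2 pi, which is never needed: both families of Fourier coefficients
   satisfy the same first-order recurrence. *)
Definition weight_mass : R := cos_coef 0 / autocorr d 0.

Lemma cos_coef_autocorr k : cos_coef k = weight_mass * autocorr d k.
Proof. by rewrite (autocorr_proportional d01 cos_coefS). Qed.

Lemma weight_mass_gt0 : 0 < weight_mass.
Proof.
have pi0 := pi_gt0 R; have [d0 _] := andP d01.
rewrite divr_gt0 ?autocorr0_gt0//.
have -> : cos_coef 0 = \int[mu]_(t in I) u t.
  by apply: eq_Rintegral => t _; rewrite mul0r cos0 mul1r.
have e : \int[mu]_(t in I) u t - \int[mu]_(t in `[- pi, pi / 2]) u t =
    \int[mu]_(t in `]pi / 2, pi]) u t.
  by apply: Rintegral_itvB; rewrite ?bnd_simp//; lra.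
have h1 : 0 <= \int[mu]_(t in `[- pi, pi / 2]) u t.
  by apply: Rintegral_ge0 => t _; exact: powR_ge0.
suff h2 : 0 < \int[mu]_(t in `]pi / 2, pi]) u t.
  by apply: le_lt_trans h1 _; rewrite -subr_gt0 e.
move=> {e h1}.
have mJ : measurable (`]pi / 2, pi]%classic : set R) by exact: measurable_itv.
have muJ : mu (`]pi / 2, pi]%classic : set R) = (pi / 2)%:E.
  rewrite lebesgue_measure_itv/= lte_fin ifT; last by lra.
  by rewrite -EFinB; congr EFin; lra.
(* Away from the singularity the chord is at most 2, so the weight is at least 2^(- 2 d). *)
apply: (@lt_le_trans _ _ (\int[mu]_(t in `]pi / 2, pi]) (2 `^ (- (2 * d))))).
  have -> := @Rintegral_cst _ _ R mu _ mJ (2 `^ (- (2 * d))).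
  rewrite (_ : fine _ = pi / 2); last exact: (congr1 fine muJ).
  by rewrite mulr_gt0 ?powR_gt0// divr_gt0.
apply: le_Rintegral => //.
- have mfin := ltry (pi / 2 : R); rewrite -muJ in mfin.
  by apply: measurable_bounded_integrable => //; exact: bounded_cst.
- apply: integrableS ui => //; apply: subset_itv; rewrite bnd_simp; lra.
move=> t /=; rewrite in_itv/= => /andP[t1 t2].
have c0 : 0 < chord t.
  move: t2; rewrite le_eqVlt => /predU1P[->|t2]; first by rewrite chord_pi.
  by apply: chord_gt0; apply/andP; split; lra.
rewrite /singular_weight gtr0_norm// !powRN lef_pV2 ?posrE ?powR_gt0//.
apply: ge0_ler_powR; rewrite ?nnegrE//; [by rewrite mulr_ge0// ltW|exact: ltW|].
by rewrite /chord ler_piMr// sin_le1.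
Qed.

Lemma cintegral_weight (k : int) :
  cintegral mu I (fun t => real_complex R (u t) * cexpi (k%:~R * t)) =
  real_complex R (weight_mass * autocorr d `|k|%N).
Proof.
rewrite -cos_coef_autocorr /cintegral.
have re t : complex.Re (real_complex R (u t) * cexpi (k%:~R * t)) = cos (`|k|%N%:R * t) * u t.
  rewrite /cexpi/= mul0r subr0 mulrC; congr (_ * _).
  case: k => n; first by [].
  by rewrite NegzE mulrNz mulNr cosN abszN.
have im t : complex.Im (real_complex R (u t) * cexpi (k%:~R * t)) =
    (sgz k)%:~R * (sin (`|k|%N%:R * t) * u t).
  rewrite /cexpi/= mul0r addr0 mulrC.
  case: (k) => [[|n]|n]; first by rewrite sgz0 mul0r mul0r sin0 mul0r.
    by have -> : sgz (Posz n.+1) = 1 by []; rewrite mul1r.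
  have -> : sgz (Negz n) = -1 by [].
  by rewrite NegzE mulrNz mulNr sinN abszN mulN1r mulNr.
under eq_Rintegral do rewrite re.
under [X in Complex _ X]eq_Rintegral do rewrite im.
rewrite RintegralZl//; last exact: sin_weight_integrable.
by rewrite -/(sin_coef _) sin_coef0 mulr0.
Qed.

End WeightIntegrals.

(** * Autocovariances from the spectral density *)

Section ConjugateTranspose.
Context {R : realType} {p : nat}.
Local Notation C := R[i].
Local Notation M := 'M[C]_p.+1.

Lemma conj_real (r : R) : (real_complex R r)^* = real_complex R r.
Proof. by apply/eqP; rewrite eq_complex/= oppr0 !eqxx. Qed.

Lemma ct_sum N (F : 'I_N -> M) : (\sum_k F k)^t* = \sum_k (F k)^t*.
Proof. by rewrite raddf_sum/= raddf_sum. Qed.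

Lemma ctZ (z : C) (A : M) : (z *: A)^t* = z^* *: A^t*.
Proof. by rewrite linearZ/= map_mxZ. Qed.

Lemma mul_ct_sums N (a b : 'I_N -> C) (G : nat -> M) :
  (\sum_k a k *: G k) * (\sum_k b k *: G k)^t* =
  \sum_(k < N) \sum_(l < N) (a k * (b l)^*) *: (G k * (G l)^t*).
Proof.
rewrite ct_sum mulr_suml; apply: eq_bigr => k _; rewrite mulr_sumr.
by apply: eq_bigr => l _; rewrite ctZ -scalerAl -scalerAr scalerA.
Qed.

End ConjugateTranspose.

(** * Covariances of h as double sums of scalar autocorrelations *)

Section GramLimit.
Context {R : realType} {p : nat}.
Local Notation C := R[i].
Local Notation M := 'M[C]_p.+1.
Variables (d : R) (d01 : 0 < d < half).
Variables (G : nat -> M) (B r : R).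
Hypothesis gG : geometric_bound G B r.
Local Notation om := (farima_coef d G).

Lemma mshift_farima y n N : (n < N)%N ->
  mshift om y n = \sum_(k < N) real_complex R (shifted d (y + k) n) *: G k.
Proof.
move=> nN; rewrite /mshift; have [yn|ny] := leqP y n; last first.
  rewrite big1// => k _.
  by rewrite /shifted leqNgt (leq_trans ny) ?leq_addr//= scale0r.
rewrite /farima_coef conv_scalar /conv.
have le1 : ((n - y).+1 <= N)%N by rewrite (leq_ltn_trans (leq_subr _ _)).
rewrite -(big_mkord xpredT (fun i => G i * scalar_seq (nbinom d) (n - y - i)%N)).
rewrite -(big_mkord xpredT (fun k => real_complex R (shifted d (y + k) n) *: G k)).
rewrite (big_cat_nat (leq0n _) le1)/= [X in _ = _ + X]big_nat [X in _ = _ + X]big1 ?addr0.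
  rewrite !big_nat; apply: eq_bigr => i /=; rewrite ltnS => ni.
  by rewrite -scalar_seqC -mulmxE mul_scalar_mx /shifted -leq_subRL// ni subnDA.
by move=> i /andP[ni _]; rewrite /shifted -leq_subRL// leqNgt ni scale0r.
Qed.

(** A delayed copy of [om] is a combination of delayed copies of c with coefficients [G k], so its
    Gram sums are double sums of truncated scalar autocorrelations. The truncation errors, weighted
    by the summable norms of [G], tend to 0 by [conv_l1_c0]. *)
Lemma cvg_gram (y t : nat) :
  mcvg (fun N => \sum_(n < N) mshift om y n * (mshift om t n)^t* -
    \sum_(k < N) \sum_(l < N)
      real_complex R (autocorr d ((t + l - (y + k)) + (y + k - (t + l)))) *:
        (G k * (G l)^t*)) 0.
Proof.
have [tau [tau0 tauge taud htau]] := shifted_autocorr_tail d01.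
have hG n := geometric_bound_sum n gG; set BG := B / (1 - r) in hG.
have BG0 : 0 <= BG by have := hG 0%N; rewrite big_ord0.
have G0 k := mxnorm_ge0 (G k).
apply: (@mcvg_le _ _ _ _ _ (fun N =>
    (\sum_(k < N) mxnorm (G k) * tau (N - y - k)%N) * BG +
    BG * (\sum_(l < N) mxnorm (G l) * tau (N - t - l)%N))); last first.
  rewrite -[X in _ --> X](_ : 0 * BG + BG * 0 = 0); last by rewrite mul0r mulr0 addr0.
  have h z := conv_l1_c0 z G0 hG tau0 tauge taud.
  by apply: cvgD; apply: cvgM; [exact: h|exact: cvg_cst|exact: cvg_cst|exact: h].
move=> N; rewrite subr0.
have -> : \sum_(n < N) mshift om y n * (mshift om t n)^t* =
    \sum_(k < N) \sum_(l < N) real_complex R (\sum_(n < N) shifted d (y + k) n * shifted d (t + l) n)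
       *: (G k * (G l)^t*).
  under eq_bigr => n _ do rewrite (mshift_farima y (ltn_ord n)) (mshift_farima t (ltn_ord n)).
  under eq_bigr do rewrite mul_ct_sums.
  rewrite exchange_big; apply: eq_bigr => k _; rewrite exchange_big; apply: eq_bigr => l _.
  by rewrite -scaler_suml rmorph_sum; congr (_ *: _); apply: eq_bigr => n _; rewrite rmorphM conj_real.
rewrite -sumrB; apply: (le_trans (mxnorm_sum _ _ _)).
apply: (@le_trans _ _ (\sum_(k < N) \sum_(l < N)
   (mxnorm (G k) * tau (N - y - k)%N * mxnorm (G l) + mxnorm (G k) * (mxnorm (G l) * tau (N - t - l)%N)))).
  apply: ler_sum => k _; rewrite -sumrB; apply: (le_trans (mxnorm_sum _ _ _)).
  apply: ler_sum => l _; rewrite -scalerBl -rmorphB mxnormZ cabs_real distrC.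
  have := htau (y + k)%N (t + l)%N N; rewrite !subnDA => h.
  apply: (le_trans (ler_pM _ _ h (_ : _ <= mxnorm (G k) * mxnorm (G l)))) => //.
  - exact: mxnorm_ge0.
  - by rewrite -mulmxE; apply: (le_trans (mxnormM _ _)); rewrite mxnorm_ct.
  by rewrite le_eqVlt; apply/orP; left; apply/eqP; ring.
under eq_bigr do rewrite big_split/= -mulr_sumr -mulr_sumr.
rewrite big_split/= -!mulr_suml; apply: lerD.
  by apply: ler_wpM2l; [apply: sumr_ge0 => i _; exact: mulr_ge0|exact: hG].
by apply: ler_wpM2r; [apply: sumr_ge0 => i _; exact: mulr_ge0|exact: hG].
Qed.

End GramLimit.


Lemma ReM {R : realType} (x y : R[i]) : complex.Re (x * y) =
  complex.Re x * complex.Re y - complex.Im x * complex.Im y.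
Proof. by case: x => a b; case: y. Qed.

Lemma ImM {R : realType} (x y : R[i]) : complex.Im (x * y) =
  complex.Re x * complex.Im y + complex.Im x * complex.Re y.
Proof. by case: x => a b; case: y. Qed.

Section ComplexIntegrals.
Context {R : realType} {disp : measure_display} {T : measurableType disp}.
Local Notation C := R[i].
Variables (mu : {measure set T -> \bar R}) (D : set T).
Implicit Types f g : T -> C.

Lemma cintegrableD f g : cintegrable mu D f -> cintegrable mu D g -> measurable D ->
  cintegrable mu D (fun t => f t + g t).
Proof.
move=> [f1 f2] [g1 g2] mD; split.
  have := integrable_add f1 g1 mD; congr (mu.-integrable _ _).
  by apply/funext => t /=; case: (f t); case: (g t).
have := integrable_add f2 g2 mD; congr (mu.-integrable _ _).
by apply/funext => t /=; case: (f t); case: (g t).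
Qed.

Lemma cintegralD f g : cintegrable mu D f -> cintegrable mu D g -> measurable D ->
  cintegral mu D (fun t => f t + g t) = cintegral mu D f + cintegral mu D g.
Proof.
move=> [f1 f2] [g1 g2] mD; rewrite /cintegral; apply/eqP; rewrite eq_complex/=.
apply/andP; split; apply/eqP; rewrite -RintegralD//; apply: eq_Rintegral => t _;
  by case: (f t); case: (g t).
Qed.

Lemma cintegrableZ z f : cintegrable mu D f -> measurable D ->
  cintegrable mu D (fun t => z * f t).
Proof.
move=> [f1 f2] mD; split.
  have := integrable_sub (integrable_scale (complex.Re z) f1 mD)
    (integrable_scale (complex.Im z) f2 mD) mD.
  by congr (mu.-integrable _ _); apply/funext => t /=; rewrite ReM.
have := integrable_add (integrable_scale (complex.Re z) f2 mD)
  (integrable_scale (complex.Im z) f1 mD) mD.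
by congr (mu.-integrable _ _); apply/funext => t /=; rewrite ImM.
Qed.

Lemma cintegralZ z f : cintegrable mu D f -> measurable D ->
  cintegral mu D (fun t => z * f t) = z * cintegral mu D f.
Proof.
move=> [f1 f2] mD; rewrite /cintegral; apply/eqP; rewrite eq_complex ReM ImM/=.
have s1 c := integrable_scale c f1 mD; have s2 c := integrable_scale c f2 mD.
apply/andP; split; apply/eqP.
  under eq_Rintegral do rewrite ReM.
  by rewrite RintegralB// !RintegralZl.
under eq_Rintegral do rewrite ImM.
by rewrite RintegralD// !RintegralZl.
Qed.

Lemma cintegrable0 : measurable D -> cintegrable mu D (fun=> 0).
Proof. by move=> mD; split; exact: integrable0. Qed.

Lemma cintegral0 : cintegral mu D (fun=> 0) = 0.
Proof. by rewrite /cintegral /Rintegral integral0. Qed.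

Lemma cintegrable_sum (I : Type) (r : seq I) (F : I -> T -> C) :
  (forall i, cintegrable mu D (F i)) -> measurable D ->
  cintegrable mu D (fun t => \sum_(i <- r) F i t).
Proof.
move=> Fi mD; elim: r => [|i r IH].
  by under eq_fun do rewrite big_nil; exact: cintegrable0.
by under eq_fun do rewrite big_cons; exact: cintegrableD.
Qed.

Lemma cintegral_sum (I : Type) (r : seq I) (F : I -> T -> C) :
  (forall i, cintegrable mu D (F i)) -> measurable D ->
  cintegral mu D (fun t => \sum_(i <- r) F i t) = \sum_(i <- r) cintegral mu D (F i).
Proof.
move=> Fi mD; elim: r => [|i r IH].
  by under eq_fun do rewrite big_nil; rewrite big_nil cintegral0.
under eq_fun do rewrite big_cons.
by rewrite big_cons cintegralD ?IH//; exact: cintegrable_sum.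
Qed.

Lemma cabs_cintegral_le f (v : T -> R) : cintegrable mu D f ->
    mu.-integrable D (EFin \o v) -> measurable D -> (forall t, D t -> cabs (f t) <= v t) ->
  cabs (cintegral mu D f) <= 2 * \int[mu]_(t in D) v t.
Proof.
move=> [f1 f2] vi mD fv; apply: (le_trans (cabs_le_ReIm _)); rewrite mulr_natl mulr2n /=.
have norm_int (h : T -> R) : mu.-integrable D (EFin \o h) ->
    mu.-integrable D (EFin \o (fun t => `|h t|)).
  by move=> hi; exact: (integrable_abse hi).
apply: lerD; apply: (le_trans (le_normr_Rintegral _ _)) => //;
  apply: le_Rintegral => // [|t Dt]; try exact: norm_int;
  apply: le_trans (fv t Dt); [exact: Re_le_cabs|exact: Im_le_cabs].
Qed.

End ComplexIntegrals.

Lemma mxnorm_le_entry {R : realType} m n (A : 'M[R[i]]_(m, n)) (b : R) :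
  (forall i j, cabs (A i j) <= b) -> mxnorm A <= (m * n)%:R * b.
Proof.
move=> Ab; apply: (@le_trans _ _ (\sum_(i < m) \sum_(j < n) b)).
  by apply: ler_sum => i _; apply: ler_sum.
by rewrite !sumr_const !card_ord mulr_natl mulnC mulrnA.
Qed.

Section UnitCircle.
Context {R : realType}.
Local Notation C := R[i].

Lemma cexpiD (s t : R) : cexpi (s + t) = cexpi s * cexpi t.
Proof.
rewrite /cexpi cosD sinD; apply/eqP; rewrite eq_complex ReM ImM/= eqxx/=.
by rewrite addrC [sin s * _]mulrC mulrC [cos s * _]mulrC [sin s * _]mulrC.
Qed.

Lemma cexpi0 : cexpi 0 = 1 :> C.
Proof. by rewrite /cexpi cos0 sin0. Qed.

Lemma cexpiX (t : R) n : cexpi t ^+ n = cexpi (n%:R * t).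
Proof.
elim: n => [|n IH]; first by rewrite mul0r cexpi0.
by rewrite exprS IH -cexpiD -natr1 mulrDl mul1r addrC.
Qed.

Lemma conj_cexpi (t : R) : (cexpi t)^* = cexpi (- t).
Proof. by apply/eqP; rewrite eq_complex/= cosN sinN !eqxx. Qed.

Lemma cabs_cexpi (t : R) : cabs (cexpi t) = 1.
Proof. by rewrite /cabs/= cos2Dsin2 sqrtr1. Qed.

End UnitCircle.

Section FourierAutocovariance.
Context {R : realType} {p : nat}.
Local Notation C := R[i].
Local Notation M := 'M[C]_p.+1.
Notation mu := (@lebesgue_measure R).
Local Notation I := (`[- pi, pi]%classic : set R).
Variables (d : R) (d01 : 0 < d < half).
Local Notation u := (singular_weight d).
Hypothesis ui : mu.-integrable I (EFin \o u).
Variables (G : nat -> M) (B r : R).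
Hypothesis gG : geometric_bound G B r.
Variables (e : int) (e1 : `|e|%N = 1%N) (A w : R -> M).
Hypothesis sA : forall t, msums_to G (cexpi (e%:~R * t)) (A t).
Hypothesis wA : forall t, w t = real_complex R (u t) *: (A t * (A t)^t*).
Hypothesis wi : forall i j, cintegrable mu I (fun t => w t i j).

Lemma cintegrable_weight (k : int) :
  cintegrable mu I (fun t => real_complex R (u t) * cexpi (k%:~R * t)).
Proof.
split.
  have := cos_weight_integrable ui k%:~R; congr (mu.-integrable _ _).
  by apply/funext => t /=; rewrite mul0r subr0 mulrC.
have := sin_weight_integrable ui k%:~R; congr (mu.-integrable _ _).
by apply/funext => t /=; rewrite mul0r addr0 mulrC.
Qed.

Lemma cintegrable_cexpi_mul (f : R -> C) (a : R) : cintegrable mu I f ->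
  cintegrable mu I (fun t => cexpi (a * t) * f t).
Proof.
have mI : measurable I by exact: measurable_itv.
move=> [f1 f2].
have c1 h : mu.-integrable I (EFin \o h) -> mu.-integrable I (EFin \o (fun t => cos (a * t) * h t)).
  move=> hi; apply: integrable_bounded_mul => //; last by move=> t; exact: cos_max.
  by apply: continuous_scale_comp; exact: continuous_cos.
have s1 h : mu.-integrable I (EFin \o h) -> mu.-integrable I (EFin \o (fun t => sin (a * t) * h t)).
  move=> hi; apply: integrable_bounded_mul => //; last by move=> t; exact: sin_max.
  by apply: continuous_scale_comp; exact: continuous_sin.
split.
  have := integrable_sub (c1 _ f1) (s1 _ f2) mI.
  by congr (mu.-integrable _ _); apply/funext => t /=; rewrite ReM.
have := integrable_add (c1 _ f2) (s1 _ f1) mI.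
by congr (mu.-integrable _ _); apply/funext => t /=; rewrite ImM.
Qed.

(** The sign [e] is an orientation of the circle: the factor [A t] is a power series at e^(i e t),
    with e = 1 for g and e = -1 for gtilde. Changing it reverses the sequence of Fourier
    coefficients, so both factorizations of one density are covered. *)
Definition fourier_matrix (k : int) : M :=
  \matrix_(i, j) cintegral mu I (fun t => cexpi (- (e * k)%:~R * t) * w t i j).

Let gram (k : int) N : M := \sum_(m < N) \sum_(l < N)
  real_complex R (weight_mass d * autocorr d (absz (m%:Z - l%:Z - k)%R)) *: (G m * (G l)^t*).

Let trunc t N : M := \sum_(m < N) cexpi (e%:~R * t) ^+ m *: G m.

Let integrand k N t i j : C := cexpi (- (e * k)%:~R * t) *
  (real_complex R (u t) *: (trunc t N * (trunc t N)^t*)) i j.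

Lemma gram_integrand k N i j :
  cintegrable mu I (fun t => integrand k N t i j) /\
  cintegral mu I (fun t => integrand k N t i j) = gram k N i j.
Proof.
have mI : measurable I by exact: measurable_itv.
have E : (fun t => integrand k N t i j) = fun t => \sum_(m < N) \sum_(l < N)
    (G m * (G l)^t*) i j * (real_complex R (u t) * cexpi ((e * (m%:Z - l%:Z - k))%:~R * t)).
  apply/funext => t; rewrite /integrand /trunc mul_ct_sums mxE summxE mulr_sumr mulr_sumr.
  apply: eq_bigr => m _; rewrite summxE mulr_sumr mulr_sumr; apply: eq_bigr => l _.
  rewrite mxE !cexpiX conj_cexpi.
  have -> : (e * (m%:Z - l%:Z - k))%:~R * t =
    - (e * k)%:~R * t + (m%:R * (e%:~R * t) - l%:R * (e%:~R * t)).
    by rewrite !rmorphM/= !rmorphB/=; ring.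
  by rewrite !cexpiD; ring.
have i1 (m l : 'I_N) := cintegrableZ ((G m * (G l)^t*) i j)
  (cintegrable_weight (e * (m%:Z - l%:Z - k))) mI.
rewrite E; split.
  by apply: cintegrable_sum => // m; exact: cintegrable_sum.
rewrite cintegral_sum// => [|m]; last exact: cintegrable_sum.
rewrite /gram summxE; apply: eq_bigr => m _; rewrite cintegral_sum// summxE.
apply: eq_bigr => l _; rewrite cintegralZ//; last exact: cintegrable_weight.
by rewrite cintegral_weight// abszM e1 mul1n [RHS]mxE mulrC.
Qed.

(** The partial sums of the factor converge uniformly on the circle, so replacing the factor by its
    truncation changes the integrand by at most a null sequence times the integrable weight. *)
Lemma cvg_gram_fourier k : mcvg (gram k) (fourier_matrix k).
Proof.
have mI : measurable I by exact: measurable_itv.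
have G0 m := mxnorm_ge0 (G m).
have hG n := geometric_bound_sum n gG; set BG := B / (1 - r) in hG.
have BG0 : 0 <= BG by have := hG 0%N; rewrite big_ord0.
have [tau [tau0 _ taud htau]] := sum_tail G0 hG.
have z1 (t : R) : cabs (cexpi (e%:~R * t)) = 1 by exact: cabs_cexpi.
have term t m : mxnorm (cexpi (e%:~R * t) ^+ m *: G m) = mxnorm (G m).
  by rewrite mxnormZ cabsX z1 expr1n mul1r.
have bT t N : mxnorm (trunc t N) <= BG.
  by apply: (le_trans (mxnorm_sum _ _ _)); under eq_bigr do rewrite term; exact: hG.
have bA t : mxnorm (A t) <= BG.
  by apply: (mcvg_norm_le (sA t)); apply: nearW => N; exact: bT.
have bD t N : mxnorm (A t - trunc t N) <= tau N.
  apply: (mcvg_norm_le (mcvgB (sA t) (mcvg_cst (trunc t N)))).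
  exists N => // n /= Nn; rewrite /trunc.
  rewrite -(sum_nat_diff (fun m : nat => cexpi (e%:~R * t) ^+ m *: G m) Nn).
  apply: (le_trans (mxnorm_sum _ _ _)); under eq_bigr do rewrite term; exact: htau.
have bP t N : mxnorm (A t * (A t)^t* - trunc t N * (trunc t N)^t*) <= 2 * BG * tau N.
  have -> : A t * (A t)^t* - trunc t N * (trunc t N)^t* =
      (A t - trunc t N) * (A t)^t* + trunc t N * (A t - trunc t N)^t*.
    by rewrite raddfB/= raddfB/= mulrBl mulrBr addrA subrK.
  apply: (le_trans (mxnormD _ _)).
  have -> : 2 * BG * tau N = tau N * BG + BG * tau N by ring.
  by apply: lerD; rewrite -mulmxE; apply: (le_trans (mxnormM _ _)); rewrite mxnorm_ct;
    apply: ler_pM; rewrite ?mxnorm_ge0// mxnorm_ct.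
pose U := \int[mu]_(t in I) u t.
apply: (@mcvg_le _ _ _ _ _ (fun N => (p.+1 * p.+1)%:R * (2 * (2 * BG * tau N * U)))); last first.
  rewrite -[X in _ --> X](_ : (p.+1 * p.+1)%:R * (2 * (2 * BG * 0 * U)) = 0).
    by do ![apply: cvgM; try exact: cvg_cst].
  by rewrite !(mulr0, mul0r).
move=> N; apply: mxnorm_le_entry => i j; rewrite !mxE cabsB_sym.
have [g1 g2] := gram_integrand k N i j; rewrite -g2.
have w1 := cintegrable_cexpi_mul (- (e * k)%:~R) (wi i j).
have -> : cintegral mu I (fun t => cexpi (- (e * k)%:~R * t) * w t i j) -
    cintegral mu I (fun t => integrand k N t i j) =
  cintegral mu I (fun t => cexpi (- (e * k)%:~R * t) * w t i j + -1 * integrand k N t i j).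
  by rewrite cintegralD// ?cintegralZ// ?mulN1r//; exact: cintegrableZ.
have i2 := integrable_scale (2 * BG * tau N) ui mI.
rewrite -RintegralZl//.
apply: (cabs_cintegral_le _ i2 mI) => [|t _].
  by apply: cintegrableD => //; exact: cintegrableZ.
rewrite mulN1r -mulrBr cabsM cabs_cexpi mul1r wA !mxE -mulrBr cabsM cabs_real.
have u0 : 0 <= u t by exact: powR_ge0.
rewrite ger0_norm// mulrC ler_wpM2r//; apply: le_trans (bP t N).
have := mxnorm_entry (A t * (A t)^t* - trunc t N * (trunc t N)^t*) i j.
by rewrite !mxE.
Qed.

(** Both sides are compared with the same finite double sums of scalar autocorrelations; dividing by
    [weight_mass] matches the integrals of the weight to these autocorrelations. *)
Lemma fourier_autocov :
  autocov (farima_coef d G) (fun k => real_complex R (weight_mass d)^-1 *: fourier_matrix k).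
Proof.
move=> y t; set L := _ *: _.
have h1 : mcvg (fun N => \sum_(k < N) \sum_(l < N)
      real_complex R (autocorr d ((t + l - (y + k)) + (y + k - (t + l)))) *:
        (G k * (G l)^t*)) L.
  have : mcvg (fun N => (real_complex R (weight_mass d)^-1)%:M *m gram (t%:Z - y%:Z) N)
      ((real_complex R (weight_mass d)^-1)%:M *m fourier_matrix (t%:Z - y%:Z)).
    by apply: mcvgMl; exact: cvg_gram_fourier.
  rewrite mul_scalar_mx; congr (mcvg _ _); apply/funext => N.
  rewrite mul_scalar_mx scaler_sumr; apply: eq_bigr => k _.
  rewrite scaler_sumr; apply: eq_bigr => l _; rewrite scalerA -rmorphM mulKf; last first.
    by rewrite gt_eqF// weight_mass_gt0.
  by congr (real_complex R (autocorr d _) *: _); lia.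
have := mcvgD (cvg_gram d01 gG y t) h1; rewrite add0r; congr (mcvg _ _).
by apply/funext => N; rewrite subrK.
Qed.

End FourierAutocovariance.

(** * FARIMA processes *)

Lemma integrable_rsum {R : realType} (disp : measure_display) (T : measurableType disp)
    (mu : {measure set T -> \bar R}) (D : set T) (I : Type) (r : seq I) (F : I -> T -> R) :
  (forall i, mu.-integrable D (EFin \o F i)) -> measurable D ->
  mu.-integrable D (EFin \o (fun t => \sum_(i <- r) F i t)).
Proof.
move=> Fi mD; elim: r => [|i r IH].
  by under eq_fun do rewrite big_nil; exact: integrable0.
by under eq_fun do rewrite big_cons; exact: integrable_add.
Qed.

Section WeightIntegrable.
Context {R : realType} {p : nat}.
Local Notation C := R[i].
Local Notation M := 'M[C]_p.+1.
Notation mu := (@lebesgue_measure R).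
Local Notation I := (`[- pi, pi]%classic : set R).
Variables (d BD : R) (A D w : R -> M).
Local Notation u := (singular_weight d).
Hypothesis wA : forall t, w t = real_complex R (u t) *: (A t * (A t)^t*).
Hypothesis DA : forall t, D t * A t = 1.
Hypothesis DB : forall t, mxnorm (D t) <= BD.

Lemma singular_weight_le t : u t <= BD ^+ 2 * mxnorm (w t).
Proof.
have u0 : 0 <= u t by exact: powR_ge0.
have E : real_complex R (u t) *: (1 : M) = D t * w t * (D t)^t*.
  rewrite wA -scalerAr -scalerAl mulrA DA mul1r -[1 in LHS](_ : (D t * A t)^t* = 1).
    by rewrite -!mulmxE trmx_mul map_mxM.
  by rewrite DA trmx1 map_mx1.
have : u t <= mxnorm (real_complex R (u t) *: (1 : M)).
  rewrite mxnormZ cabs_real ger0_norm// -[1]/(1%:M) mxnorm_scalar cabs1 mulr1.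
  by rewrite ler_peMr// ler1n.
move=> /le_trans -> //; rewrite E -!mulmxE; apply: (le_trans (mxnormM _ _)).
rewrite mxnorm_ct (_ : BD ^+ 2 * _ = BD * mxnorm (w t) * BD); last by ring.
apply: ler_pM; rewrite ?mxnorm_ge0//; apply: (le_trans (mxnormM _ _)).
by apply: ler_wpM2r => //; exact: mxnorm_ge0.
Qed.

(** Integrability of the scalar weight is inherited from the spectral density: with [D] the bounded
    inverse of the factor [A], conjugating w by [D] gives the weight times the identity. *)
Lemma singular_weight_integrable : (forall i j, cintegrable mu I (fun t => w t i j)) ->
  mu.-integrable I (EFin \o u).
Proof.
move=> wi; have mI : measurable I by exact: measurable_itv.
have ni (h : R -> R) : mu.-integrable I (EFin \o h) ->
  mu.-integrable I (EFin \o (fun t => `|h t|)) by move=> hi; exact: (integrable_abse hi).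
pose v t := BD ^+ 2 * \sum_i \sum_j (`|complex.Re (w t i j)| + `|complex.Im (w t i j)|).
have vi : mu.-integrable I (EFin \o v).
  apply: integrable_scale => //; apply: integrable_rsum => // i.
  apply: integrable_rsum => // j; have [w1 w2] := wi i j.
  by apply: integrable_add => //; exact: ni.
apply: le_integrable vi => //.
  apply/measurable_realfun.measurable_EFinP.
  apply: (@measurableT_comp _ _ _ _ _ _ (@powR R ^~ (- (2 * d)))) => //.
  apply: measurableT_comp => //.
  apply: measurable_realfun.subspace_continuous_measurable_fun => //.
  by apply: continuous_subspaceT; exact: continuous_chord.
move=> t _ /=; rewrite lee_fin ger0_norm; last exact: powR_ge0.
apply: le_trans (ler_norm _); apply: (le_trans (singular_weight_le t)).
apply: ler_wpM2l; first exact: sqr_ge0.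
by apply: ler_sum => i _; apply: ler_sum => j _; exact: cabs_le_ReIm.
Qed.

End WeightIntegrable.

(** * Normal equations of the finite predictor *)

Section NormalEquations.
Context {R : realType} {disp : measure_display} {Omega : measurableType disp}.
Variable P : probability Omega R.
Local Notation C := R[i].

Lemma cL2_mul_cintegrable (x y : Omega -> C) : cL2 P x -> cL2 P y ->
  cintegrable P setT (fun o => x o * (y o)^*).
Proof.
move=> [x1 x2] [y1 y2].
have i11 := (Lfun1_integrable _ _).1 (Lfun2_mul_Lfun1 x1 y1).
have i12 := (Lfun1_integrable _ _).1 (Lfun2_mul_Lfun1 x1 y2).
have i21 := (Lfun1_integrable _ _).1 (Lfun2_mul_Lfun1 x2 y1).
have i22 := (Lfun1_integrable _ _).1 (Lfun2_mul_Lfun1 x2 y2).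
split.
  have := integrable_add i11 i22 measurableT; congr (_.-integrable _ _).
  by apply/funext => o /=; case: (x o) => a b; case: (y o) => a' b' /=; rewrite mulrN opprK.
have := integrable_sub i21 i12 measurableT; congr (_.-integrable _ _).
by apply/funext => o /=; case: (x o) => a b; case: (y o) => a' b' /=; rewrite mulrN addrC.
Qed.

Variables (q : nat) (X : int -> Omega -> 'cV[C]_q).
Hypothesis X2 : forall k i, cL2 P (fun o => X k o i 0).

Lemma normal_equations n (phi : nat -> 'M[C]_q) : backward_finite_predictor P X n phi ->
  forall m, (0 < m <= n)%N ->
  covmx P X (- n.+1%:Z) (- m%:Z) =
  \sum_(1 <= j < n.+1) phi j *m covmx P X (- (n.+1 - j)%N%:Z) (- m%:Z).
Proof.
move=> hphi m /andP[m0 mn]; apply/matrixP => i i'; rewrite mxE summxE.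
have [_ /(_ (fun o => X (- m%:Z) o i' 0))] := hphi i.
have Vm : past_span X n (fun o => X (- m%:Z) o i' 0).
  exists (fun k l => ((k == m) && (l == i'))%:R); apply/funext => o.
  rewrite (bigD1_seq m)/= ?iota_uniq ?mem_index_iota ?m0 ?ltnS//.
  rewrite (bigD1 i')//= !eqxx mul1r big1 ?addr0 => [|l li]; last by rewrite (negbTE li) mul0r.
  rewrite [X in _ + X]big1 ?addr0// => k km.
  by rewrite big1// => l _; rewrite (negbTE km) mul0r.
move=> /(_ Vm).
have xi (k : int) l := cL2_mul_cintegrable (X2 k l) (X2 (- m%:Z) i').
pose F (j : nat) (l : 'I_q) o := phi j i l * (X (- (n.+1 - j)%N%:Z) o l 0 * (X (- m%:Z) o i' 0)^*).
have Fi j l : cintegrable P setT (F j l) by exact: cintegrableZ.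
rewrite /cinner /cexpectation => h.
have : cintegral P setT (fun o => X (- n.+1%:Z) o i 0 * (X (- m%:Z) o i' 0)^* +
    -1 * (\sum_(1 <= j < n.+1) \sum_l F j l o)) = 0.
  rewrite -[RHS]h; congr cintegral; apply/funext => o.
  rewrite mulN1r mulrBl summxE mulr_suml; congr (_ - _); apply: eq_bigr => j _.
  by rewrite mxE mulr_suml; apply: eq_bigr => l _; rewrite /F mulrA.
have Si : cintegrable P setT (fun o => \sum_(1 <= j < n.+1) \sum_l F j l o).
  by apply: cintegrable_sum => // j; exact: cintegrable_sum.
rewrite cintegralD// ?cintegralZ//; last exact: cintegrableZ.
rewrite mulN1r => /eqP; rewrite subr_eq0 => /eqP ->.
rewrite cintegral_sum// => [|j]; last exact: cintegrable_sum.
apply: eq_bigr => j _; rewrite cintegral_sum// mxE; apply: eq_bigr => l _.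
by rewrite cintegralZ// mxE.
Qed.

End NormalEquations.

(** * Comparison of the operator norm with the entrywise norm *)

Section OperatorNorm.
Context {R : realType} {q : nat}.
Local Notation C := R[i].
Implicit Types (A : 'M[C]_q) (v : 'cV[C]_q).

Lemma vnorm_entry v i : cabs (v i 0) <= vnorm v.
Proof.
rewrite -[leLHS]ger0_norm ?cabs_ge0// -sqrtr_sqr ler_wsqrtr//.
by rewrite (bigD1 i)//= lerDl sumr_ge0// => j _; exact: sqr_ge0.
Qed.

Lemma vnorm_le_sum v : vnorm v <= \sum_i cabs (v i 0).
Proof.
have s0 : 0 <= \sum_i cabs (v i 0) by apply: sumr_ge0 => i _; exact: cabs_ge0.
rewrite -[leRHS]ger0_norm// -sqrtr_sqr ler_wsqrtr// expr2 mulr_suml.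
apply: ler_sum => i _; rewrite expr2 ler_wpM2l ?cabs_ge0//.
by rewrite (bigD1 i)//= lerDl sumr_ge0// => j _; exact: cabs_ge0.
Qed.

Lemma vnorm_mulmx_le A v : vnorm v <= 1 -> vnorm (A *m v) <= mxnorm A.
Proof.
move=> v1; apply: (le_trans (vnorm_le_sum _)); apply: ler_sum => i _.
rewrite mxE; apply: (le_trans (cabs_sum _ _ _)); apply: ler_sum => j _.
by rewrite cabsM ler_piMr ?cabs_ge0// (le_trans (vnorm_entry v j)).
Qed.

Lemma vnorm0 : vnorm (0 : 'cV[C]_q) = 0.
Proof. by rewrite /vnorm big1 ?sqrtr0// => i _; rewrite mxE cabs0 expr0n. Qed.

Lemma opnorm_le_mxnorm A : opnorm A <= mxnorm A.
Proof.
apply: ge_sup.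
  by exists (vnorm (A *m 0)), 0 => //=; rewrite vnorm0.
by move=> _ [v /= v1 <-]; exact: vnorm_mulmx_le.
Qed.

Lemma entry_le_opnorm A i j : cabs (A i j) <= opnorm A.
Proof.
have d1 : vnorm (delta_mx j 0 : 'cV[C]_q) <= 1.
  apply: (le_trans (vnorm_le_sum _)); rewrite (bigD1 j)//= big1 ?addr0 => [|k kj].
    by rewrite mxE !eqxx cabs1.
  by rewrite mxE (negbTE kj) cabs0.
apply: (@le_trans _ _ (vnorm (A *m delta_mx j 0))).
  by apply: le_trans (vnorm_entry _ i); rewrite -colE mxE.
apply: sup_upper_bound; last by exists (delta_mx j 0).
split; first by exists (vnorm (A *m delta_mx j 0)), (delta_mx j 0).
by exists (mxnorm A) => _ [v /= v1 <-]; exact: vnorm_mulmx_le.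
Qed.

Lemma opnorm_ge0 A : 0 <= opnorm A.
Proof.
apply: (@le_trans _ _ (vnorm (A *m 0))); first exact: sqrtr_ge0.
apply: sup_upper_bound; last by exists 0 => //=; rewrite vnorm0.
split; first by exists (vnorm (A *m 0)), 0 => //=; rewrite vnorm0.
by exists (mxnorm A) => _ [v /= v1 <-]; exact: vnorm_mulmx_le.
Qed.

Lemma mxnorm_le_opnorm A : mxnorm A <= (q * q)%:R * opnorm A.
Proof. by apply: mxnorm_le_entry => i j; exact: entry_le_opnorm. Qed.

End OperatorNorm.


Lemma closed_disk_cexpi {R : realType} (t : R) : closed_disk (cexpi t).
Proof. by rewrite /closed_disk /mkset cabs_cexpi. Qed.

Lemma half_line_ext {R : realType} {p : nat} (d : R) (gam gam' : int -> 'M[R[i]]_p.+1) kern :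
  gam =1 gam' -> half_line d gam kern -> half_line d gam' kern.
Proof. by move=> /funext ->. Qed.

Section FarimaProcess.
Context {R : realType} {p : nat}.
Local Notation C := R[i].
Local Notation M := 'M[C]_p.+1.
Variables (d : R) (d01 : 0 < d < half).
Variables (g gt : C -> M).
Hypotheses (hg : rational_invertible_on_disk g) (hgt : rational_invertible_on_disk gt).
Hypothesis hgg : forall t : R,
  g (cexpi (- t)) *m (g (cexpi (- t)))^t* = gt (cexpi t) *m (gt (cexpi t))^t*.
Let w (t : R) := farima_density d g (cexpi t).
Hypothesis wi : forall i j, cintegrable (@lebesgue_measure R) `[- pi, pi]%classic
  (fun t => w t i j).

(** Up to a positive scalar, harmless in homogeneous equations, this is the covariance of X_m with
    X_(m+k). With this orientation the factor is gtilde, as backward prediction requires. *)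
Definition farima_autocov (k : int) : M :=
  real_complex R (weight_mass d)^-1 *: fourier_matrix (- 1) w k.

(** The two factorizations of the density related by [hgg] give the two ends of an interval: gtilde
    yields the kernel of the covariance sequence, g that of the reversed sequence. *)
Lemma farima_half_lines (a : nat -> M) : ar_coefficients (farima_h d gt) a ->
  exists kern kern', [/\ half_line d farima_autocov kern,
    half_line d (fun k => farima_autocov (- k)) kern' &
    forall y, infinite_predictor (farima_h d gt) a y.+1 = kern 1%N y].
Proof.
move=> ha; have [_ g0] := hg; have [_ gt0] := hgt.
have [G [H [B [r [gG gH GH HG sGH]]]]] := rational_invertible_series hg.
have [G' [H' [B' [r' [gG' gH' GH' HG' sGH']]]]] := rational_invertible_series hgt.
have wg t : w t = real_complex R (singular_weight d t) *: (g (cexpi t) * (g (cexpi t))^t*).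
  by rewrite /w /farima_density cabs_chord.
have wgt t : w t = real_complex R (singular_weight d t) *:
    (gt (cexpi (- t)) * (gt (cexpi (- t)))^t*).
  by rewrite wg -!mulmxE -hgg opprK.
have sH t := (sGH _ (closed_disk_cexpi t)).2.
have ui : (@lebesgue_measure R).-integrable `[- pi, pi]%classic (EFin \o singular_weight d).
  apply: (@singular_weight_integrable _ _ d (B / (1 - r)) (fun t => g (cexpi t))
    (fun t => invmx (g (cexpi t))) w wg _ _ wi) => t.
    by rewrite -mulmxE mulVmx// unitmxE unitfE; apply: g0; exact: closed_disk_cexpi.
  apply: (mcvg_norm_le (sH t)); apply: nearW => n.
  apply: (le_trans (mxnorm_sum _ _ _)); apply: le_trans (geometric_bound_sum n gH).
  by apply: ler_sum => k _; rewrite mxnormZ cabsX cabs_cexpi expr1n mul1r.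
have sG t : msums_to G (cexpi (1%:~R * t)) (g (cexpi t)).
  by rewrite mul1r; exact: (sGH _ (closed_disk_cexpi t)).1.
have sG' t : msums_to G' (cexpi ((- 1)%:~R * t)) (gt (cexpi (- t))).
  rewrite rmorphN rmorph1 mulN1r; exact: (sGH' _ (closed_disk_cexpi (- t))).1.
have cov1 := fourier_autocov d01 ui gG (erefl : `|1 : int|%N = 1%N) sG wg wi.
have cov2 := fourier_autocov d01 ui gG' (erefl : `|- 1 : int|%N = 1%N) sG' wgt wi.
exists (half_kernel d G' H'), (half_kernel d G H); split.
- have [B0 r01 GB] := gG'; have [_ _ HB] := gH'.
  exact: (farima_half_line d01 B0 r01 GB HB GH' HG' cov2).
- have [B0 r01 GB] := gG; have [_ _ HB] := gH.
  apply: half_line_ext (farima_half_line d01 B0 r01 GB HB GH HG cov1) => k.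
  by rewrite /farima_autocov /fourier_matrix mulNr mulrN opprK mul1r.
move=> y; apply: (infinite_predictor_kernel d01 gH' GH' gt0 _ _ ha) => z z1.
  exact: (sGH' z z1).1.
exact: (sGH' z z1).2.
Qed.

End FarimaProcess.

Theorem corollary6p10 (R : realType) (disp : measure_display)
    (Omega : measurableType disp) (P : probability Omega R)
    (q : nat) (hq : (0 < q)%N)
    (d : R) (hd : 0 < d < 2^-1)
    (X : int -> Omega -> 'cV[R[i]]_q)
    (hX : centered_weakly_stationary P X)
    (g : R[i] -> 'M[R[i]]_q) (hg : rational_invertible_on_disk g)
    (hw : has_spectral_density P X (farima_density d g))
    (gtilde : R[i] -> 'M[R[i]]_q) (hgtilde : rational_invertible_on_disk gtilde)
    (hgg : forall t : R,
       g (cexpi (- t)) *m (g (cexpi (- t)))^t* =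
       gtilde (cexpi t) *m (gtilde (cexpi t))^t*)
    (a : nat -> 'M[R[i]]_q) (ha : ar_coefficients (farima_h d gtilde) a)
    (phi_fin : nat -> nat -> 'M[R[i]]_q)
    (hphi_fin : forall n : nat, (0 < n)%N ->
       backward_finite_predictor P X n (phi_fin n)) :
  let phi := infinite_predictor (farima_h d gtilde) a in
  exists K : R, 0 < K /\
    forall n : nat, (0 < n)%N ->
      ((\sum_(1 <= j < n.+1) opnorm (phi_fin n j - phi j))%:E
       <= K%:E * \sum_(n.+1 <= j <oo) (opnorm (phi j))%:E)%E.
Proof.
(* Writing q = p + 1 makes the square matrices a nonzero ring. *)
case: q hq X hX g hg hw gtilde hgtilde hgg a ha phi_fin hphi_fin => // p _ X [X2 _ _] g hg
  [wi _ covE] gtilde hgt hgg a ha phi_fin hphi phi.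
have [kern [kern' [hl hl' phiE]]] := farima_half_lines hd hg hgt hgg wi ha.
pose kap : R[i] := real_complex R ((weight_mass d)^-1 * (2 * pi)).
have acE (m n : int) : farima_autocov d g (n - m) = kap *: covmx P X m n.
  have pi2 : 2 * pi != 0 :> R by rewrite mulf_neq0 ?pnatr_eq0// gt_eqF// pi_gt0.
  apply/matrixP => i j; rewrite [LHS]mxE [X in _ * X]mxE [RHS]mxE covE mulrA -rmorphM -mulrA mulfV// mulr1.
  congr (_ * cintegral _ _ _); apply/funext => t.
  by rewrite mulN1r opprB mulNr.
(* Position l of the interval stands for X_(-(n - l)), so 0, ..., n - 1 run through X_(-n), ...,
   X_(-1), and the predicted X_(-(n + 1)) sits at distance 1 to the left. *)
have hphi' n l : (0 < n)%N -> (l < n)%N ->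
    toep (farima_autocov d g) n (fun j => phi_fin n j.+1) l = farima_autocov d g l.+1.
  move=> n0 ln.
  have := normal_equations X2 (hphi n n0) (m := n - l) _.
  rewrite subn_gt0 ln leq_subr => /(_ isT) h.
  rewrite (_ : (l.+1 : int) = - (n - l)%N%:Z - - n.+1%:Z); last by lia.
  rewrite acE h scaler_sumr big_add1 big_mkord; apply: eq_bigr => j _.
  rewrite scalemxAr -acE mulmxE; congr (_ * farima_autocov d g _); rewrite subSS.
  by rewrite -!subzn ?(ltnW ln) ?(ltnW (ltn_ord j))//; ring.
have [K0 K00 hK] := baxter_inequality hd hl hl' hphi'.
(* The factor q^2 is the price of returning from [mxnorm] to [opnorm] on the right; on the left
   [opnorm <= mxnorm] is free. *)
pose K := K0 * (p.+1 * p.+1)%:R; have K_gt0 : 0 < K by rewrite mulr_gt0// ltr0n.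
exists K; split => // n n0; set S := (\sum_(n.+1 <= j <oo) _)%E.
have S0 : (0 <= S)%E by apply: nneseries_ge0 => j _ _; rewrite lee_fin opnorm_ge0.
(* The tail is an extended real; were it infinite, the right-hand side would be +oo since K > 0. *)
have [Sfin|] := boolP (S \is a fin_num); last first.
  rewrite ge0_fin_numE// -leNgt leye_eq => /eqP ->.
  by rewrite gt0_muley ?lte_fin// leey.
rewrite -(fineK Sfin) -EFinM lee_fin.
apply: (@le_trans _ _ (\sum_(j < n) mxnorm (phi_fin n j.+1 - kern 1%N j))).
  rewrite big_add1 big_mkord; apply: ler_sum => j _.
  by rewrite /phi phiE opnorm_le_mxnorm.
rewrite /K -mulrA; apply: hK => // Y.
apply: (@le_trans _ _ ((p.+1 * p.+1)%:R * \sum_(n.+1 <= j < Y.+1) opnorm (phi j))).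
  rewrite big_add1/= mulr_sumr; apply: ler_sum => y _.
  by rewrite -phiE mxnorm_le_opnorm.
rewrite ler_wpM2l// -lee_fin fineK// -sumEFin.
by apply: nneseries_lim_ge => j _ _; rewrite lee_fin opnorm_ge0.
Qed.
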